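(* Let $\mathcal{C}$ be either $\mathcal{C}_{HS}$ or $\mathcal{C}_P$. Let $G_1$ and $G_2$ be finitely generated flexibly $\mathcal{C}$-stable groups, let $H$ be a finite group and let $i_j\colon H\to G_j$ $(j=1,2)$ be injective homomorphisms such that $i_j(H)$ is almost normal in $G_j$ for $j=1,2$. Then the amalgamated free product $G_1*_HG_2$ is flexibly $\mathcal{C}$-stable.
   Context: $\mathcal{C}_{HS}$ is the class of groups $\mathrm{Aut}(X)$, where $X$ is a finite-dimensional Hilbert space and $\mathrm{Aut}(X)$ is its unitary group, with the metric $d(A_1,A_2)=\|A_1-A_2\|_{HS}$, $\|A\|_{HS}=\mathrm{Tr}(A^*A)^{1/2}$, $\mathrm{Tr}$ the normalized trace on $X$ (write $\|\cdot\|_{HS,X}$ to indicate $X$). $\mathcal{C}_P$ is the class of groups $\mathrm{Aut}(X)$, where $X$ is a finite set and $\mathrm{Aut}(X)$ is its symmetric group, with the normalized Hamming metric $d(\sigma_1,\sigma_2)=\frac{1}{|X|}\#\{x\in X:\sigma_1(x)\neq\sigma_2(x)\}$. $|X|$ denotes the dimension of the Hilbert space, respectively the size of the set. Flexible stability. A group $G$ is flexibly $\mathcal{C}$-stable if for any sequence of maps $\varphi_n\colon G\to\mathrm{Aut}(X_n)\in\mathcal{C}$ with $d(\varphi_n(g)\varphi_n(h),\varphi_n(gh))\to0$ for all $g,h\in G$ there are $Y_n\supseteq X_n$ (finite-dimensional Hilbert spaces, respectively finite sets) with $|Y_n|/|X_n|\to1$ and homomorphisms $\psi_n\colon G\to\mathrm{Aut}(Y_n)$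 such that for all $g\in G$: in the case $\mathcal{C}_{HS}$, $\|\varphi_n(g)-p_n\psi_n(g)p_n\|_{HS,X_n}\to0$, where $p_n$ is the orthogonal projection of $Y_n$ onto $X_n$; in the case $\mathcal{C}_P$, $\frac{1}{|X_n|}\#\{x\in X_n:\varphi_n(g)(x)\ne\psi_n(g)(x)\}\to0$. A subgroup $H\le G$ is almost normal if there is a subgroup $H_1$ with $H\trianglelefteq H_1\le G$ and $[G:H_1]<\infty$ (i.e. the normalizer of $H$ has finite index in $G$). $G_1*_HG_2:=(G_1*G_2)/\langle\langle i_1(h)i_2(h)^{-1}: h\in H\rangle\rangle$. *)

(* Defs.v *)
From HB Require Import structures.
From mathcomp Require Import all_boot all_order all_algebra all_fingroup.
From mathcomp Require Import generic_quotient spectral sesquilinear complex.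
From mathcomp Require Import all_classical all_reals all_analysis.
Set Implicit Arguments.
Unset Strict Implicit.
Unset Printing Implicit Defensive.

Import Order.TTheory GRing.Theory Num.Theory.
Import numFieldNormedType.Exports.

Local Open Scope classical_set_scope.
Local Open Scope quotient_scope.
Local Open Scope group_scope.

(* Arbitrary (possibly infinite) groups are [groupType]s; their subgroups are
   represented as classical sets satisfying [is_subgroup]. *)

Section Subgroups.
Variable G : groupType.
Implicit Types A B S : set G.

Definition is_subgroup A : Prop :=
  A 1 /\ forall x y, A x -> A y -> A (x * y^-1).

Definition is_normal_in A B : Prop :=
  [/\ is_subgroup A, is_subgroup B, A `<=` B
    & forall x y, B x -> A y -> A (y ^ x)].

Definition finite_index A : Prop :=
  finite_set [set [set x * a | a in A] | x in [set: G]].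

Definition almost_normal A : Prop :=
  exists B, is_normal_in A B /\ finite_index B.

Definition generated_subgroup S : set G :=
  \bigcap_(A in [set A | is_subgroup A /\ S `<=` A]) A.

Definition finitely_generated : Prop :=
  exists S, finite_set S /\ generated_subgroup S = [set: G].

Definition normal_closure S : set G :=
  \bigcap_(A in [set A | is_normal_in A [set: G] /\ S `<=` A]) A.

End Subgroups.

(* A type with operations that satisfy the group axioms up to a congruence
   [sg_eqv]; its quotient [setoid_quot] is a [groupType]. Both the free product
   and the quotient of a group by a normal closure are obtained this way. *)
Record setoid_group := SetoidGroup {
  sg_car :> choiceType;
  sg_eqv : sg_car -> sg_car -> Prop;
  sg_one : sg_car;
  sg_mul : sg_car -> sg_car -> sg_car;
  sg_inv : sg_car -> sg_car;
  sg_refl : forall x, sg_eqv x x;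
  sg_sym : forall x y, sg_eqv x y -> sg_eqv y x;
  sg_trans : forall x y z, sg_eqv x y -> sg_eqv y z -> sg_eqv x z;
  sg_mul_compat : forall x x' y y',
    sg_eqv x x' -> sg_eqv y y' -> sg_eqv (sg_mul x y) (sg_mul x' y');
  sg_inv_compat : forall x x', sg_eqv x x' -> sg_eqv (sg_inv x) (sg_inv x');
  sg_mulA : forall x y z,
    sg_eqv (sg_mul x (sg_mul y z)) (sg_mul (sg_mul x y) z);
  sg_mul1 : forall x, sg_eqv (sg_mul sg_one x) x;
  sg_mulr1 : forall x, sg_eqv (sg_mul x sg_one) x;
  sg_mulV : forall x, sg_eqv (sg_mul (sg_inv x) x) sg_one;
  sg_mulrV : forall x, sg_eqv (sg_mul x (sg_inv x)) sg_one
}.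

Section SetoidQuotient.
Variable P : setoid_group.

Definition sg_rel (x y : P) : bool := `[< sg_eqv x y >].

Lemma sg_rel_equiv : equiv_class_of sg_rel.
Proof.
split=> [x|x y|y x z].
- by apply/asboolP; exact: sg_refl.
- by apply/asboolP/asboolP; exact: sg_sym.
- by move=> /asboolP xy /asboolP yz; apply/asboolP; exact: sg_trans yz.
Qed.

Canonical sg_equiv := EquivRelPack sg_rel_equiv.

Definition setoid_quot := {eq_quot sg_equiv}.

Definition setoid_pi (x : P) : setoid_quot := \pi_{eq_quot sg_equiv} x.

Lemma setoid_piP x y : setoid_pi x = setoid_pi y <-> sg_eqv x y.
Proof.
by split=> [/eqP|xy]; [rewrite eqmodE => /asboolP | apply/eqmodP/asboolP].
Qed.

HB.instance Definition _ := Choice.on setoid_quot.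

Let qone : setoid_quot := setoid_pi (sg_one P).
Let qmul (a b : setoid_quot) : setoid_quot :=
  setoid_pi (sg_mul (repr a) (repr b)).
Let qinv (a : setoid_quot) : setoid_quot := setoid_pi (sg_inv (repr a)).

Let repr_eqv x : sg_eqv (repr (setoid_pi x)) x.
Proof. by apply/setoid_piP; rewrite /setoid_pi reprK. Qed.

Let qmulE x y : qmul (setoid_pi x) (setoid_pi y) = setoid_pi (sg_mul x y).
Proof. by apply/setoid_piP; apply: sg_mul_compat; exact: repr_eqv. Qed.

Let qinvE x : qinv (setoid_pi x) = setoid_pi (sg_inv x).
Proof. by apply/setoid_piP; apply: sg_inv_compat; exact: repr_eqv. Qed.

Lemma setoid_piW (K : setoid_quot -> Prop) :
  (forall x, K (setoid_pi x)) -> forall a, K a.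
Proof. exact: (@quotW _ {eq_quot sg_equiv}). Qed.

Let qmulA : associative qmul.
Proof.
elim/setoid_piW=> x; elim/setoid_piW=> y; elim/setoid_piW=> z.
by rewrite !qmulE; apply/setoid_piP; exact: sg_mulA.
Qed.
Let qmul1 : left_id qone qmul.
Proof. by elim/setoid_piW=> x; rewrite qmulE; apply/setoid_piP; exact: sg_mul1. Qed.
Let qmulr1 : right_id qone qmul.
Proof. by elim/setoid_piW=> x; rewrite qmulE; apply/setoid_piP; exact: sg_mulr1. Qed.
Let qmulV : left_inverse qone qinv qmul.
Proof.
by elim/setoid_piW=> x; rewrite qinvE qmulE; apply/setoid_piP; exact: sg_mulV.
Qed.
Let qmulrV : right_inverse qone qinv qmul.
Proof.
by elim/setoid_piW=> x; rewrite qinvE qmulE; apply/setoid_piP; exact: sg_mulrV.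
Qed.

HB.instance Definition _ :=
  isGroup.Build setoid_quot qmulA qmul1 qmulr1 qmulV qmulrV.

Lemma setoid_piM x y : setoid_pi (sg_mul x y) = setoid_pi x * setoid_pi y.
Proof. by rewrite -qmulE. Qed.

End SetoidQuotient.

Section QuotientByNormalClosure.
Variables (G : groupType) (S : set G).
Local Notation N := (normal_closure S).

Lemma normal_closure1 : N 1.
Proof. by move=> A [[[A1 _] _ _ _] _]. Qed.

Lemma normal_closureF x y : N x -> N y -> N (x * y^-1).
Proof.
move=> xS yS A AS; have [[[_ AF] _ _ _] _] := AS.
by apply: AF; [exact: xS | exact: yS].
Qed.

Lemma normal_closureV x : N x -> N x^-1.
Proof.
by rewrite -[x^-1]mul1g; apply: normal_closureF; exact: normal_closure1.
Qed.

Lemma normal_closureM x y : N x -> N y -> N (x * y).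
Proof.
by move=> xS /normal_closureV yS; rewrite -[y]invgK; exact: normal_closureF.
Qed.

Lemma normal_closureJ x y : N x -> N (x ^ y).
Proof.
move=> xS A AS; have [[_ _ _ AJ] _] := AS.
by apply: AJ => //; exact: xS.
Qed.

Let eqv (x y : G) : Prop := N (x^-1 * y).

Let eqv_refl x : eqv x x.
Proof. by rewrite /eqv mulVg; exact: normal_closure1. Qed.

Let eqv_sym x y : eqv x y -> eqv y x.
Proof. by move=> /normal_closureV; rewrite invgM invgK. Qed.

Let eqv_trans x y z : eqv x y -> eqv y z -> eqv x z.
Proof.
by move=> xy yz; have := normal_closureM xy yz; rewrite -mulgA mulKVg.
Qed.

Let eqv_mul x x' y y' : eqv x x' -> eqv y y' -> eqv (x * y) (x' * y').
Proof.
move=> xx yy; rewrite /eqv.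
have -> : (x * y)^-1 * (x' * y') = ((x^-1 * x') ^ y) * (y^-1 * y').
  by rewrite /conjg invgM !mulgA mulgK.
by apply: normal_closureM => //; exact: normal_closureJ.
Qed.

Let eqv_inv x x' : eqv x x' -> eqv x^-1 x'^-1.
Proof.
move=> xx; rewrite /eqv.
have -> : (x^-1)^-1 * x'^-1 = ((x^-1 * x')^-1) ^ x^-1.
  by rewrite /conjg !invgM !invgK !mulgA mulgK.
by apply: normal_closureJ; exact: normal_closureV.
Qed.

Definition ncl_setoid_group : setoid_group.
Proof.
apply: (@SetoidGroup G eqv 1 *%g (fun x => x^-1)) => //.
- by move=> x y z; rewrite mulgA; exact: eqv_refl.
- by move=> x; rewrite mul1g; exact: eqv_refl.
- by move=> x; rewrite mulg1; exact: eqv_refl.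
- by move=> x; rewrite mulVg; exact: eqv_refl.
- by move=> x; rewrite mulgV; exact: eqv_refl.
Defined.

(* The group G / <<S>>, the quotient by the normal closure of S. *)
Definition quotient_by_ncl : groupType := setoid_quot ncl_setoid_group.

End QuotientByNormalClosure.

Section FreeProduct.
Variables G1 G2 : groupType.

Let word := seq (G1 + G2).

Inductive fp_eqv : word -> word -> Prop :=
| fp_refl u : fp_eqv u u
| fp_sym u v : fp_eqv u v -> fp_eqv v u
| fp_trans u v w : fp_eqv u v -> fp_eqv v w -> fp_eqv u w
| fp_cat u u' v v' : fp_eqv u u' -> fp_eqv v v' -> fp_eqv (u ++ v) (u' ++ v')
| fp_one_l : fp_eqv [:: inl 1] [::]
| fp_one_r : fp_eqv [:: inr 1] [::]
| fp_mul_l x y : fp_eqv [:: inl x; inl y] [:: inl (x * y)]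
| fp_mul_r x y : fp_eqv [:: inr x; inr y] [:: inr (x * y)].

Let inv_letter (l : G1 + G2) : G1 + G2 :=
  match l with inl x => inl x^-1 | inr x => inr x^-1 end.

Let inv_word (w : word) : word := rev (map inv_letter w).

Let inv_letterK : involutive inv_letter.
Proof. by case=> x /=; rewrite invgK. Qed.

Let inv_wordK : involutive inv_word.
Proof. by move=> w; rewrite /inv_word map_rev revK (mapK inv_letterK). Qed.

Let inv_word_compat u v : fp_eqv u v -> fp_eqv (inv_word u) (inv_word v).
Proof.
elim=> {u v} [u|u v _|u v w _ uv _ vw|u u' v v' _ uu _ vv|||x y|x y].
- exact: fp_refl.
- exact: fp_sym.
- exact: fp_trans uv vw.
- by rewrite /inv_word !map_cat !rev_cat; exact: fp_cat.
- by rewrite /inv_word /= invg1; exact: fp_one_l.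
- by rewrite /inv_word /= invg1; exact: fp_one_r.
- by rewrite /inv_word /= /rev /= invgM; exact: fp_mul_l.
- by rewrite /inv_word /= /rev /= invgM; exact: fp_mul_r.
Qed.

Let letterV l : fp_eqv [:: l; inv_letter l] [::].
Proof.
case: l => x /=.
- by apply: fp_trans (fp_mul_l _ _) _; rewrite mulgV; exact: fp_one_l.
- by apply: fp_trans (fp_mul_r _ _) _; rewrite mulgV; exact: fp_one_r.
Qed.

Let wordV w : fp_eqv (w ++ inv_word w) [::].
Proof.
elim: w => [|l w IHw]; first exact: fp_refl.
have -> : (l :: w) ++ inv_word (l :: w) =
    [:: l] ++ (w ++ inv_word w) ++ [:: inv_letter l].
  by rewrite /inv_word /= rev_cons -cats1 -catA.
apply: fp_trans (letterV l); apply: (@fp_cat [:: l] [:: l] _ [:: inv_letter l]).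
  exact: fp_refl.
by apply: (@fp_cat _ [::]) => //; exact: fp_refl.
Qed.

Definition fp_setoid_group : setoid_group.
Proof.
apply: (@SetoidGroup (seq (G1 + G2)) fp_eqv [::] cat inv_word).
- exact: fp_refl.
- exact: fp_sym.
- exact: fp_trans.
- exact: fp_cat.
- exact: inv_word_compat.
- by move=> u v w; rewrite catA; exact: fp_refl.
- by move=> u; exact: fp_refl.
- by move=> u; rewrite cats0; exact: fp_refl.
- by move=> u; rewrite -{2}[u]inv_wordK; exact: wordV.
- exact: wordV.
Defined.

(* G1 * G2: words in the letters of G1 and G2, modulo the congruence which
   multiplies adjacent letters from the same factor and erases identities. *)
Definition free_product : groupType := setoid_quot fp_setoid_group.

Definition fp_inl (x : G1) : free_product :=
  setoid_pi (P := fp_setoid_group) [:: inl x].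
Definition fp_inr (x : G2) : free_product :=
  setoid_pi (P := fp_setoid_group) [:: inr x].

End FreeProduct.

Definition amalgam (H G1 G2 : groupType) (i1 : H -> G1) (i2 : H -> G2) :
    groupType :=
  quotient_by_ncl
    [set fp_inl G2 (i1 h) * (fp_inr G1 (i2 h))^-1 | h in [set: H]].

Local Open Scope ring_scope.
Local Open Scope sesquilinear_scope.

Section FlexibleStability.
Variable R : realType.
Local Notation C := R[i].

(* The Hilbert-Schmidt norm of an operator on C^d for the normalized trace
   tr / d. The trace of A^* A is a nonnegative real, so [Re] only casts to R. *)
Definition hs_norm (d : nat) (A : 'M[C]_d) : R :=
  Num.sqrt (complex.Re (\tr (A^t* *m A)) / d%:R).

Definition hamming_dist (X : finType) (s t : {perm X}) : R :=
  #|[set x | s x != t x]|%:R / #|X|%:R.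

(* A Hilbert space of dimension d is modelled as C^d, with Aut(C^d) the unitary
   matrices. Spaces and sets are nonzero, as normalization divides by |X|. An
   inclusion of C^d in C^e is an isometry J, and p A p, as an operator
   on the subspace C^d, is J^* A J. *)
Definition flexibly_HS_stable (G : groupType) : Prop :=
  forall (d : nat -> nat) (phi : forall n, G -> 'M[C]_(d n)),
    (forall n, (0 < d n)%N) ->
    (forall n g, phi n g \is unitarymx) ->
    (forall g h, (fun n => hs_norm (phi n g *m phi n h - phi n (g * h)%g))
                   @ \oo --> (0 : R)) ->
  exists (e : nat -> nat) (J : forall n, 'M[C]_(e n, d n))
         (psi : forall n, G -> 'M[C]_(e n)),
    [/\ forall n, (J n)^t* *m J n = 1%:M,
        (fun n => (e n)%:R / (d n)%:R) @ \oo --> (1 : R),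
        forall n g, psi n g \is unitarymx,
        forall n g h, psi n (g * h)%g = psi n g *m psi n h
      & forall g, (fun n => hs_norm (phi n g - (J n)^t* *m psi n g *m J n))
                    @ \oo --> (0 : R)].

(* An inclusion of X n in Y n is an injection j n. The product of {perm X} is
   (s * t) x = t (s x); the opposite convention gives the same notion, on
   replacing each phi n g and psi n g by its inverse. *)
Definition flexibly_P_stable (G : groupType) : Prop :=
  forall (X : nat -> finType) (phi : forall n, G -> {perm (X n)}),
    (forall n, (0 < #|X n|)%N) ->
    (forall g h, (fun n => hamming_dist (phi n g * phi n h)%g (phi n (g * h)%g))
                   @ \oo --> (0 : R)) ->
  exists (Y : nat -> finType) (j : forall n, X n -> Y n)
         (psi : forall n, {multiplicative G -> {perm (Y n)}}),
    [/\ forall n, injective (j n),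
        (fun n => #|Y n|%:R / #|X n|%:R) @ \oo --> (1 : R)
      & forall g,
          (fun n => #|[set x | j n (phi n g x) != psi n g (j n x)]|%:R
                      / #|X n|%:R)
            @ \oo --> (0 : R)].

End FlexibleStability.

Inductive stability_class := C_HS | C_P.

Definition flexibly_stable (R : realType) (C : stability_class)
    (G : groupType) : Prop :=
  match C with
  | C_HS => flexibly_HS_stable R G
  | C_P => flexibly_P_stable R G
  end.

(* Main.v *)
Require Import Defs.
From HB Require Import structures.
From mathcomp Require Import all_boot all_order all_algebra all_fingroup.
From mathcomp Require Import cyclic generic_quotient spectral sesquilinear.
From mathcomp Require Import complex.
From mathcomp Require Import all_classical all_reals all_analysis.
From mathcomp Require Import ring lra zify.

(* An asymptotic homomorphism [phi] of the amalgam restricts to the factors, so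
   flexible stability corrects it there to genuine actions [psi1], [psi2] on
   slightly larger spaces [Y1], [Y2]. What is missing is that [psi1] and [psi2]
   agree on H; they do so up to a small error.

   Since H is finite and almost normal, it has finitely many conjugates in each
   factor, and every action of a factor is a sum of isotypic pieces of finitely
   many types, the H-multiplicities of a piece being its size times a fixed
   vector. The two multiplicity vectors of H on [Y1] and [Y2] differ by a small
   vector v. By Farkas' lemma the types split in two classes: those outside [K]
   occupy a portion of size O(|v|), and the combinations of those in [K] form
   a group, hence a lattice, so that v is compensated by adding actions of size
   O(|v|). The pieces outside [K] are made trivial without changing the space,
   which keeps the inclusion of [X]; small actions are then added on both sides
   to make the H-actions isomorphic.

   Finally the partial isomorphism between the H-actions given by [X] is close
   to an H-isomorphism [T] (extension orbit by orbit for permutations, averaging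
   and polar decomposition for unitaries); conjugating by [T] the action of the
   second factor, one obtains an action of the amalgam. *)

Set Implicit Arguments.
Unset Strict Implicit.
Unset Printing Implicit Defensive.

Import Order.TTheory GRing.Theory Num.Theory.

Local Open Scope ring_scope.

(** * Balancing multiplicities *)

(** Every bound is linear in a single error, with a constant depending only on the groups and the
    embeddings, so it stays small after division by |X|. The obstacle is positivity and integrality:
    pieces can be added but not subtracted, and not every size of a piece occurs. A type in [K] can
    be cancelled by adding further pieces; a Farkas functional that is positive on all other types
    measures their share. Finiteness of the types is needed for uniform constants. For permutations
    a type is an orbit of subsets of the finite set of conjugates of H. For unitaries it rests on
    Dietzmann's lemma: these conjugates generate a finite group, so the eigenvalues of their class
    sums come from a list fixed in advance. Characters are complex, hence the balancing of
    representations takes place in the rational coordinates given by multiplicities of irreducible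
    characters. The unnormalized squared Hilbert-Schmidt norm plays the role of the number of bad
    points, being additive over orthogonal sums. *)

Section Farkas.
Variables (F : realFieldType) (T : eqType) (I : finType).
Implicit Types (l : seq T) (a : T -> I -> F) (b y : I -> F).

Definition in_cone l a b :=
  exists2 c : T -> F, (forall t, 0 <= c t)
    & forall i, b i = \sum_(t <- l) c t * a t i.

(** Induction on the generators. A functional [y] separating [b] from the cone of [l] may be
    negative on the new generator [a u]; everything is then projected along [a u] and separated
    again. The new functional composed with the projection vanishes on [a u]. *)
Lemma farkas l a b : uniq l -> ~ in_cone l a b ->
  exists2 y, (forall t, t \in l -> 0 <= \sum_i y i * a t i)
    & \sum_i y i * b i < 0.
Proof.
elim: l a b => [|u l IHl] a b /=.
  move=> _ nb; have [i bi] : exists i, b i != 0.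
    apply: contrapT => /forallNP b0; apply: nb; exists (fun=> 0) => // i.
    by rewrite big_nil; apply/eqP; move: (b0 i) => /negP; rewrite negbK.
  exists (fun i => - b i) => //; under eq_bigr do rewrite mulNr -expr2.
  rewrite sumrN oppr_lt0 (bigD1 i) //= ltr_wpDr ?sumr_ge0 //.
    by move=> j _; rewrite sqr_ge0.
  by rewrite lt_def sqrf_eq0 bi sqr_ge0.
case/andP=> ul uniq_l nb.
have [y ya yb] : exists2 y, (forall t, t \in l -> 0 <= \sum_i y i * a t i)
    & \sum_i y i * b i < 0.
  apply: IHl => // -[c c0 cb]; apply: nb.
  exists (fun t => if t == u then 0 else c t) => [t|i]; first by case: ifP.
  rewrite big_cons eqxx mul0r add0r cb; apply: eq_big_seq => t tl.
  by case: eqP => // tu; rewrite -tu tl in ul.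
have [yu|yu] := leP 0 (\sum_i y i * a u i).
  by exists y => // t; rewrite inE => /predU1P[->|/ya].
set p := fun x : I -> F => (\sum_i y i * x i) / (\sum_i y i * a u i).
(* projection along [a u] onto the hyperplane orthogonal to [y] *)
pose q x i := x i - p x * a u i.
have [y' ya' yb'] : exists2 y', (forall t, t \in l -> 0 <= \sum_i y' i * q (a t) i)
    & \sum_i y' i * q b i < 0.
  apply: (IHl (fun t => q (a t))) => // -[c c0 cb]; apply: nb.
  (* The coefficient of [u] undoes the projections. It is nonnegative since [y] is negative on [b]
     and [a u] and nonnegative on each [a s], so that [p b] is positive and [p (a s)] at most
     zero. *)
  exists (fun t => if t == u then p b - \sum_(s <- l) c s * p (a s)
                   else if t \in l then c t else 0) => [t|i].
    case: eqP => _; last by case: ifP.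
    rewrite subr_ge0 (@le_trans _ _ 0) //.
      rewrite big_seq; apply: sumr_le0 => s sl; rewrite mulr_ge0_le0 //.
      by rewrite /p mulr_ge0_le0 ?ya // invr_le0 ltW.
    by rewrite /p; apply: mulr_le0; rewrite ?invr_le0 ltW.
  rewrite big_cons eqxx; under eq_big_seq => t tl.
    have -> : (t == u) = false by apply: contraNF ul => /eqP <-.
    rewrite tl; over.
  have := cb i; rewrite /q /= => /eqP; rewrite subr_eq => /eqP ->.
  under eq_bigr do rewrite mulrBr mulrA.
  by rewrite sumrB -mulr_suml; ring.
have qE x : \sum_i y' i * q x i = \sum_i (y' i
     - (\sum_j y' j * a u j) / (\sum_j y j * a u j) * y i) * x i.
  under eq_bigr do rewrite /q mulrBr.
  under [RHS]eq_bigr do rewrite mulrBl -[_ / _ * _ * _]mulrA.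
  rewrite !sumrB; congr (_ - _).
  rewrite -[RHS]mulr_sumr; rewrite /p.
  under eq_bigr do rewrite mulrCA.
  by rewrite -mulr_sumr; ring.
exists (fun i => y' i - (\sum_j y' j * a u j) / (\sum_j y j * a u j) * y i).
  move=> t; rewrite inE => /predU1P[->|tl]; last by rewrite -qE ya'.
  rewrite -qE /q /p divff ?lt_eqF // big1 // => i _.
  by rewrite mul1r subrr mulr0.
by rewrite -qE.
Qed.

End Farkas.

(** * Cost of the vectors of an integral lattice *)

Section LatticeCost.
Variables (I : finType) (L : (I -> rat) -> Prop) (P : (I -> rat) -> nat -> Prop).
Hypothesis LZ : forall x, L x -> forall i, x i \in Num.int.
Hypothesis L0 : L (fun=> 0).
Hypothesis LB : forall x y, L x -> L y -> L (fun i => x i - y i).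
Hypothesis P0 : P (fun=> 0) 0.
Hypothesis PD : forall x y m n, P x m -> P y n -> P (fun i => x i + y i) (m + n).
Hypothesis LP : forall x, L x -> exists n, P x n.

Let LD x y : L x -> L y -> L (fun i => x i + y i).
Proof.
move=> Lx Ly; rewrite (_ : (fun _ => _) = fun i => x i - (0 - y i)).
  by apply: LB => //; apply: LB.
by apply/funext => i; ring.
Qed.

Let LN x : L x -> L (fun i => - x i).
Proof.
move=> Lx; rewrite (_ : (fun _ => _) = fun i => 0 - x i); first exact: LB.
by apply/funext => i; ring.
Qed.

Let LM (n : nat) x : L x -> L (fun i => n%:R * x i).
Proof.
move=> Lx; elim: n => [|n IHn].
  by rewrite (_ : (fun _ => _) = fun=> 0) //; apply/funext => i; ring.
rewrite (_ : (fun _ => _) = fun i => x i + n%:R * x i); first exact: LD.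
by apply/funext => i; rewrite -natr1; ring.
Qed.

Let PM (n m : nat) x : P x m -> P (fun i => n%:R * x i) (n * m).
Proof.
move=> Px; elim: n => [|n IHn].
  by rewrite (_ : (fun _ => _) = fun=> 0) //; apply/funext => i; ring.
rewrite (_ : (fun _ => _) = fun i => x i + n%:R * x i); first exact: PD.
by apply/funext => i; rewrite -natr1; ring.
Qed.

Let norm (x : I -> rat) := \sum_i `|x i|.

(** Coordinates are eliminated one by one, as in a Hermite normal form: a multiple of a fixed [g] in
    [L] with least positive entry at [i] kills the entry of [x] there, and the multiplier is at most
    the norm of [x]. Both [g] and its negative have some finite cost. *)
Lemma lattice_cost : exists c : nat, forall x, L x ->
  exists2 n, P x n & n%:R <= c%:R * norm x.
Proof.
suff /(_ (enum I)) [c cP] : forall l : seq I, exists c : nat, forall x, L x ->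
    (forall i, i \notin l -> x i = 0) ->
    exists2 n, P x n & n%:R <= c%:R * norm x.
  by exists c => x Lx; apply: cP => // i; rewrite mem_enum.
elim=> [|i l [c cP]].
  exists 0 => x Lx x0; exists 0%N; last by rewrite mul0r.
  by rewrite (_ : x = fun=> 0) //; apply/funext => i; apply: x0.
pose Ll x := L x /\ forall j, j \notin i :: l -> x j = 0.
pose ok n := `[< exists2 x, Ll x & x i = n.+1%:R >].
have [[n okn]|nok] := pselect (exists n, ok n); last first.
  exists c => x Lx x0; apply: cP => // j jl.
  case: (eqVneq j i) => [->|ji]; last by apply: x0; rewrite inE negb_or ji.
  apply: contrapT => /eqP xi; apply: nok.
  have /intrP[z xz] := LZ Lx i.
  case: z xz => [[|n]|n] xz; first by rewrite xz eqxx in xi.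
    by exists n; apply/asboolP; exists x.
  exists n; apply/asboolP; exists (fun i => - x i).
    by split=> [|k kl]; [exact: LN | rewrite x0 ?oppr0].
  by rewrite xz NegzE rmorphN /= opprK.
case: (ex_minnP (ex_intro ok n okn)) => m /asboolP[g [Lg g0] gi] min_m.
have [n1 Pn1] := LP Lg; have [n2 Pn2] := LP (LN Lg).
have norm_g0 : 0 <= norm g by apply: sumr_ge0.
have [G leG] : exists G : nat, norm g <= G%:R.
  by exists (Num.truncn (norm g)).+1; rewrite ltW // truncnS_gt.
(* The remainder has norm at most [1 + G] times that of [x] and costs [c] per unit; each of the at
   most [norm x] copies of [g] or of its negative costs at most [n1 + n2]. *)
exists (c * (1 + G) + (n1 + n2))%N => x Lx x0.
have /intrP[z xz] := LZ Lx i.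
have [q [r [zE r_lt]]] : exists q : int, exists r : nat,
    z = q * m.+1%:Z + r%:Z /\ (r < m.+1)%N.
  exists (z %/ m.+1%:Z)%Z, `|(z %% m.+1%:Z)%Z|%N.
  rewrite gez0_abs ?modz_ge0 // -divz_eq; split=> //.
  by rewrite -ltz_nat gez0_abs ?modz_ge0 // ltz_pmod.
have Lqg : Ll (fun j => q%:~R * g j) /\
    exists2 N, P (fun j => q%:~R * g j) N & (N <= `|q|%N * (n1 + n2))%N.
  split.
    split=> [|j jl]; last by rewrite g0 ?mulr0.
    case: q {zE} => k; first exact: LM.
    rewrite NegzE (_ : (fun _ => _) = fun i => k.+1%:R * - g i).
      by apply: LM; exact: LN.
    by apply/funext => j; rewrite rmorphN /=; ring.
  case: q {zE} => k.
    exists (k * n1)%N; first exact: PM.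
    by rewrite leq_mul ?leq_addr.
  exists (k.+1 * n2)%N; last by rewrite leq_mul ?leq_addl.
  rewrite NegzE (_ : (fun _ => _) = fun i => k.+1%:R * - g i); first exact: PM.
  by apply/funext => j; rewrite rmorphN /=; ring.
case: Lqg => -[Lqg qg0] [N PN leN].
pose x' j := x j - q%:~R * g j.
have Lx' : L x' by exact: LB.
have x'i : x' i = r%:R.
  by rewrite /x' xz gi zE !rmorphD !rmorphM /=; ring.
have r0 : r = 0%N.
  case: r {zE} r_lt x'i => // r r_lt x'i; exfalso.
  suff /min_m : ok r by rewrite leqNgt (r_lt : (r < m)%N).
  apply/asboolP; exists x' => //; split=> // j jl.
  by rewrite /x' x0 ?g0 //; ring.
have [n' Pn' len'] : exists2 n, P x' n & n%:R <= c%:R * norm x'.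
  apply: cP => // j jl; case: (eqVneq j i) => [->|ji]; first by rewrite x'i r0.
  by rewrite /x' x0 ?g0 ?inE ?negb_or ?ji //; ring.
exists (n' + N)%N.
  rewrite (_ : x = fun j => x' j + q%:~R * g j); first exact: PD.
  by apply/funext => j; rewrite /x'; ring.
have norm_x0 : 0 <= norm x by apply: sumr_ge0.
have le_q : `|q|%N%:R <= norm x.
  apply: (@le_trans _ _ `|x i|).
    rewrite xz zE r0 addr0 -intr_norm normrM natr_absz ler_int.
    by rewrite ler_peMr.
  by rewrite /norm (bigD1 i) //= lerDl sumr_ge0.
have le_x' : norm x' <= norm x + `|q|%N%:R * norm g.
  rewrite /norm mulr_sumr -big_split /=; apply: ler_sum => j _.
  by rewrite (le_trans (ler_normB _ _)) // normrM natr_absz intr_norm.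
move: leN; rewrite -(ler_nat rat) natrM !natrD => leN.
have c0 : (0 : rat) <= c%:R by [].
have := ler_wpM2l c0 le_x'.
have : `|q|%N%:R * norm g <= norm x * G%:R by rewrite ler_pM.
move=> /(ler_wpM2l c0).
have : `|q|%N%:R * (n1 + n2)%:R <= norm x * (n1 + n2)%:R by rewrite ler_wpM2r.
rewrite !natrM !natrD.
move: len' leN; lra.
Qed.

End LatticeCost.

Lemma common_denominator (T : finType) (c : T -> rat) : (forall t, 0 <= c t) ->
  exists2 d, (0 < d)%N & exists n : T -> nat, forall t, d%:R * c t = (n t)%:R.
Proof.
move=> c0; exists (\prod_t `|denq (c t)|)%N.
  by rewrite prodn_gt0 // => t; rewrite absz_gt0 denq_neq0.
exists (fun t => `|numq (c t)| * \prod_(s | s != t) `|denq (c s)|)%N => t.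
rewrite (bigD1 t) //= !natrM mulrAC; congr (_ * _).
rewrite mulrC !natr_absz ger0_norm ?denq_ge0 // ger0_norm ?numq_ge0 //.
by rewrite numqE.
Qed.

(** * Balancing with nonnegative combinations of finitely many types *)

Section Balance.
Variables (T I : finType) (w : T -> I -> rat) (E : T -> nat -> Prop).
Hypothesis E0 : forall t, E t 0.
Hypothesis ED : forall t m n, E t m -> E t n -> E t (m + n).
Hypothesis EZ : forall t n i, E t n -> n%:R * w t i \in Num.int.

Let EM t (k n : nat) : E t n -> E t (k * n).
Proof. by move=> En; elim: k => [|k IHk]; rewrite ?mul0n ?mulSn; [exact: E0|exact: ED]. Qed.

Let P (x : I -> rat) (n : nat) := exists s : T -> nat,
  [/\ forall t, E t (s t), forall i, x i = \sum_t (s t)%:R * w t i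
    & (\sum_t s t <= n)%N].

Let P0 : P (fun=> 0) 0.
Proof.
exists (fun=> 0%N); split=> // [i|]; last by rewrite big1.
by rewrite big1 // => t _; rewrite mul0r.
Qed.

Let PD x y m n : P x m -> P y n -> P (fun i => x i + y i) (m + n).
Proof.
move=> [s [Es xE sm]] [s' [Es' yE s'n]]; exists (fun t => s t + s' t)%N.
split=> [t|i|]; first exact: ED.
- by rewrite xE yE -big_split /=; apply: eq_bigr => t _; rewrite natrD mulrDl.
- by rewrite big_split leq_add.
Qed.

(** The invertible part of the semigroup of realizable vectors. It is a group, so [lattice_cost]
    applies although only nonnegative combinations are available. *)
Let L x := (exists n, P x n) /\ (exists n, P (fun i => - x i) n).

Let LZ x : L x -> forall i, x i \in Num.int.
Proof.
by case=> [[n [s [Es xE _]]] _] i; rewrite xE rpred_sum // => t _; apply: EZ.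
Qed.

Let L0 : L (fun=> 0).
Proof.
split; first by exists 0%N.
by exists 0%N; rewrite (_ : (fun _ => _) = fun=> 0) // oppr0.
Qed.

Let LD x y : L x -> L y -> L (fun i => x i + y i).
Proof.
move=> [[m Pm] [m' Pm']] [[n Pn] [n' Pn']]; split.
  by exists (m + n)%N; exact: PD.
exists (m' + n')%N.
by rewrite (_ : (fun _ => _) = fun i => - x i + - y i); [exact: PD|apply/funext => i; ring].
Qed.

Let LN x : L x -> L (fun i => - x i).
Proof.
case=> Lx LNx; split=> //.
by rewrite (_ : (fun i => - - x i) = x) //; apply/funext => i; rewrite opprK.
Qed.

Let LB x y : L x -> L y -> L (fun i => x i - y i).
Proof. by move=> Lx Ly; apply: LD => //; exact: LN. Qed.

Let norm (x : I -> rat) := \sum_i `|x i|.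

(* The types in [K] are those whose vector is opposite to a combination of the
   others; by Farkas' lemma the remaining ones are controlled by the defect. *)
Lemma balance : exists K : pred T, exists c : nat, forall z : T -> nat,
  (forall t, E t (z t)) ->
  let v := norm (fun i => \sum_t (z t)%:R * w t i) in
  [/\ (\sum_(t | ~~ K t) z t)%:R <= c%:R * v & exists s : T -> nat,
    [/\ forall t, E t (s t), (\sum_t s t)%:R <= c%:R * v
      & forall i, \sum_(t | K t) (z t)%:R * w t i + \sum_t (s t)%:R * w t i = 0]].
Proof.
(* [e t] is a nonzero admissible size, or [0] if there is none; in the latter case [u t] below
   vanishes and [t] falls in [K]. *)
have /choice [e eP] : forall t, exists e, E t e /\
    (e = 0%N -> forall n, E t n -> n = 0%N).
  move=> t; have [[n [En n0]]|nE] := pselect (exists n, E t n /\ n != 0%N).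
    by exists n; split=> // n00; rewrite n00 in n0.
  exists 0%N; split=> // _ n En; apply/eqP; apply: contrapT => /negP n0.
  by apply: nE; exists n.
pose u t i : rat := (e t)%:R * w t i.
pose K t := `[< in_cone (enum T) u (fun i => - u t i) >].
have PK t x : K t -> E t x -> exists n, P (fun i => - (x%:R * w t i)) n.
  have [Ee e0] := eP t.
  move=> /asboolP[c c0 cE] Ex; have [e_t|e_t] := posnP (e t).
    exists 0%N; rewrite (_ : (fun _ => _) = fun=> 0) //; apply/funext => i.
    by rewrite (e0 e_t _ Ex) mul0r oppr0.
  have [d d0 [n nE]] := common_denominator c0.
  have de0 : (0 < d * e t)%N by rewrite muln_gt0 d0.
  (* Writing [e] and [w] for [e t] and [w t]: the negative of [x w] equals
     [x d (- e w) + (d e - 1) x w], and clearing denominators makes the first term a nonnegative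
     combination of the [u j]. *)
  pose s j := (x * n j * e j + (j == t) * ((d * e t).-1 * x))%N.
  exists (\sum_j s j)%N, s; split=> // [j|i].
    have [Eej _] := eP j; apply: ED; first exact: EM.
    by case: eqP => [->|]; rewrite ?mul1n ?mul0n //; exact: EM.
  under eq_bigr do rewrite natrD mulrDl.
  rewrite big_split /= [X in _ + X](bigD1 t) //= eqxx.
  rewrite [X in _ + (_ + X)]big1 ?addr0 => [|j /negPf->]; last first.
    by rewrite mul0n mul0r.
  transitivity (x%:R * (d%:R * - u t i) + (d * e t - 1)%:R * (x%:R * w t i)).
    by rewrite natrB // natrM /u; ring.
  congr (_ + _); last by rewrite mul1n subn1 natrM mulrA.
  rewrite (cE i) big_enum /= !mulr_sumr.
  by apply: eq_bigr => j _; rewrite !natrM -nE /u; ring.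
have /choice [y yP] : forall t, exists y : I -> rat,
    (forall s, 0 <= \sum_i y i * u s i) /\ (~~ K t -> 0 < \sum_i y i * u t i).
  move=> t; have [Kt|/asboolP nKt] := boolP (K t).
    by exists (fun=> 0); split=> // s; rewrite big1 // => i _; rewrite mul0r.
  have [|y0 y1 y2] := farkas _ nKt; first exact: enum_uniq.
  exists y0; split=> [s|_]; first by apply: y1; rewrite mem_enum.
  move: y2; under eq_bigr do rewrite mulrN.
  by rewrite sumrN oppr_lt0.
(* The sum of the separating functionals is nonnegative on all types and positive on all those
   outside [K] at once. *)
pose Y i := \sum_t y t i.
have YE s : \sum_i Y i * u s i = \sum_t \sum_i y t i * u s i.
  by rewrite exchange_big /=; apply: eq_bigr => i _; rewrite mulr_suml.
have Yu s : 0 <= \sum_i Y i * u s i.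
  by rewrite YE sumr_ge0 // => t _; case: (yP t) => + _; exact.
have YuK s : ~~ K s -> 0 < \sum_i Y i * u s i.
  move=> Ks; rewrite YE (bigD1 s) //= ltr_wpDr //; last by case: (yP s) => _; exact.
  by rewrite sumr_ge0 // => t _; case: (yP t) => + _; exact.
pose b t := \sum_i Y i * w t i.
have ub t : \sum_i Y i * u t i = (e t)%:R * b t.
  by rewrite mulr_sumr; apply: eq_bigr => i _; rewrite /u; ring.
have b_gt0 t : ~~ K t -> 0 < b t.
  move=> /YuK; rewrite ub; case: (e t) => [|m]; first by rewrite mul0r ltxx.
  by rewrite pmulr_rgt0.
have [c0 c0P] : exists c0 : nat, forall t, ~~ K t -> 1 <= c0%:R * b t.
  exists (Num.truncn (\sum_(t | ~~ K t) (b t)^-1)).+1 => t Kt.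
  rewrite -ler_pdivrMr ?b_gt0 // mul1r.
  apply: (@le_trans _ _ (\sum_(t | ~~ K t) (b t)^-1)).
    by rewrite (bigD1 t) //= lerDl sumr_ge0 // => s /andP[/b_gt0/ltW]; rewrite invr_ge0.
  by rewrite ltW // truncnS_gt.
have [c1 c1P] : exists c1 : nat, forall i, `|Y i| <= c1%:R.
  exists (Num.truncn (\sum_i `|Y i|)).+1 => i; apply: (@le_trans _ _ (\sum_i `|Y i|)).
    by rewrite (bigD1 i) //= lerDl sumr_ge0.
  by rewrite ltW // truncnS_gt.
have [c2 c2P] : exists c2 : nat, forall t, norm (w t) <= c2%:R.
  exists (Num.truncn (\sum_t norm (w t))).+1 => t.
  apply: (@le_trans _ _ (\sum_t norm (w t))).
    by rewrite (bigD1 t) //= lerDl sumr_ge0 // => s _; apply: sumr_ge0.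
  by rewrite ltW // truncnS_gt.
have [c3 c3P] := lattice_cost LZ L0 LB P0 PD (fun x (Lx : L x) => Lx.1).
(* [c0 * c1] bounds the part outside [K]; the part in [K] then has norm at most [1 + c2 * (c0 * c1)]
   times [v], and is compensated at cost [c3] per unit of norm. *)
exists K, (c0 * c1 + c3 * (1 + c2 * (c0 * c1)))%N => z Ez v.
have v0 : 0 <= v by apply: sumr_ge0.
(* Pair the total vector with [Y]: types in [K] contribute nonnegatively, the others at least their
   size over [c0], and the result is at most [c1 * v]. *)
have le_del : (\sum_(t | ~~ K t) z t)%:R <= (c0 * c1)%:R * v.
  apply: (@le_trans _ _ (c0%:R * \sum_t (z t)%:R * b t)).
    rewrite natr_sum mulr_sumr [leRHS](bigID K) /= -[leLHS]add0r lerD //.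
      apply: sumr_ge0 => t _; apply: mulr_ge0 => //.
      case: (eqVneq (e t) 0%N) => [et|et].
        by case: (eP t) => _ /(_ et _ (Ez t)) ->; rewrite mul0r.
      by have := Yu t; rewrite ub pmulr_rge0 ?ltr0n ?lt0n // => bt; rewrite mulr_ge0.
    apply: ler_sum => t /c0P; rewrite mulrCA => le1.
    by rewrite -[leLHS]mulr1 ler_wpM2l.
  rewrite natrM -mulrA ler_wpM2l //.
  have -> : \sum_t (z t)%:R * b t = \sum_i Y i * (\sum_t (z t)%:R * w t i).
    under eq_bigr do rewrite mulr_sumr.
    rewrite exchange_big /=; apply: eq_bigr => i _.
    by rewrite mulr_sumr; apply: eq_bigr => t _; ring.
  rewrite mulr_sumr; apply: ler_sum => i _.
  by rewrite (le_trans (ler_norm _)) // normrM ler_wpM2r.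
split.
  rewrite (le_trans le_del) // ler_wpM2r // ler_nat leq_addr //.
pose x i := \sum_(t | K t) (z t)%:R * w t i.
have Lx : L x.
  rewrite /x; elim: (index_enum T) => [|t l IHl].
    by rewrite (_ : (fun _ => _) = fun=> 0) //; apply/funext => i; rewrite big_nil.
  rewrite (_ : (fun _ => _) = fun i => (if K t then (z t)%:R * w t i else 0)
      + \sum_(j <- l | K j) (z j)%:R * w j i); last first.
    by apply/funext => i; rewrite big_cons; case: ifP => _; rewrite ?add0r.
  apply: LD => //; case Kt: (K t); last exact: L0.
  split; last exact: PK.
  pose s j := ((j == t) * z t)%N; exists (\sum_j s j)%N, s; split=> // [j|i].
    by rewrite /s; case: eqP => [->|]; rewrite ?mul1n ?mul0n.
  rewrite (bigD1 t) //= /s eqxx mul1n big1 ?addr0 // => j /negPf->.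
  by rewrite mul0n mul0r.
have [n [s [Es sE leN]] len] := c3P _ (LN Lx).
exists s; split=> // [|i]; last by rewrite -sE subrr.
apply: (@le_trans _ _ n%:R); first by rewrite ler_nat.
rewrite (le_trans len) // natrD mulrDl -[leLHS]add0r lerD ?mulr_ge0 //.
rewrite natrM -mulrA ler_wpM2l // natrD mulrDl mul1r.
rewrite /norm; under eq_bigr do rewrite normrN.
have xE i : x i = \sum_t (z t)%:R * w t i - \sum_(t | ~~ K t) (z t)%:R * w t i.
  by rewrite [in RHS](bigID K) /= addrK.
apply: (@le_trans _ _ (v + norm (fun i => \sum_(t | ~~ K t) (z t)%:R * w t i))).
  rewrite -big_split /=; apply: ler_sum => i _; rewrite xE; exact: ler_normB.
rewrite lerD2l natrM -mulrA.
apply: (@le_trans _ _ (c2%:R * (\sum_(t | ~~ K t) z t)%:R)); last by rewrite ler_wpM2l.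
apply: (@le_trans _ _ (\sum_i \sum_(t | ~~ K t) (z t)%:R * `|w t i|)).
  apply: ler_sum => i _; rewrite (le_trans (ler_norm_sum _ _ _)) //.
  by apply: ler_sum => t _; rewrite normrM normr_nat.
rewrite exchange_big /= natr_sum mulr_sumr; apply: ler_sum => t _.
by rewrite -mulr_sumr mulrC ler_wpM2r //; exact: c2P.
Qed.

End Balance.

(** One application of [balance] to the disjoint union of both families, the second one negated: a
    vanishing signed total is an equality between the two sides. *)
Lemma balance_two (T1 T2 I : finType) (w1 : T1 -> I -> rat) (w2 : T2 -> I -> rat)
    (E1 : T1 -> nat -> Prop) (E2 : T2 -> nat -> Prop) :
  (forall t, E1 t 0) -> (forall t, E2 t 0) ->
  (forall t m n, E1 t m -> E1 t n -> E1 t (m + n)%N) ->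
  (forall t m n, E2 t m -> E2 t n -> E2 t (m + n)%N) ->
  (forall t n i, E1 t n -> n%:R * w1 t i \in Num.int) ->
  (forall t n i, E2 t n -> n%:R * w2 t i \in Num.int) ->
  exists (K1 : pred T1) (K2 : pred T2) (c : nat), forall z1 z2,
  (forall t, E1 t (z1 t)) -> (forall t, E2 t (z2 t)) ->
  let v := \sum_i `|\sum_t (z1 t)%:R * w1 t i - \sum_t (z2 t)%:R * w2 t i| in
  exists s1 s2, [/\ forall t, E1 t (s1 t), forall t, E2 t (s2 t),
    forall i, \sum_(t | K1 t) (z1 t)%:R * w1 t i + \sum_t (s1 t)%:R * w1 t i =
              \sum_(t | K2 t) (z2 t)%:R * w2 t i + \sum_t (s2 t)%:R * w2 t i,
    (\sum_(t | ~~ K1 t) z1 t + \sum_(t | ~~ K2 t) z2 t)%:R <= c%:R * v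
    & (\sum_t s1 t + \sum_t s2 t)%:R <= c%:R * v].
Proof.
move=> E10 E20 E1D E2D E1Z E2Z.
pose w (t : T1 + T2) i := match t with inl t => w1 t i | inr t => - w2 t i end.
pose E (t : T1 + T2) n := match t with inl t => E1 t n | inr t => E2 t n end.
have [||| K [c KP]] := @balance _ I w E.
- by case.
- by case=> t m n; [exact: E1D | exact: E2D].
- by case=> t n i /= En; rewrite ?mulrN ?rpredN; [exact: E1Z | exact: E2Z].
exists (fun t => K (inl t)), (fun t => K (inr t)), c => z1 z2 Ez1 Ez2 v.
pose z (t : T1 + T2) := match t with inl t => z1 t | inr t => z2 t end.
have [] := KP z; first by case.
rewrite !big_sumType /=.
have -> : \sum_i `|\sum_t (z t)%:R * w t i| = v.
  apply: eq_bigr => i _; rewrite big_sumType /= -sumrN; congr `|_ + _|.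
  by apply: eq_bigr => t _; rewrite mulrN.
move=> le_del [s [Es le_s sE]].
exists (fun t => s (inl t)), (fun t => s (inr t)); split=> //.
- by move=> t; exact: (Es (inl t)).
- by move=> t; exact: (Es (inr t)).
- move=> i; have := sE i; rewrite !big_sumType /=.
  under [X in _ + X + _]eq_bigr do rewrite mulrN.
  under [X in _ + _ + (_ + X)]eq_bigr do rewrite mulrN.
  rewrite !sumrN => /eqP; rewrite addrACA -opprD subr_eq0 => /eqP.
  exact.
- by move: le_s; rewrite big_sumType.
Qed.

(** * Conjugates of a finite almost normal subgroup; amalgams *)

Local Open Scope classical_set_scope.
Local Open Scope group_scope.

(** [B] normalizes the image of [i], so the set of conjugates [i h ^ x] depends on [x] only through
    the coset of [x^-1] modulo [B]. One representative per coset suffices, and there are finitely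
    many cosets. *)
Lemma almost_normal_conj (H : finGroupType) (G : groupType)
    (i : {multiplicative H -> G}) : almost_normal (range i) ->
  exists2 s : seq G, uniq s & forall g, g \in s <-> exists h x, g = i h ^ x.
Proof.
case=> B [[_ [B1 BF] _ BJ] finB].
pose r (C : set G) := xget 1 C.
pose D := [set i (p.2 : H) ^ (r p.1)^-1 | p in
  [set [set x * a | a in B] | x in [set: G]] `*` [set: H]].
have finD : finite_set D.
  by apply: finite_image; apply: finite_setX => //; exact: finite_finset.
pose X := [set g | exists h x, g = i h ^ x].
have finX : finite_set X.
  apply: sub_finite_set finD => _ [h [x ->]].
  pose C := [set x^-1 * a | a in B].
  have : C (r C) by apply: (@xgetPex _ 1 C); exists (x^-1 * 1), 1.
  case=> b Bb rC; have [h' _ h'E] := BJ b (i h) Bb (imageT _ _).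
  exists (C, h') => /=; first by split=> //; exists x^-1.
  by rewrite h'E -conjgM -rC invgM invgK mulKVg.
have [s sE] := (finite_seqP X).1 finX.
exists (undup s) => [|g]; first exact: undup_uniq.
rewrite mem_undup; change (g \in s <-> X g); rewrite sE; split; exact.
Qed.

(** * Dietzmann's lemma on finite conjugation-invariant sets of torsion elements *)

Section Dietzmann.
Variables (G : groupType) (X : seq G) (k : nat).
Hypothesis k_gt0 : (0 < k)%N.
Hypothesis XJ : forall g x, g \in X -> g ^ x \in X.
Hypothesis Xk : forall g, g \in X -> g ^+ k = 1.

Let pr (w : seq G) : G := foldr (fun x y => x * y) 1 w.

Let pull x w : all [in X] w -> x \in w -> exists w',
  [/\ all [in X] w', size w = (size w').+1, pr w = x * pr w'
    & count_mem x w = (count_mem x w').+1].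
Proof.
elim: w => // y w IHw /= /andP[Xy Xw]; rewrite inE eq_sym.
have [<- _|yx /= xw] := eqVneq y x; first by exists w.
have [w' [Xw' -> -> ->]] := IHw Xw xw; exists (y ^ x :: w'); split=> //=.
- by rewrite XJ.
- by rewrite /conjg !mulgA mulgV mul1g.
- have -> // : (y ^ x == x) = false.
  apply/negP => /eqP yxE; case/eqP: yx; apply: (conjg_inj x).
  by rewrite yxE /conjg mulKg.
Qed.

Let pulln x n w : all [in X] w -> (n <= count_mem x w)%N -> exists w',
  [/\ all [in X] w', size w = (n + size w')%N & pr w = x ^+ n * pr w'].
Proof.
elim: n w => [|n IHn] w Xw nw; first by exists w; rewrite expg0 mul1g.
have xw : x \in w by rewrite -has_pred1 has_count (leq_trans _ nw).
have [w' [Xw' -> -> cE]] := pull Xw xw; rewrite cE ltnS in nw.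
have [w2 [Xw2 -> ->]] := IHn _ Xw' nw.
by exists w2; rewrite mulgA -expgS.
Qed.

(** In a word longer than [size X * k] some letter occurs [k] times by the pigeonhole principle;
    pulled to the front, these copies cancel. *)
Let shorten w : all [in X] w -> exists w',
  [/\ all [in X] w', (size w' <= size X * k)%N & pr w = pr w'].
Proof.
have [n] := ubnP (size w); elim: n w => // n IHn w; rewrite ltnS => wn Xw.
have [wk|wk] := leqP (size w) (size X * k); first by exists w.
have [x Xx kx] : exists2 x, x \in X & (k <= count_mem x w)%N.
  apply: contrapT => nx.
  suff : (size w <= size X * k)%N by rewrite leqNgt wk.
  apply: (@leq_trans (\sum_(x <- undup X) count_mem x w)).
    have -> : size w = count [in undup X] w.
      rewrite -count_predT; apply: eq_in_count => y yw.
      by rewrite mem_undup (allP Xw).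
    elim: {Xw wn wk nx} w => [|y w IHw] //=; under eq_bigr do rewrite /=.
    rewrite big_split /= leq_add //.
    case: (boolP (y \in undup X)) => // yX.
    by rewrite (bigD1_seq y) ?undup_uniq //= eqxx.
  apply: (@leq_trans (\sum_(x <- undup X) k)).
    rewrite !big_seq; apply: leq_sum => x; rewrite mem_undup => Xx.
    rewrite leqNgt; apply/negP => kx; apply: nx; exists x => //; exact: ltnW.
  by rewrite big_const_seq count_predT iter_addn_0 mulnC leq_mul2r size_undup orbT.
have [w' [Xw' sw ->]] := pulln Xw kx; rewrite (Xk Xx) mul1g.
have [|w2 [? ? ->]] := IHn w' _ Xw'; last by exists w2.
by apply: leq_trans wn; rewrite sw -[X in (X < _)%N]add0n ltn_add2r.
Qed.

(** [N] lists the values of words of length at most [size X * k]. By [shorten] these are the values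
    of all words, so multiplying by a letter stays in [N]. *)
Lemma dietzmann : exists N : seq G, [/\ uniq N, 1 \in N
  & forall g n, g \in X -> n \in N -> g * n \in N].
Proof.
pose fix words n := if n is m.+1 then words m ++ [seq x * y | x <- X, y <- words m]
  else [:: 1].
have wordsP n g : g \in words n <-> exists w, [/\ all [in X] w, (size w <= n)%N & g = pr w].
  elim: n g => [|n IHn] g /=.
    rewrite inE; split=> [/eqP->|[w [_]]]; first by exists [::].
    by rewrite leqn0 size_eq0 => /eqP-> ->; exact: eqxx.
  rewrite mem_cat; split.
    case/orP=> [/IHn[w [Xw wn ->]]|/allpairsP[[x y] /= [Xx /IHn[w [Xw wn ->]] ->]]].
      by exists w; rewrite leqW.
    by exists (x :: w); rewrite /= Xx.
  case=> -[|x w] [/= Xw wn ->].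
    by apply/orP; left; apply/IHn; exists [::].
  case/andP: Xw => Xx Xw; apply/orP; right; apply/allpairsP; exists (x, pr w).
  by split=> //; apply/IHn; exists w.
exists (undup (words (size X * k)%N)).
split=> [||g n Xg]; rewrite ?undup_uniq ?mem_undup //.
  by apply/wordsP; exists [::].
move=> /wordsP[w [Xw _ ->]]; apply/wordsP.
by have [|w' [? ? ?]] := @shorten (g :: w); [rewrite /= Xg|exists w'].
Qed.

End Dietzmann.

(** * Universal property of the amalgam *)

Section Amalgam.
Variables (H G1 G2 : groupType) (i1 : H -> G1) (i2 : H -> G2).
Local Notation A := (amalgam i1 i2).
Local Notation S :=
  [set fp_inl G2 (i1 h) * (fp_inr G1 (i2 h))^-1 | h in [set: H]].

Definition amalgam_pi (x : free_product G1 G2) : A :=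
  setoid_pi (P := ncl_setoid_group S) x.
Definition amalgam_inl (x : G1) : A := amalgam_pi (fp_inl G2 x).
Definition amalgam_inr (x : G2) : A := amalgam_pi (fp_inr G1 x).

Let amalgam_piM x y : amalgam_pi (x * y) = amalgam_pi x * amalgam_pi y.
Proof. exact: (@setoid_piM (ncl_setoid_group S)). Qed.

Lemma amalgam_inlM x y : amalgam_inl (x * y) = amalgam_inl x * amalgam_inl y.
Proof.
rewrite -amalgam_piM; congr amalgam_pi; rewrite /fp_inl.
rewrite -(@setoid_piM (fp_setoid_group G1 G2)); apply/setoid_piP.
by apply: fp_sym; exact: fp_mul_l.
Qed.

Lemma amalgam_inrM x y : amalgam_inr (x * y) = amalgam_inr x * amalgam_inr y.
Proof.
rewrite -amalgam_piM; congr amalgam_pi; rewrite /fp_inr.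
rewrite -(@setoid_piM (fp_setoid_group G1 G2)); apply/setoid_piP.
by apply: fp_sym; exact: fp_mul_r.
Qed.

Lemma amalgam_agree h : amalgam_inl (i1 h) = amalgam_inr (i2 h).
Proof.
apply/setoid_piP => /=; set a := fp_inl _ _; set b := fp_inr _ _.
have N : normal_closure S (a * b^-1) by move=> B [_]; apply; exists h.
have := normal_closureV (normal_closureJ a N).
by rewrite conjgE -mulgA mulKg invgM invgK.
Qed.

Lemma amalgam_ind (P : A -> Prop) :
  (forall x y, P x -> P y -> P (x * y)) ->
  (forall x, P (amalgam_inl x)) -> (forall y, P (amalgam_inr y)) ->
  forall a, P a.
Proof.
move=> PM Pl Pr; elim/setoid_piW; elim/setoid_piW; elim=> [|l w IHw].
  have -> // : setoid_pi (P := ncl_setoid_group S)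
    (setoid_pi (P := fp_setoid_group G1 G2) [::]) = amalgam_inl 1.
  congr setoid_pi; apply/setoid_piP; apply: fp_sym; exact: fp_one_l.
have -> : setoid_pi (P := fp_setoid_group G1 G2) (l :: w) =
    setoid_pi (P := fp_setoid_group G1 G2) [:: l] *
    setoid_pi (P := fp_setoid_group G1 G2) w.
  by rewrite -(@setoid_piM (fp_setoid_group G1 G2)).
rewrite (@setoid_piM (ncl_setoid_group S)); apply: PM => //.
by case: l => x; [exact: Pl | exact: Pr].
Qed.

Variables (M : Type) (op : M -> M -> M) (e : M).
Hypothesis opA : associative op.
Hypothesis op1l : left_id e op.
Hypothesis op1r : right_id e op.
Variables (f1 : G1 -> M) (f2 : G2 -> M).
Hypothesis f1M : forall x y, f1 (x * y) = op (f1 x) (f1 y).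
Hypothesis f2M : forall x y, f2 (x * y) = op (f2 x) (f2 y).
Hypothesis f11 : f1 1 = e.
Hypothesis f21 : f2 1 = e.
Hypothesis f12 : forall h, f1 (i1 h) = f2 (i2 h).

(** The target is a monoid rather than a group, so that the same statement serves permutations and
    square matrices. *)
Lemma amalgam_lift : exists f : A -> M,
  [/\ forall x y, f (x * y) = op (f x) (f y), forall x, f (amalgam_inl x) = f1 x
    & forall y, f (amalgam_inr y) = f2 y].
Proof.
pose ev := foldr (fun (l : G1 + G2) m =>
  op (match l with inl x => f1 x | inr y => f2 y end) m) e.
have ev_cat u v : ev (u ++ v) = op (ev u) (ev v).
  by elim: u => [|l u IHu] /=; rewrite ?op1l // IHu opA.
have ev_eqv u v : fp_eqv u v -> ev u = ev v.
  elim=> {u v} //= [u v w _ -> _ ->|u u' v v' _ uu _ vv|||x y|x y] //.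
  - by rewrite !ev_cat uu vv.
  - by rewrite f11 op1l.
  - by rewrite f21 op1l.
  - by rewrite !op1r f1M.
  - by rewrite !op1r f2M.
pose F (x : free_product G1 G2) := ev (repr x).
have FE w : F (setoid_pi (P := fp_setoid_group G1 G2) w) = ev w.
  apply: ev_eqv; apply/(@setoid_piP (fp_setoid_group G1 G2)).
  by rewrite /setoid_pi reprK.
have FM x y : F (x * y) = op (F x) (F y).
  elim/setoid_piW: x => u; elim/setoid_piW: y => v.
  by rewrite -setoid_piM !FE ev_cat.
have F1 : F 1 = e by rewrite [1](_ : _ = setoid_pi (P := fp_setoid_group G1 G2) [::]) // FE.
(* The elements sent to [e] form a normal subgroup containing the relators; inverses are treated
   through [F (z^-1 * z) = e], since [M] offers none. *)
have FN x : normal_closure S x -> F x = e.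
  move=> Nx; apply: (Nx [set x | F x = e]); split=> [|_ [h _ <-]].
    have FV z : F z = e -> F z^-1 = e.
      by move=> Fz; rewrite -[LHS]op1r -{1}Fz -FM mulVg.
    split=> //.
    - by split=> // u v /= Fu Fv; rewrite FM Fu FV // op1l.
    - by move=> u v _ /= Fv; rewrite !FM Fv op1l -FM mulVg.
  set a := fp_inl _ _; set b := fp_inr _ _.
  have Fab : F a = F b by rewrite !FE /= f12.
  by rewrite /= FM Fab -FM mulgV.
pose f (x : A) := F (repr x).
have fE x : f (amalgam_pi x) = F x.
  have /setoid_piP : setoid_pi (P := ncl_setoid_group S) x =
    setoid_pi (P := ncl_setoid_group S) (repr (amalgam_pi x)).
    by rewrite [RHS]/setoid_pi reprK.
  move=> /FN; rewrite FM => E; rewrite /f -[LHS]op1l.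
  by rewrite -F1 -(mulgV x) FM -opA E op1r.
exists f; split=> [x y|x|y].
- elim/setoid_piW: x => u; elim/setoid_piW: y => v.
  by rewrite -setoid_piM [setoid_pi _]/(amalgam_pi _) ![setoid_pi _]/(amalgam_pi _) !fE FM.
- by rewrite fE FE /= op1r.
- by rewrite fE FE /= op1r.
Qed.

End Amalgam.

Local Close Scope classical_set_scope.

(** * Permutations *)

Section Actions.
Variable G : groupType.

Definition is_action (X : finType) (a : G -> {perm X}) :=
  forall g h, a (g * h) = a g * a h.

Lemma action1 (X : finType) (a : G -> {perm X}) : is_action a -> a 1 = 1.
Proof. by move=> aM; apply: (mulgI (a 1)); rewrite -aM !mulg1. Qed.

Lemma actionMx (X : finType) (a : G -> {perm X}) g h x : is_action a ->
  a (g * h) x = a h (a g x).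
Proof. by move=> ->; rewrite permM. Qed.

Lemma actionK (X : finType) (a : G -> {perm X}) g x : is_action a ->
  a g^-1 (a g x) = x.
Proof. by move=> aM; rewrite -actionMx // mulgV action1 // perm1. Qed.

Lemma actionKV (X : finType) (a : G -> {perm X}) g x : is_action a ->
  a g (a g^-1 x) = x.
Proof. by move=> aM; rewrite -actionMx // mulVg action1 // perm1. Qed.

Lemma trivial_action (X : finType) : is_action (fun=> 1 : {perm X}).
Proof. by move=> g h; rewrite mulg1. Qed.

Definition perm_of (X : finType) (f : X -> X) : {perm X} :=
  if pselect (injective f) is left fI then perm fI else 1.

Lemma perm_ofE (X : finType) (f : X -> X) : injective f -> perm_of f =1 f.
Proof. by rewrite /perm_of => fI x; case: pselect => // ?; rewrite permE. Qed.

Lemma action_of (X : finType) (f : G -> X -> X) :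
  (forall x, f 1 x = x) -> (forall g h x, f (g * h) x = f h (f g x)) ->
  exists2 a : G -> {perm X}, is_action a & forall g, a g =1 f g.
Proof.
move=> f1 fM; have fI g : injective (f g).
  by apply: (can_inj (g := f g^-1)) => x; rewrite -fM mulgV f1.
exists (fun g => perm_of (f g)) => [g h|g]; last exact: perm_ofE.
by apply/permP => x; rewrite permM !perm_ofE.
Qed.

End Actions.

(** * Finite H-sets and their stabilizer counts *)

Section StabilizerCounts.
Variable H : finGroupType.

Definition stab (X : finType) (a : H -> {perm X}) (x : X) : {set H} :=
  [set h | a h x == x].

(** These counts are the multiplicities of H in the permutation case: they determine a finite H-set
    up to isomorphism and are additive over disjoint unions. Counting points instead of orbits
    avoids representatives. *)
Definition stab_count (X : finType) (a : H -> {perm X}) (S : {set H}) : nat :=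
  #|[set x | stab a x == S]|.

Lemma sum_stab_count (X : finType) (a : H -> {perm X}) :
  (\sum_S stab_count a S)%N = #|X|.
Proof.
rewrite -[RHS]sum1_card (partition_big (stab a) xpredT) //=.
apply: eq_bigr => S _; rewrite sum1_card; apply: eq_card => x.
by rewrite !inE.
Qed.

Lemma stab_count_trivial (X : finType) S :
  stab_count (fun=> 1 : {perm X}) S = ((S == [set: H]) * #|X|)%N.
Proof.
rewrite /stab_count; have [->|nS] := eqVneq S [set: H].
  rewrite mul1n; apply: eq_card => x; rewrite !inE; apply/eqP/setP => h.
  by rewrite !inE perm1 eqxx.
apply/eqP; rewrite cards_eq0; apply/eqP/setP => x; rewrite !inE.
apply: contra_neqF nS => /eqP <-; apply/setP => h.
by rewrite !inE perm1 eqxx.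
Qed.

(* A point outside the domain goes to any point outside the image with the same
   stabilizer, its orbit following by equivariance. *)
Lemma extend_equivariant (X Y : finType) (a : H -> {perm X}) (b : H -> {perm Y})
    (A : {set X}) (f : X -> Y) :
  is_action a -> is_action b ->
  (forall S, stab_count a S = stab_count b S) ->
  (forall h x, x \in A -> a h x \in A) ->
  {in A &, injective f} -> (forall h x, x \in A -> f (a h x) = b h (f x)) ->
  exists F : X -> Y, [/\ injective F, forall h x, F (a h x) = b h (F x)
    & {in A, F =1 f}].
Proof.
move=> aM bM ab; have [n] := ubnP #|~: A|.
elim: n A f => // n IHn A f; rewrite ltnS => An AH fI fE.
have [AT|[x xA]] : A = [set: X] \/ exists x, x \notin A.
  have [/setP AT|nA] := pselect (A =i [set: X]); first by left.
  by right; apply: contrapT => /forallNP nx; apply: nA => x; rewrite inE;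
    apply: contrapT => /negP xA; exact: (nx x).
  by exists f; split=> // [x y|h x]; [apply: fI|apply: fE]; rewrite AT inE.
have stabf z : z \in A -> stab b (f z) = stab a z.
  move=> zA; apply/setP => h; rewrite !inE -fE //.
  by apply/eqP/eqP => [/fI->//|->//]; exact: AH.
(* Otherwise every point of [Y] with the stabilizer of [x] is the image of a point of [A] with that
   stabilizer; as [x] lies outside [A], there would be fewer of them in [Y] than in [X]. *)
have [y yA yS] : exists2 y, y \notin f @: A & stab b y = stab a x.
  apply: contrapT => ny.
  have : [set y | stab b y == stab a x] \subset
      f @: (A :&: [set z | stab a z == stab a x]).
    apply/fintype.subsetP => y; rewrite inE => /eqP yS.
    have /imsetP[z zA yE] : y \in f @: A.
      by apply: contrapT => /negP yA; apply: ny; exists y.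
    by apply/imsetP; exists z => //; rewrite !inE zA -stabf // -yE yS eqxx.
  move=> /subset_leq_card; rewrite -/(stab_count b (stab a x)) -ab leqNgt.
  apply/negP; rewrite negbK; apply: (leq_ltn_trans (leq_imset_card _ _)).
  apply: proper_card; apply/fintype.properP; split; first exact: finset.subsetIr.
  by exists x; rewrite !inE ?eqxx // (negPf xA).
pose O := [set a h x | h in [set: H]].
have eq_orb h k : (a h x == a k x) = (b h y == b k y).
  have aux (Z : finType) (c : H -> {perm Z}) z : is_action c ->
      (c h z == c k z) = (h * k^-1 \in stab c z).
    move=> cM; rewrite inE actionMx //; apply/eqP/eqP => [->|]; first exact: actionK.
    by move=> {2}<-; rewrite actionKV.
  by rewrite !aux // yS.
have OA h : a h x \notin A.
  by apply: contra xA => /(AH h^-1); rewrite actionK.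
pose g z := if [pick h | a h x == z] is Some h then b h y else f z.
have gO h : g (a h x) = b h y.
  rewrite /g; case: pickP => [k|/(_ h)]; last by rewrite eqxx.
  by rewrite eq_orb => /eqP.
have gA z : z \in A -> g z = f z.
  rewrite /g; case: pickP => // h /eqP <-.
  by rewrite (negPf (OA h)).
have [||||F [FI FE Ff]] := IHn (A :|: O) g.
- apply: leq_trans An; apply: proper_card; apply/fintype.properP; split.
    by rewrite finset.setCS finset.subsetUl.
  exists x; rewrite !inE // negbK; apply/orP; right.
  by apply/imsetP; exists 1; rewrite ?inE ?action1 ?perm1.
- move=> h z; rewrite !inE => /orP[/(AH h)->//|/imsetP[k _ ->]].
  by apply/orP; right; apply/imsetP; exists (k * h); rewrite ?inE ?actionMx.
- have fgO z h : z \in A -> f z <> b h y.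
    move=> zA fz; case/negP: yA; apply/imsetP; exists (a h^-1 z); first exact: AH.
    by rewrite fE // fz actionK.
  move=> z w; rewrite !inE => /orP[zA|/imsetP[h _ ->]] /orP[wA|/imsetP[k _ ->]].
  + by rewrite !gA //; exact: fI.
  + by rewrite gA // gO => /(fgO _ _ zA).
  + by rewrite [g w]gA // gO => /esym/(fgO _ _ wA).
  + by rewrite !gO => /eqP; rewrite -eq_orb => /eqP.
- move=> h z; rewrite inE => /orP[zA|/imsetP[k _ ->]].
    by rewrite !gA ?AH // fE.
  by rewrite -actionMx // !gO actionMx.
exists F; split=> // z zA; rewrite Ff ?gA // inE zA //.
Qed.

End StabilizerCounts.

Section ActionConstructions.
Variable G : groupType.

Lemma restrict_action (X : finType) (a : G -> {perm X}) (p : pred X) :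
  is_action a -> (forall g x, p (a g x) = p x) ->
  exists2 b : G -> {perm {x | p x}}, is_action b
    & forall g x, val (b g x) = a g (val x).
Proof.
move=> aM ap.
have [|g h x|b bM bE] := @action_of G _ (fun g (x : {x | p x}) =>
    Sub (a g (val x)) (etrans (ap g (val x)) (valP x)) : {x | p x}).
- by move=> x; apply: val_inj => /=; rewrite action1 // perm1.
- by apply: val_inj => /=; exact: actionMx.
by exists b => // g x; rewrite bE SubK.
Qed.

Lemma partial_action (X : finType) (a : G -> {perm X}) (p : pred X) :
  is_action a -> (forall g x, p (a g x) = p x) ->
  exists2 b : G -> {perm X}, is_action b
    & forall g x, b g x = if p x then a g x else x.
Proof.
move=> aM ap; apply: action_of => [x|g h x].
  by rewrite action1 // perm1 if_same.
by case: ifP => [px|->//]; rewrite ap px actionMx.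
Qed.

Lemma sum_action (X Y : finType) (a : G -> {perm X}) (b : G -> {perm Y}) :
  is_action a -> is_action b -> exists2 c : G -> {perm (X + Y)%type},
    is_action c & forall g x, c g x = match x with
      | inl x => inl (a g x) | inr y => inr (b g y) end.
Proof.
move=> aM bM; apply: action_of => [[x|y]|g h [x|y]].
- by rewrite action1 // perm1.
- by rewrite action1 // perm1.
- by rewrite actionMx.
- by rewrite actionMx.
Qed.

End ActionConstructions.

Section SumStabilizers.
Variable H : finGroupType.

Lemma stab_count_sum (X Y : finType) (a : H -> {perm X}) (b : H -> {perm Y})
    (c : H -> {perm (X + Y)%type}) (S : {set H}) :
  (forall g x, c g x = match x with
      | inl x => inl (a g x) | inr y => inr (b g y) end) ->
  stab_count c S = (stab_count a S + stab_count b S)%N.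
Proof.
move=> cE; rewrite /stab_count -!sum1_card big_sumType /=.
congr (_ + _)%N; apply: eq_bigl => x; rewrite !inE; congr (_ == _);
  by apply/setP => h; rewrite !inE cE.
Qed.

End SumStabilizers.

(** * Types of the points of a G-set *)

Section ActionTypes.
Variables (H : finGroupType) (G : groupType) (i : {multiplicative H -> G}).
Variable s : seq G.
Hypothesis sP : forall g, g \in s <-> exists h x, g = i h ^ x.

Let C := seq_sub s.

Let conj_mem x (g : C) : val g ^ x \in s.
Proof.
by have /sP[h [y ->]] := valP g; apply/sP; exists h, (y * x); rewrite conjgM.
Qed.
Let cj x (g : C) : C := SeqSub (conj_mem x g).

Let img_mem h : i h \in s.
Proof. by apply/sP; exists h, 1; rewrite conjg1. Qed.
Let img h : C := SeqSub (img_mem h).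

(** [A] stands for the set of those conjugates of elements of H that fix a point; [shift A x] is the
    corresponding set for the point moved by [x]. *)
Let shift (A : {set C}) x : {set C} := [set g | cj x^-1 g \in A].
Let orb (A : {set C}) : {set {set C}} := [set B | `[< exists x, B = shift A x >]].
Let tr (A : {set C}) : {set H} := [set h | img h \in A].

Let shiftM A x y : shift (shift A x) y = shift A (x * y).
Proof.
apply/setP => g; rewrite !inE; congr (_ \in A); apply: val_inj => /=.
by rewrite invgM conjgM.
Qed.

Let shift1 A : shift A 1 = A.
Proof.
apply/setP => g; rewrite !inE; congr (_ \in A); apply: val_inj => /=.
by rewrite invg1 conjg1.
Qed.

Let orb_shift A x : orb (shift A x) = orb A.
Proof.
apply/setP => B; rewrite !inE; apply/asboolP/asboolP => -[y ->].
  by exists (x * y); rewrite shiftM.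
by exists (x^-1 * y); rewrite shiftM mulKVg.
Qed.

Let alpha (t : {set {set C}}) (S : {set H}) : rat :=
  (#|[set A in t | tr A == S]|%:R / #|t|%:R)%R.

(* The type of a point is the G-orbit of its stabilizer among the finitely many
   conjugates of elements of H; points with conjugate stabilizers are equally
   numerous, so the H-stabilizers are distributed in fixed proportions. *)
Lemma action_types : exists (T : finType) (alpha : T -> {set H} -> rat),
  forall (X : finType) (a : G -> {perm X}), is_action a ->
  exists ty : X -> T, (forall g x, ty (a g x) = ty x) /\
    forall t S, (#|[set x | (ty x == t) && (stab (a \o i) x == S)]|%:R =
      #|[set x | ty x == t]|%:R * alpha t S :> rat)%R.
Proof.
exists {set {set C}}, alpha => X a aM; pose st x : {set C} := [set g | a (val g) x == x].
have st_act g x : st (a g x) = shift (st x) g.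
  apply/setP => c; rewrite !inE /= conjgE invgK !(actionMx _ _ _ aM).
  apply/eqP/eqP => [->|{2}<-]; first exact: actionK.
  by rewrite actionKV.
exists (fun x => orb (st x)); split=> [g x|t S]; first by rewrite st_act orb_shift.
have [[x0 tE]|nt] := pselect (exists x0, t = orb (st x0)); last first.
  rewrite (_ : [set x | orb (st x) == t] = finset.set0).
    rewrite cards0 mul0r; apply/eqP; rewrite pnatr_eq0 cards_eq0.
    by apply/eqP/setP => x; rewrite !inE; case: eqP => // xt; case: nt; exists x.
  by apply/setP => x; rewrite !inE; case: eqP => // xt; case: nt; exists x.
pose n A := #|[set x | st x == A]|.
have nE A : A \in t -> n A = n (st x0).
  rewrite tE inE => /asboolP[y ->]; rewrite /n -[RHS](card_imset _ (@perm_inj _ (a y))).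
  apply: eq_card => x; rewrite !inE; apply/eqP/imsetP => [xE|[z]].
    exists (a y^-1 x); last by rewrite actionKV.
    by rewrite inE st_act xE shiftM mulgV shift1.
  by rewrite inE => /eqP zE ->; rewrite st_act zE.
have tP x : (orb (st x) == t) = (st x \in t).
  apply/eqP/idP => [<-|]; first by rewrite inE; apply/asboolP; exists 1; rewrite shift1.
  by rewrite tE inE => /asboolP[y ->]; rewrite orb_shift.
(* Each stabilizer trace in the orbit [t] belongs to the same number of points. Applied to the
   condition [tr A == S] and to the trivial one, this gives the fixed proportion [alpha t S]. *)
have cnt (p : pred {set C}) : #|[set x | (st x \in t) && p (st x)]| =
    (#|[set A in t | p A]| * n (st x0))%N.
  rewrite -sum1_card (partition_big st [in [set A in t | p A]]) /=; last first.
    by move=> x; rewrite !inE.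
  rewrite -sum_nat_const; apply: eq_bigr => A; rewrite inE => /andP[At pA].
  rewrite -(nE A At) sum1_card; apply: eq_card => x; rewrite [LHS]unfold_in !inE.
  by case: (eqVneq (st x) A) => [->|]; rewrite ?andbF // At pA.
have stE x : stab (a \o i) x = tr (st x) by apply/setP => h; rewrite !inE.
have -> : [set x | orb (st x) == t] = [set x | (st x \in t) && predT (st x)].
  by apply/setP => x; rewrite !inE tP andbT.
rewrite (_ : [set x | _ && _] = [set x | (st x \in t) && (tr (st x) == S)]).
  rewrite (cnt (fun A => tr A == S)) (cnt predT) /alpha.
  rewrite (_ : [set A in t | predT A] = t); last by apply/setP => A; rewrite inE andbT.
  have t0 : (#|t|%:R != 0 :> rat)%R.
    by rewrite pnatr_eq0 cards_eq0; apply/set0Pn; exists (st x0); rewrite -tP tE.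
  by rewrite !natrM mulrAC mulrCA divff // mulr1 mulrC.
by apply/setP => x; rewrite !inE tP stE.
Qed.

End ActionTypes.

(* [b] is [a] made trivial on the points whose type is not in [K]. *)
Lemma action_decomposition (H : finGroupType) (G : groupType)
    (i : {multiplicative H -> G}) : almost_normal (range i) ->
  exists (T : finType) (alpha : T -> {set H} -> rat),
  forall (X : finType) (a : G -> {perm X}), is_action a -> exists z : T -> nat,
  [/\ forall t, exists (Y : finType) (b : G -> {perm Y}), [/\ is_action b, #|Y| = z t
        & forall S, ((stab_count (b \o i) S)%:R = (z t)%:R * alpha t S)%R],
      forall S, ((stab_count (a \o i) S)%:R = \sum_t (z t)%:R * alpha t S)%R
    & forall K : pred T, exists b : G -> {perm X}, [/\ is_action b,
        forall S, ((stab_count (b \o i) S)%:R = \sum_(t | K t) (z t)%:R * alpha t S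
          + ((S == [set: H]) * \sum_(t | ~~ K t) z t)%:R)%R
      & forall g, (#|[set x | b g x != a g x]| <= \sum_(t | ~~ K t) z t)%N]].
Proof.
move=> /almost_normal_conj[s _ /action_types[T [alpha typesP]]].
exists T, alpha => X a aM; have [ty [tyJ tyE]] := typesP X a aM.
pose z t := #|[set x | ty x == t]|.
exists z; split=> [t|S|K].
- have [|b bM bE] := @restrict_action G X a (fun x => ty x == t) aM.
    by move=> g x; rewrite tyJ.
  exists {x | ty x == t}, b; split=> // [|S].
    by rewrite card_sig; apply: eq_card => x; rewrite !inE.
  rewrite -tyE; congr (_%:R)%R; rewrite /stab_count -(card_imset _ val_inj).
  have stE x : stab (b \o i) x = stab (a \o i) (val x).
    by apply/setP => h; rewrite !inE -val_eqE bE.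
  apply: eq_card => x; rewrite !inE; apply/imsetP/andP => [[y]|[tx xS]].
    by rewrite inE stE => yS ->; rewrite (valP y).
  by exists (Sub x tx); rewrite ?inE ?stE ?SubK.
- under eq_bigr do rewrite -tyE.
  rewrite -natr_sum; congr (_%:R)%R.
  rewrite /stab_count -sum1_card (partition_big ty xpredT) //=.
  apply: eq_bigr => t _; rewrite sum1_card; apply: eq_card => x.
  by rewrite [LHS]unfold_in !inE andbC.
have [|b bM bE] := @partial_action G X a (fun x => K (ty x)) aM.
  by move=> g x; rewrite tyJ.
have zK : (\sum_(t | ~~ K t) z t)%N = #|[set x | ~~ K (ty x)]|.
  rewrite -sum1_card (partition_big ty (fun t => ~~ K t)) //=; last first.
    by move=> x; rewrite inE.
  apply: eq_bigr => t Kt; rewrite sum1_card; apply: eq_card => x.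
  by rewrite [RHS]unfold_in !inE; case: (eqVneq (ty x) t) => [->|]; rewrite ?andbF ?Kt.
exists b; split=> // [S|g]; last first.
  rewrite zK; apply: subset_leq_card; apply/fintype.subsetP => x.
  by rewrite !inE bE; case: ifP; rewrite ?eqxx.
under [X in (X + _)%R]eq_bigr do rewrite -tyE.
rewrite -natr_sum -natrD; congr (_%:R)%R.
rewrite /stab_count -sum1_card (bigID (fun x => K (ty x))) /=; congr (_ + _)%N.
  rewrite (partition_big ty K) //=; last by move=> x /andP[].
  apply: eq_bigr => t Kt; rewrite sum1_card; apply: eq_card => x.
  rewrite [LHS]unfold_in !inE; case: (eqVneq (ty x) t) => [E|]; rewrite ?andbF ?andbT ?andFb // E Kt.
  by rewrite andbT andTb; congr (_ == _); apply/setP => h; rewrite !inE /= bE E Kt.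
rewrite sum1_card zK; have [->|nS] := eqVneq S [set: H].
  rewrite mul1n; apply: eq_card => x; rewrite [LHS]unfold_in !inE andbC.
  case: (boolP (K _)) => // Kx.
  by apply/eqP/setP => h; rewrite !inE /= bE (negPf Kx) eqxx.
rewrite mul0n; apply: eq_card0 => x; rewrite [LHS]unfold_in !inE andbC.
case: (boolP (K _)) => //= Kx; apply: contra_neqF nS => /eqP <-.
by apply/setP => h; rewrite !inE /= bE (negPf Kx) eqxx.
Qed.

(** The admissible sizes of a type, in the role of [E] in the balancing lemmas: closed under
    addition by disjoint union, but possibly missing many numbers. *)
Definition P_realizable (H : finGroupType) (G : groupType) (i : H -> G)
    (w : {set H} -> rat) (n : nat) : Prop :=
  exists (Y : finType) (b : G -> {perm Y}), [/\ is_action b, #|Y| = n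
    & forall S, ((stab_count (b \o i) S)%:R = n%:R * w S)%R].

Section ActionRealizable.
Variables (H : finGroupType) (G : groupType) (i : H -> G).

Lemma empty_action : exists b : G -> {perm void}, is_action b.
Proof. by exists (fun=> 1) => g h; rewrite mulg1. Qed.

Lemma stab_count_void (b : H -> {perm void}) S : stab_count b S = 0%N.
Proof. by apply: eq_card0 => -[]. Qed.

Lemma P_realizable0 w : P_realizable i w 0.
Proof.
have [b bM] := empty_action; exists void, b; split=> // [|S]; first exact: card_void.
by rewrite stab_count_void mul0r.
Qed.

Lemma P_realizableD w m n :
  P_realizable i w m -> P_realizable i w n -> P_realizable i w (m + n).
Proof.
move=> [X [a [aM Xm aE]]] [Y [b [bM Yn bE]]].
have [c cM cE] := sum_action aM bM; exists (X + Y)%type, c.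
split=> // [|S]; first by rewrite card_sum Xm Yn.
rewrite (@stab_count_sum _ _ _ (a \o i) (b \o i)) => [|h x]; last exact: cE.
by rewrite !natrD mulrDl aE bE.
Qed.

Lemma P_realizable_int w n S : P_realizable i w n -> (n%:R * w S \in Num.int)%R.
Proof. by case=> Y [b [_ _ <-]]; exact: rpred_nat. Qed.

Lemma P_realizable_sum (T : finType) (w : T -> {set H} -> rat) (s : T -> nat) :
  (forall t, P_realizable i (w t) (s t)) ->
  exists (Y : finType) (b : G -> {perm Y}), [/\ is_action b, #|Y| = (\sum_t s t)%N
    & forall S, ((stab_count (b \o i) S)%:R = \sum_t (s t)%:R * w t S)%R].
Proof.
move=> sR; elim: (index_enum T) => [|t l [Y [b [bM Yn bE]]]].
  have [b bM] := empty_action; exists void, b; split=> // [|S].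
    by rewrite big_nil card_void.
  by rewrite big_nil stab_count_void.
have [X [a [aM Xn aE]]] := sR t.
have [c cM cE] := sum_action aM bM; exists (X + Y)%type, c.
split=> // [|S]; first by rewrite card_sum big_cons Xn Yn.
rewrite (@stab_count_sum _ _ _ (a \o i) (b \o i)) => [|h x]; last exact: cE.
by rewrite natrD big_cons aE bE.
Qed.

End ActionRealizable.

(** * Correction of one pair of permutation actions *)

Section PermutationStep.
Variables (H : finGroupType) (G1 G2 : groupType).
Variables (i1 : {multiplicative H -> G1}) (i2 : {multiplicative H -> G2}).
Hypotheses (an1 : almost_normal (range i1)) (an2 : almost_normal (range i2)).

Lemma card_bad_le (X : finType) (I : finType) (p : I -> pred X) (m : nat) :
  (forall j, #|[set x | p j x]| <= m)%N ->
  (#|[set x | [exists j, p j x]]| <= #|I| * m)%N.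
Proof.
move=> pm; apply: (@leq_trans (\sum_j #|[set x | p j x]|)); last first.
  by rewrite -sum_nat_const; apply: leq_sum => j _; exact: pm.
rewrite -sum1_card; under [leqRHS]eq_bigr do rewrite -sum1_card big_mkcond.
rewrite exchange_big /= big_mkcond /=; apply: leq_sum => x _; rewrite inE.
case: ifP => // /existsP[j pj].
by rewrite (bigD1 j) //= inE pj.
Qed.

(** On [A] the injection preserves stabilizers, and the image of [A] misses at most [2 * eta] points
    of [Y]. As [n] does not involve [Y], it serves to compare actions on two different sets. *)
Lemma stab_count_le (X Y : finType) (theta : H -> {perm X}) (j : X -> Y)
    (a : H -> {perm Y}) (eta : nat) (S : {set H}) (A : {set X}) :
  injective j -> (#|Y| <= #|X| + eta)%N ->
  (#|~: A| <= eta)%N ->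
  (forall x, x \in A -> forall h, j (theta h x) = a h (j x)) ->
  let n := #|[set x in A | stab theta x == S]| in
  (n <= stab_count a S)%N /\ (stab_count a S <= n + 2 * eta)%N.
Proof.
move=> jI Yeta Aeta Ah n.
have stabj x : x \in A -> stab a (j x) = stab theta x.
  by move=> xA; apply/setP => h; rewrite !inE -Ah // (inj_eq jI).
have nE : n = #|j @: [set x in A | stab theta x == S]| by rewrite card_imset.
split.
  rewrite nE; apply: subset_leq_card; apply/fintype.subsetP => _ /imsetP[x xA ->].
  by move: xA; rewrite !inE => /andP[xA xS]; rewrite stabj.
rewrite nE.
have : (stab_count a S <= #|(j @: [set x in A | stab theta x == S]) :|: ~: (j @: A)|)%N.
  apply: subset_leq_card; apply/fintype.subsetP => y; rewrite !inE => yS.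
  case: (boolP (y \in j @: A)); rewrite ?orbT // orbF => /imsetP[x xA yE].
  by apply/imsetP; exists x => //; rewrite inE xA -stabj // -yE.
move=> /leq_trans; apply; apply: (leq_trans (leq_card_setU _ _)).
rewrite leq_add2l cardsCs finset.setCK card_imset // leq_subLR.
apply: (leq_trans Yeta); rewrite -(cardsC A) mul2n -addnn addnA leq_add2r.
by rewrite leq_add2l.
Qed.

(** The statement for a single set, in absolute counts. [theta] stands for the given asymptotic
    homomorphism on H, hence is only a family of permutations, and [m] for any of its values on a
    factor. *)
Lemma P_step : exists c : nat, forall (X Y1 Y2 : finType) (eta : nat)
    (theta : H -> {perm X}) (j1 : X -> Y1) (j2 : X -> Y2)
    (a1 : G1 -> {perm Y1}) (a2 : G2 -> {perm Y2}),
  X -> injective j1 -> injective j2 -> is_action a1 -> is_action a2 ->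
  (#|Y1| <= #|X| + eta)%N -> (#|Y2| <= #|X| + eta)%N ->
  (forall h, #|[set x | j1 (theta h x) != a1 (i1 h) (j1 x)]| <= eta)%N ->
  (forall h, #|[set x | j2 (theta h x) != a2 (i2 h) (j2 x)]| <= eta)%N ->
  exists (Z : finType) (J : X -> Z) (b1 : G1 -> {perm Z}) (b2 : G2 -> {perm Z}),
  [/\ injective J, (#|Z| <= #|X| + c * eta)%N, is_action b1 /\ is_action b2,
      forall h, b1 (i1 h) = b2 (i2 h)
    & (forall g (m : {perm X}), (#|[set x | J (m x) != b1 g (J x)]| <=
         #|[set x | j1 (m x) != a1 g (j1 x)]| + c * eta)%N) /\
      (forall g (m : {perm X}), (#|[set x | J (m x) != b2 g (J x)]| <=
         #|[set x | j2 (m x) != a2 g (j2 x)]| + c * eta)%N)].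
Proof.
have [T1 [w1 dec1]] := action_decomposition an1.
have [T2 [w2 dec2]] := action_decomposition an2.
have [||||||K1 [K2 [c0 bal]]] := @balance_two T1 T2 {set H} w1 w2
    (fun t => P_realizable i1 (w1 t)) (fun t => P_realizable i2 (w2 t)).
- by move=> t; exact: P_realizable0.
- by move=> t; exact: P_realizable0.
- by move=> t m n; exact: P_realizableD.
- by move=> t m n; exact: P_realizableD.
- by move=> t n S; exact: P_realizable_int.
- by move=> t n S; exact: P_realizable_int.
(* Two sides with [#|H|] bad sets each, plus [1] for the excess of [Y1] or [Y2] over [X]; the two
   counts of one stabilizer then differ by at most [2 * e * eta]. *)
pose e := (2 * #|H| + 1)%N.
pose cv := (#|{set H}| * (2 * e))%N.
pose c1 := (c0 * cv)%N.
(* For each side and each [h], the intertwining fails at [eta] points for the given action and at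
   [c1 * eta] more because the action was modified. *)
pose cD := (#|H| * (1 + c1) + #|H| * (1 + c1))%N.
exists (1 + c1 + c1 + c1 + cD + cD)%N => X Y1 Y2 eta theta j1 j2 a1 a2 x0 j1I j2I a1M a2M Y1e Y2e bad1 bad2.
have [z1 [Ez1 cnt1 /(_ K1)[a1' [a1M' cnt1' a1E]]]] := dec1 _ a1 a1M.
have [z2 [Ez2 cnt2 /(_ K2)[a2' [a2M' cnt2' a2E]]]] := dec2 _ a2 a2M.
have [s1 [s2 [Es1 Es2 sE le_del le_s]]] := bal z1 z2 Ez1 Ez2.
set v := (\sum_S _)%R in le_del le_s.
set del1 := (\sum_(t | ~~ K1 t) z1 t)%N in le_del cnt1' a1E.
set del2 := (\sum_(t | ~~ K2 t) z2 t)%N in le_del cnt2' a2E.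
have vE : (v <= (cv * eta)%:R)%R.
  pose A := ~: ([set x | [exists h, j1 (theta h x) != a1 (i1 h) (j1 x)]] :|:
     [set x | [exists h, j2 (theta h x) != a2 (i2 h) (j2 x)]]).
  have Ae : (#|~: A| <= e * eta)%N.
    rewrite finset.setCK (leq_trans (leq_card_setU _ _)) // /e mulnDl mul2n -addnn.
    rewrite mulnDl -[leqLHS]addn0 leq_add // leq_add //; exact: card_bad_le.
  have Ye (n : nat) : (n <= #|X| + eta -> n <= #|X| + e * eta)%N.
    move=> /leq_trans; apply; rewrite leq_add2l /e mulnDl mul1n; exact: leq_addl.
  rewrite /cv -mulnA natrM mulr_natl -sumr_const; apply: ler_sum => S _.
  rewrite -cnt1 -cnt2.
  have [] := @stab_count_le X Y1 theta j1 (a1 \o i1) _ S A j1I (Ye _ Y1e) Ae.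
    move=> x; rewrite !inE negb_or => /andP[/existsPn xA _] h.
    by apply/eqP; have := xA h; rewrite negbK.
  have [] := @stab_count_le X Y2 theta j2 (a2 \o i2) _ S A j2I (Ye _ Y2e) Ae.
    move=> x; rewrite !inE negb_or => /andP[_ /existsPn xA] h.
    by apply/eqP; have := xA h; rewrite negbK.
  set n := #|[set x in A | _]|; set n1 := stab_count _ _; set n2 := stab_count _ _.
  rewrite -!(ler_nat rat) -mulnA !natrD => ? ? ? ?; rewrite ler_norml; lra.
have {}vE k : (k%:R <= c0%:R * v)%R -> (k <= c1 * eta)%N.
  move=> kv; rewrite -(ler_nat rat) (le_trans kv) // /c1 -mulnA natrM.
  by rewrite ler_wpM2l.
move: le_del le_s => /vE le_del /vE le_s.
have le_del1 : (del1 <= c1 * eta)%N by rewrite (leq_trans (leq_addr _ _) le_del).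
have le_del2 : (del2 <= c1 * eta)%N by rewrite (leq_trans (leq_addl _ _) le_del).
have [V1 [r1 [r1M V1n r1E]]] := P_realizable_sum Es1.
have [V2 [r2 [r2M V2n r2E]]] := P_realizable_sum Es2.
(* Trivialization creates [del1] fixed points in [Y1] and [del2] in [Y2]; each side receives the
   other's number, which balances the fixed points. *)
have [d1 d1M d1E] := sum_action r1M (@trivial_action G1 'I_del2).
have [d2 d2M d2E] := sum_action r2M (@trivial_action G2 'I_del1).
have [b1 b1M b1E] := sum_action a1M' d1M.
have [b2 b2M b2E] := sum_action a2M' d2M.
have iM (G : groupType) (i : {multiplicative H -> G}) (Y : finType)
    (a : G -> {perm Y}) : is_action a -> is_action (a \o i).
  by move=> aM g h; rewrite /= gmulfM aM.
have cnt_eq S : stab_count (b2 \o i2) S = stab_count (b1 \o i1) S.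
  apply/eqP; rewrite -(eqr_nat rat).
  rewrite (@stab_count_sum _ _ _ (a2' \o i2) (d2 \o i2)) => [|h x]; last exact: b2E.
  rewrite (@stab_count_sum _ _ _ (a1' \o i1) (d1 \o i1)) => [|h x]; last exact: b1E.
  rewrite (@stab_count_sum _ _ _ (r2 \o i2) (fun=> 1)) => [|h x]; last exact: d2E.
  rewrite (@stab_count_sum _ _ _ (r1 \o i1) (fun=> 1)) => [|h x]; last exact: d1E.
  rewrite !natrD cnt1' cnt2' r1E r2E !stab_count_trivial !card_ord.
  by apply/eqP; have := sE S; lra.
pose Z1 := (Y1 + (V1 + 'I_del2))%type; pose Z2 := (Y2 + (V2 + 'I_del1))%type.
have Z12 : #|{: Z1}| = #|{: Z2}|.
  rewrite -(sum_stab_count (b1 \o i1)) -(sum_stab_count (b2 \o i2)).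
  by apply: eq_bigr => S _; rewrite cnt_eq.
(* [D] corresponds to H-invariant sets in [Z1] and [Z2], which need not hold for
   the set of points on which both [j]s intertwine [theta]. *)
pose ok x x' h := (a1' (i1 h) (j1 x) == j1 x') && (a2' (i2 h) (j2 x) == j2 x').
pose D := [set x | [forall h, [exists x', ok x x' h]]].
(* [a1'] and [a2'] are genuine actions: when [h] moves [x] to [x'] on both sides, the condition on
   [x] at [h * k] is the one on [x'] at [k]. *)
have DP x : x \in D -> forall h, exists2 x', x' \in D & ok x x' h.
  rewrite inE => /forallP xD h; have /existsP[x' xx'] := xD h.
  exists x' => //; rewrite inE; apply/forallP => k.
  have /existsP[x2 xx2] := xD (h * k); apply/existsP; exists x2.
  move: xx2 xx'; rewrite /ok !gmulfM !(actionMx _ _ _ a1M') !(actionMx _ _ _ a2M').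
  by move=> /andP[/eqP <- /eqP <-] /andP[/eqP -> /eqP ->]; rewrite !eqxx.
have De : (#|~: D| <= cD * eta)%N.
  have : ~: D \subset ([set x | [exists h, j1 (theta h x) != a1' (i1 h) (j1 x)]] :|:
     [set x | [exists h, j2 (theta h x) != a2' (i2 h) (j2 x)]]).
    apply/fintype.subsetP => x; rewrite !inE negb_forall => /existsP[h].
    move=> /existsPn/(_ (theta h x)); rewrite negb_and => /orP[] xh; apply/orP;
      [left|right]; apply/existsP; exists h; by rewrite eq_sym.
  move=> /subset_leq_card/leq_trans; apply; apply: (leq_trans (leq_card_setU _ _)).
  rewrite /cD mulnDl -!mulnA leq_add //; apply: card_bad_le => h;
    rewrite mulnDl mul1n.
  - apply: (@leq_trans #|[set x | j1 (theta h x) != a1 (i1 h) (j1 x)] :|: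
        [set x | a1' (i1 h) (j1 x) != a1 (i1 h) (j1 x)]|).
      apply: subset_leq_card; apply/fintype.subsetP => x; rewrite !inE.
      by case: (eqVneq (a1' _ _) (a1 _ _)) => [->|]; rewrite ?orbT ?orbF.
    rewrite (leq_trans (leq_card_setU _ _)) // leq_add ?bad1 //.
    apply: leq_trans le_del1; apply: leq_trans (a1E (i1 h)).
    rewrite -(card_imset _ j1I); apply: subset_leq_card.
    by apply/fintype.subsetP => _ /imsetP[x + ->]; rewrite !inE.
  - apply: (@leq_trans #|[set x | j2 (theta h x) != a2 (i2 h) (j2 x)] :|:
        [set x | a2' (i2 h) (j2 x) != a2 (i2 h) (j2 x)]|).
      apply: subset_leq_card; apply/fintype.subsetP => x; rewrite !inE.
      by case: (eqVneq (a2' _ _) (a2 _ _)) => [->|]; rewrite ?orbT ?orbF.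
    rewrite (leq_trans (leq_card_setU _ _)) // leq_add ?bad2 //.
    apply: leq_trans le_del2; apply: leq_trans (a2E (i2 h)).
    rewrite -(card_imset _ j2I); apply: subset_leq_card.
    by apply/fintype.subsetP => _ /imsetP[x + ->]; rewrite !inE.
pose A := [set (inl (j2 x) : Z2) | x in D].
(* The value off the image of [j2] is a default; only the values on [A] enter below. *)
pose f (z : Z2) : Z1 := if [pick x | inl (j2 x) == z] is Some x then inl (j1 x)
  else inl (j1 x0).
have fE x : f (inl (j2 x)) = inl (j1 x).
  rewrite /f; case: pickP => [y /eqP[/j2I->]//|/(_ x)]; by rewrite eqxx.
have [|||F [FI FE FA]] := @extend_equivariant H Z2 Z1 (b2 \o i2) (b1 \o i1) A f
   (iM _ _ _ _ b2M) (iM _ _ _ _ b1M) cnt_eq.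
- move=> h _ /imsetP[x xD ->]; have [x' x'D /andP[_ /eqP xx']] := DP x xD h.
  by apply/imsetP; exists x' => //; rewrite /= b2E xx'.
- by move=> _ _ /imsetP[x _ ->] /imsetP[y _ ->]; rewrite !fE => -[/j1I->].
- move=> h _ /imsetP[x xD ->]; have [x' x'D /andP[/eqP xx1 /eqP xx2]] := DP x xD h.
  by rewrite /= b2E xx2 !fE b1E xx1.
have [F' FK F'K] : bijective F by apply: inj_card_bij => //; rewrite Z12.
(* The second action is transported to [Z1] by the H-isomorphism [F], which makes it agree with [b1]
   on H. *)
have [||b bM bE] := @action_of G2 Z1 (fun g z => F (b2 g (F' z))).
- by move=> z; rewrite action1 // perm1 F'K.
- by move=> g h z; rewrite FK actionMx.
pose J x : Z1 := inl (j1 x).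
have FJ x : x \in D -> F (inl (j2 x)) = J x.
  by move=> xD; rewrite FA ?fE //; apply/imsetP; exists x.
have leC k : (k \in [:: 1 + c1 + c1; c1; c1 + cD + cD]%N -> k * eta <= (1 + c1 + c1 + c1 + cD + cD) * eta)%N.
  by rewrite !inE leq_mul2r => /or3P[] /eqP->; apply/orP; right; lia.
exists Z1, J, b1, b; split=> //.
- by move=> x y [] /j1I.
- rewrite /Z1 !card_sum card_ord V1n; apply: (@leq_trans (#|X| + (1 + c1 + c1) * eta)).
    rewrite !mulnDl mul1n !addnA leq_add // leq_add //.
    exact: leq_trans (leq_addr _ _) le_s.
  by rewrite leq_add2l leC // !inE eqxx.
- by move=> h; apply/permP => z; rewrite bE; have := FE h (F' z); rewrite F'K.
split=> g m.
- apply: (@leq_trans (#|[set x | j1 (m x) != a1 g (j1 x)] :|: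
     [set x | a1' g (j1 x) != a1 g (j1 x)]|)).
    apply: subset_leq_card; apply/fintype.subsetP => x; rewrite !inE b1E.
    rewrite (inj_eq (@inl_inj _ _)).
    by case: (eqVneq (a1' _ _) (a1 _ _)) => [->|]; rewrite ?orbT ?orbF.
  rewrite (leq_trans (leq_card_setU _ _)) // leq_add2l.
  apply: (@leq_trans (c1 * eta)); last by rewrite leC // !inE eqxx orbT.
  apply: leq_trans le_del1; apply: leq_trans (a1E g).
  rewrite -(card_imset _ j1I); apply: subset_leq_card.
  by apply/fintype.subsetP => _ /imsetP[x + ->]; rewrite !inE.
(* [F] matches the two inclusions on [D] only, so points with [x] or [m x] outside [D] are lost as
   well; hence [cD] twice. *)
- apply: (@leq_trans (#|[set x | j2 (m x) != a2 g (j2 x)] :|: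
     ([set x | a2' g (j2 x) != a2 g (j2 x)] :|: (~: D :|: m @^-1: ~: D))|)).
    apply: subset_leq_card; apply/fintype.subsetP => x; rewrite inE.
    case: (boolP (x \in D)) => xD; last first.
      by rewrite !finset.in_setU (finset.in_setC x D) xD !orbT.
    case: (boolP (m x \in D)) => mxD; last first.
      have mx : x \in m @^-1: ~: D by rewrite finset.inE finset.in_setC.
      by rewrite !finset.in_setU mx !orbT.
    rewrite bE -!FJ // FK b2E (inj_eq FI) (inj_eq (@inl_inj _ _)) !inE.
    by case: (eqVneq (a2' _ _) (a2 _ _)) => [->->|] //; rewrite orbT.
  rewrite (leq_trans (leq_card_setU _ _)) // leq_add2l.
  apply: (@leq_trans ((c1 + cD + cD) * eta)); last by rewrite leC // !inE eqxx !orbT.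
  rewrite -addnA mulnDl (leq_trans (leq_card_setU _ _)) // leq_add //.
    apply: leq_trans le_del2; apply: leq_trans (a2E g).
    rewrite -(card_imset _ j2I); apply: subset_leq_card.
    by apply/fintype.subsetP => _ /imsetP[x + ->]; rewrite !inE.
  rewrite mulnDl (leq_trans (leq_card_setU _ _)) // leq_add //.
  by rewrite card_preimset //; exact: perm_inj.
Qed.

End PermutationStep.

(** * Unitary representations *)

Local Open Scope ring_scope.
Local Open Scope sesquilinear_scope.

Section Adjoint.
Variable C : numClosedFieldType.

Lemma adjM m n p (A : 'M[C]_(m, n)) (B : 'M[C]_(n, p)) :
  (A *m B)^t* = B^t* *m A^t*.
Proof. by rewrite trmx_mul map_mxM. Qed.

Lemma adjD m n (A B : 'M[C]_(m, n)) : (A + B)^t* = A^t* + B^t*.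
Proof. by rewrite linearD map_mxD. Qed.

Lemma adjB m n (A B : 'M[C]_(m, n)) : (A - B)^t* = A^t* - B^t*.
Proof. by rewrite linearB map_mxB. Qed.

Lemma adjZ m n (c : C) (A : 'M[C]_(m, n)) : (c *: A)^t* = c^* *: A^t*.
Proof. by rewrite linearZ map_mxZ. Qed.

Lemma adj0 m n : (0 : 'M[C]_(m, n))^t* = 0.
Proof. by rewrite trmx0 map_mx0. Qed.

Lemma adj1 n : (1%:M : 'M[C]_n)^t* = 1%:M.
Proof. by rewrite trmx1 map_mx1. Qed.

Lemma adj_sum m n (I : Type) (r : seq I) (P : pred I) (F : I -> 'M[C]_(m, n)) :
  (\sum_(i <- r | P i) F i)^t* = \sum_(i <- r | P i) (F i)^t*.
Proof.
elim: r => [|i r IHr]; first by rewrite !big_nil adj0.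
by rewrite !big_cons; case: (P i); rewrite ?adjD IHr.
Qed.

Lemma adjE m n (A : 'M[C]_(m, n)) i j : A^t* i j = (A j i)^*.
Proof. by rewrite !mxE. Qed.

Lemma mxtrace_adj n (A : 'M[C]_n) : \tr (A^t*) = (\tr A)^*.
Proof. by rewrite /mxtrace rmorph_sum; apply: eq_bigr => i _; rewrite adjE. Qed.

Lemma unitary_adjK n (U : 'M[C]_n) : U \is unitarymx -> U *m U^t* = 1%:M.
Proof. by move/unitarymxP. Qed.

Lemma unitary_Kadj n (U : 'M[C]_n) : U \is unitarymx -> U^t* *m U = 1%:M.
Proof. by move=> /unitarymxP/mulmx1C. Qed.

End Adjoint.

(** * The Frobenius inner product and norm *)

Section Frobenius.
Variable R : realType.
Local Notation C := R[i].

(** The real part gives a real inner product on complex matrices, so that all estimates take place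
    in [R]. *)
Definition ip m n (A B : 'M[C]_(m, n)) : R := complex.Re (\tr (A^t* *m B)).
Definition fro2 m n (A : 'M[C]_(m, n)) : R := ip A A.

Lemma cReD (x y : C) : complex.Re (x + y) = complex.Re x + complex.Re y.
Proof. by case: x; case: y. Qed.
Lemma cReN (x : C) : complex.Re (- x) = - complex.Re x.
Proof. by case: x. Qed.
Lemma cRe_conj (x : C) : complex.Re x^* = complex.Re x.
Proof. by case: x. Qed.
Lemma cIm_conj (x : C) : complex.Im x^* = - complex.Im x.
Proof. by case: x. Qed.
Lemma cReZ (r : R) (x : C) : complex.Re (r%:C%C * x) = r * complex.Re x.
Proof. by case: x => a b /=; rewrite mul0r subr0. Qed.
Lemma conj_real (r : R) : (r%:C%C : C)^* = r%:C%C.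
Proof. by apply/eqP; rewrite eq_complex /= oppr0 !eqxx. Qed.
Lemma cRe_sum (I : Type) (r : seq I) (P : pred I) (F : I -> C) :
  complex.Re (\sum_(i <- r | P i) F i) = \sum_(i <- r | P i) complex.Re (F i).
Proof. by apply: (big_morph _ cReD). Qed.
Lemma cRe_nat n : complex.Re (n%:R : C) = n%:R.
Proof. by elim: n => // n IHn; rewrite -!natr1 cReD IHn. Qed.

Lemma ipC m n (A B : 'M[C]_(m, n)) : ip A B = ip B A.
Proof. by rewrite /ip -cRe_conj -mxtrace_adj adjM trmxCK. Qed.

Lemma ipDr m n (A B D : 'M[C]_(m, n)) : ip A (B + D) = ip A B + ip A D.
Proof. by rewrite /ip mulmxDr mxtraceD cReD. Qed.

Lemma ipNr m n (A B : 'M[C]_(m, n)) : ip A (- B) = - ip A B.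
Proof. by rewrite /ip mulmxN linearN cReN. Qed.

Lemma ipZr m n (r : R) (A B : 'M[C]_(m, n)) : ip A (r%:C%C *: B) = r * ip A B.
Proof. by rewrite /ip -scalemxAr mxtraceZ cReZ. Qed.

Lemma ipDl m n (A B D : 'M[C]_(m, n)) : ip (A + B) D = ip A D + ip B D.
Proof. by rewrite ipC ipDr !(ipC D). Qed.

Lemma ipNl m n (A B : 'M[C]_(m, n)) : ip (- A) B = - ip A B.
Proof. by rewrite ipC ipNr ipC. Qed.

Lemma ipZl m n (r : R) (A B : 'M[C]_(m, n)) : ip (r%:C%C *: A) B = r * ip A B.
Proof. by rewrite ipC ipZr ipC. Qed.

Lemma ip0r m n (A : 'M[C]_(m, n)) : ip A 0 = 0.
Proof. by rewrite /ip mulmx0 mxtrace0. Qed.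

Lemma ip_sumr m n (I : Type) (r : seq I) (A : 'M[C]_(m, n)) (F : I -> 'M[C]_(m, n)) :
  ip A (\sum_(i <- r) F i) = \sum_(i <- r) ip A (F i).
Proof. by apply: (big_morph (ip A)) => [x y|]; rewrite ?ip0r ?ipDr. Qed.

Lemma fro2E m n (A : 'M[C]_(m, n)) :
  fro2 A = \sum_i \sum_j (complex.Re (A j i) ^+ 2 + complex.Im (A j i) ^+ 2).
Proof.
rewrite /fro2 /ip /mxtrace cRe_sum; apply: eq_bigr => i _.
rewrite mxE cRe_sum; apply: eq_bigr => j _; rewrite adjE.
by case: (A j i) => a b /=; ring.
Qed.

Lemma fro2_ge0 m n (A : 'M[C]_(m, n)) : 0 <= fro2 A.
Proof.
by rewrite fro2E; apply: sumr_ge0 => i _; apply: sumr_ge0 => j _; rewrite addr_ge0 ?sqr_ge0.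
Qed.

Lemma fro2_eq0 m n (A : 'M[C]_(m, n)) : fro2 A = 0 -> A = 0.
Proof.
have ge0 i j : 0 <= complex.Re (A j i) ^+ 2 + complex.Im (A j i) ^+ 2.
  by rewrite addr_ge0 ?sqr_ge0.
move=> /eqP; rewrite fro2E psumr_eq0 => [/allP A0|i _]; last exact: sumr_ge0.
apply/matrixP => j i; rewrite mxE; have := A0 i (mem_index_enum i).
rewrite /= psumr_eq0 => [/allP/(_ j (mem_index_enum j))|//] /=.
rewrite paddr_eq0 ?sqr_ge0 // !sqrf_eq0 => /andP[/eqP re0 /eqP im0].
by apply/eqP; rewrite eq_complex re0 im0 !eqxx.
Qed.

Lemma fro20 m n : fro2 (0 : 'M[C]_(m, n)) = 0.
Proof. by rewrite /fro2 ip0r. Qed.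

Lemma fro2N m n (A : 'M[C]_(m, n)) : fro2 (- A) = fro2 A.
Proof. by rewrite /fro2 ipNl ipNr opprK. Qed.

Lemma fro2Z m n (r : R) (A : 'M[C]_(m, n)) : fro2 (r%:C%C *: A) = r ^+ 2 * fro2 A.
Proof. by rewrite /fro2 ipZl ipZr mulrA expr2. Qed.

Lemma fro2D m n (A B : 'M[C]_(m, n)) : fro2 (A + B) = fro2 A + 2 * ip A B + fro2 B.
Proof. by rewrite /fro2 ipDl !ipDr (ipC B A); ring. Qed.

Lemma fro2B m n (A B : 'M[C]_(m, n)) : fro2 (A - B) = fro2 A - 2 * ip A B + fro2 B.
Proof. by rewrite fro2D ipNr fro2N; ring. Qed.

Lemma ip_le m n (A B : 'M[C]_(m, n)) : 2 * ip A B <= fro2 A + fro2 B.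
Proof. by have := fro2_ge0 (A - B); rewrite fro2B; lra. Qed.

Lemma fro2D_le m n (A B : 'M[C]_(m, n)) : fro2 (A + B) <= 2 * fro2 A + 2 * fro2 B.
Proof. by have := fro2_ge0 (A - B); rewrite fro2B fro2D; lra. Qed.

Lemma fro2B_le m n (A B : 'M[C]_(m, n)) : fro2 (A - B) <= 2 * fro2 A + 2 * fro2 B.
Proof. by rewrite -(fro2N B); exact: fro2D_le. Qed.

Lemma fro2_adj m n (A : 'M[C]_(m, n)) : fro2 (A^t*) = fro2 A.
Proof. by rewrite /fro2 /ip trmxCK mxtrace_mulC. Qed.

Lemma fro2_isol m n p (K : 'M[C]_(m, n)) (A : 'M[C]_(n, p)) :
  K^t* *m K = 1%:M -> fro2 (K *m A) = fro2 A.
Proof. by move=> KK; rewrite /fro2 /ip adjM mulmxA -(mulmxA _ (K^t*)) KK mulmx1. Qed.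

Lemma fro2_isor m n p (K : 'M[C]_(p, n)) (A : 'M[C]_(m, n)) :
  K^t* *m K = 1%:M -> fro2 (A *m K^t*) = fro2 A.
Proof. by move=> KK; rewrite -fro2_adj adjM trmxCK fro2_isol // fro2_adj. Qed.

Lemma fro2_iso m n (K : 'M[C]_(m, n)) : K^t* *m K = 1%:M -> fro2 K = n%:R.
Proof. by move=> KK; rewrite /fro2 /ip KK mxtrace1 cRe_nat. Qed.

Lemma fro2_unitl m n (U : 'M[C]_m) (A : 'M[C]_(m, n)) :
  U \is unitarymx -> fro2 (U *m A) = fro2 A.
Proof. by move/unitary_Kadj; exact: fro2_isol. Qed.

Lemma fro2_unitr m n (U : 'M[C]_n) (A : 'M[C]_(m, n)) :
  U \is unitarymx -> fro2 (A *m U) = fro2 A.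
Proof.
by move=> /unitary_adjK UU; rewrite -[U]trmxCK fro2_isor // trmxCK.
Qed.

Lemma CauchySchwarz_ip m n (A B : 'M[C]_(m, n)) : (ip A B) ^+ 2 <= fro2 A * fro2 B.
Proof.
have [B0|B0] := eqVneq (fro2 B) 0.
  by rewrite B0 mulr0 (fro2_eq0 B0) ip0r expr0n.
have Bgt0 : 0 < fro2 B by rewrite lt_def B0 fro2_ge0.
have := fro2_ge0 ((fro2 B)%:C%C *: A - (ip A B)%:C%C *: B).
rewrite fro2B !fro2Z ipZl ipZr => ge0.
have : 0 <= fro2 B * (fro2 A * fro2 B - ip A B ^+ 2) by apply: le_trans ge0 _; lra.
by rewrite pmulr_rge0 // subr_ge0.
Qed.

(* The real and imaginary parts of [tr (A^* B)] are both real inner products. *)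
Lemma normc_tr_le m n (A B : 'M[C]_(m, n)) :
  Normc.normc (\tr (A^t* *m B)) <= 2 * Num.sqrt (fro2 A * fro2 B).
Proof.
set z := \tr _.
have re : `|complex.Re z| <= Num.sqrt (fro2 A * fro2 B).
  by rewrite -sqrtr_sqr ler_wsqrtr // CauchySchwarz_ip.
have im : `|complex.Im z| <= Num.sqrt (fro2 A * fro2 B).
  have -> : complex.Im z = - ip A ('i%C *: B).
    by rewrite /ip -scalemxAr mxtraceZ -/z mulrC ReiNIm opprK.
  rewrite normrN -sqrtr_sqr ler_wsqrtr // (le_trans (CauchySchwarz_ip _ _)) //.
  rewrite ler_wpM2l ?fro2_ge0 // /fro2 /ip adjZ -scalemxAl -scalemxAr scalerA.
  have -> : ('i%C : C)^* * 'i%C = 1 by apply/eqP; rewrite eq_complex /=; apply/andP; split; apply/eqP; ring.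
  by rewrite scale1r.
have -> : Normc.normc z = Num.sqrt (complex.Re z ^+ 2 + complex.Im z ^+ 2) by case: (z).
apply: (@le_trans _ _ (`|complex.Re z| + `|complex.Im z|)); last lra.
rewrite -[leRHS]ger0_norm ?addr_ge0 // -[leRHS]sqrtr_sqr ler_wsqrtr // sqrrD.
rewrite !real_normK ?num_real // lerD2r lerDl mulrn_wge0 // mulr_ge0 //.
Qed.

(** Convexity: with [B] the average, summing [2 * ip (F i) B <= r + fro2 B] over [i] gives
    [2 * fro2 B <= r + fro2 B]. *)
Lemma fro2_sum_le m n (I : finType) (F : I -> 'M[C]_(m, n)) (r : R) :
  (forall i, fro2 (F i) <= r) -> (0 < #|I|)%N ->
  fro2 ((#|I|%:R^-1 : R)%:C%C *: \sum_i F i) <= r.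
Proof.
move=> Fr I0; set B := _ *: _.
have n0 : #|I|%:R != 0 :> R by rewrite pnatr_eq0 -lt0n.
have : \sum_i (2 * ip (F i) B) <= \sum_(i in I) (r + fro2 B).
  by apply: ler_sum => i _; apply: le_trans (ip_le _ _) _; rewrite lerD2r.
under eq_bigr do rewrite ipC.
rewrite -mulr_sumr -ip_sumr sumr_const.
have -> : \sum_i F i = (#|I|%:R : R)%:C%C *: B.
  by rewrite scalerA -rmorphM /= divff // scale1r.
rewrite ipZr -[(r + _) *+ _]mulr_natl mulrCA -/(fro2 B) ler_pM2l ?ltr0n //; lra.
Qed.

End Frobenius.

(** * Orthogonal decompositions described by isometries *)

Section Isometries.
Variable C : numClosedFieldType.

(* [K] and [K'] are the two column blocks of a unitary matrix. *)
Definition split_iso n k k' (K : 'M[C]_(n, k)) (K' : 'M[C]_(n, k')) : Prop :=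
  [/\ K^t* *m K = 1%:M, K'^t* *m K' = 1%:M & K *m K^t* + K' *m K'^t* = 1%:M].

Lemma split_iso_orth n k k' (K : 'M[C]_(n, k)) (K' : 'M[C]_(n, k')) :
  split_iso K K' -> K^t* *m K' = 0 /\ K'^t* *m K = 0.
Proof.
case=> KK KK' sumK.
have H : K^t* *m K' = 0.
  have /(congr1 (mulmx (K^t*)))/(congr1 (mulmx^~ K')) := sumK.
  rewrite mulmxDr mulmxDl mulmx1 !mulmxA KK mul1mx -!mulmxA KK' mulmx1.
  by move=> /eqP; rewrite -subr_eq0 addrK => /eqP.
by split=> //; rewrite -[LHS]trmxCK adjM trmxCK H adj0.
Qed.

Lemma split_iso_dim n k k' (K : 'M[C]_(n, k)) (K' : 'M[C]_(n, k')) :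
  split_iso K K' -> (k + k' = n)%N.
Proof.
case=> KK KK' /(congr1 mxtrace); rewrite mxtraceD !(mxtrace_mulC _ (_^t*)) KK KK'.
by rewrite !mxtrace1 -natrD => /eqP; rewrite eqr_nat => /eqP.
Qed.

Definition select n (A : {set 'I_n}) : 'M[C]_(n, #|A|) :=
  \matrix_(i, j) (i == enum_val j)%:R.

Lemma select_adjE n (A : {set 'I_n}) i j : (select A)^t* j i = (i == enum_val j)%:R.
Proof. by rewrite adjE mxE conjC_nat. Qed.

Lemma mul_select_r n p (A : {set 'I_n}) (M : 'M[C]_(p, n)) i j :
  (M *m select A) i j = M i (enum_val j).
Proof.
rewrite mxE (bigD1 (enum_val j)) //= mxE eqxx mulr1 big1 ?addr0 // => k /negPf kj.
by rewrite mxE kj mulr0.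
Qed.

Lemma mul_select_l n p (A : {set 'I_n}) (M : 'M[C]_(n, p)) i j :
  ((select A)^t* *m M) i j = M (enum_val i) j.
Proof.
rewrite mxE (bigD1 (enum_val i)) //= select_adjE eqxx mul1r big1 ?addr0 // => k /negPf kj.
by rewrite select_adjE kj mul0r.
Qed.

Lemma select_iso n (A : {set 'I_n}) : (select A)^t* *m select A = 1%:M.
Proof.
by apply/matrixP => i j; rewrite mul_select_l !mxE (inj_eq enum_val_inj).
Qed.

Lemma select_proj n (A : {set 'I_n}) :
  select A *m (select A)^t* = diag_mx (\row_i (i \in A)%:R).
Proof.
apply/matrixP => i j; rewrite !mxE; have [iA|iA] := boolP (i \in A).
  rewrite (bigD1 (enum_rank_in iA i)) //= mxE select_adjE enum_rankK_in // eqxx mul1r.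
  rewrite big1 ?addr0 => [|k ki]; first by rewrite eq_sym; case: eqP.
  rewrite mxE; case: eqP => [E|]; last by rewrite mul0r.
  by case/eqP: ki; apply: enum_val_inj; rewrite enum_rankK_in.
rewrite mul0rn big1 // => k _; rewrite mxE; case: eqP => [E|]; last by rewrite mul0r.
by rewrite E enum_valP in iA.
Qed.

Lemma select_split n (A : {set 'I_n}) : split_iso (select A) (select (~: A)).
Proof.
split; rewrite ?select_iso // !select_proj -raddfD -diag_const_mx; congr diag_mx.
by apply/rowP => i; rewrite !mxE inE; case: (i \in A); rewrite ?addr0 ?add0r.
Qed.

Lemma split_iso_unitary n k k' (P : 'M[C]_n) (K : 'M[C]_(n, k)) (K' : 'M[C]_(n, k')) :
  P \is unitarymx -> split_iso K K' -> split_iso (P *m K) (P *m K').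
Proof.
move=> Pu [KK KK' sumK]; split.
- by rewrite adjM mulmxA -(mulmxA (K^t*)) unitary_Kadj // mulmx1.
- by rewrite adjM mulmxA -(mulmxA (K'^t*)) unitary_Kadj // mulmx1.
- transitivity (P *m (K *m K^t* + K' *m K'^t*) *m P^t*).
    by rewrite !adjM mulmxDr mulmxDl !mulmxA.
  by rewrite sumK mulmx1 unitary_adjK.
Qed.

End Isometries.

Arguments select {C n} A.
Arguments select_iso {C n} A.
Arguments select_proj {C n} A.
Arguments select_split {C n} A.

Section SpectralSplit.
Variable C : numClosedFieldType.

Lemma spectral_decomposition n (Z : 'M[C]_n) : Z \is normalmx ->
  exists (P : 'M[C]_n) (D : 'rV[C]_n), P \is unitarymx /\ Z = P *m diag_mx D *m P^t*.
Proof.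
move=> /orthomx_spectralP E; exists ((spectralmx Z)^t*), (spectral_diag Z).
rewrite trmxC_unitary spectral_unitarymx; split=> //.
by rewrite trmxCK {1}E invmx_unitary ?spectral_unitarymx.
Qed.

(** In a diagonalizing basis, a matrix commuting with [Z] has no entries between different
    eigenvalues, so it preserves the eigenspace [K] and its complement [K']. A nonzero eigenvalue is
    chosen whenever there is one; [K'] may be empty. *)
Lemma spectral_split n (Z : 'M[C]_n) : (0 < n)%N -> Z \is normalmx ->
  exists (lambda : C) (k k' : nat) (K : 'M[C]_(n, k)) (K' : 'M[C]_(n, k')),
  [/\ Z != 0 -> lambda != 0, (0 < k)%N, split_iso K K', Z *m K = lambda *: K
    & forall M, M *m Z = Z *m M ->
      M *m K = K *m (K^t* *m M *m K) /\ M *m K' = K' *m (K'^t* *m M *m K')].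
Proof.
move=> n0 /spectral_decomposition[P [D [Pu ZE]]].
have [i0 Di0] : exists i0, Z != 0 -> D 0 i0 != 0.
  have [[i0 Di0]|nD] := pselect (exists i0, D 0 i0 != 0); first by exists i0.
  exists (Ordinal n0); apply: contra_neq => _; rewrite ZE.
  rewrite (_ : D = 0) ?raddf0 ?mulmx0 ?mul0mx //; apply/rowP => i; rewrite mxE.
  by apply: contrapT => /eqP Di; apply: nD; exists i.
pose A := [set i | D 0 i == D 0 i0]; pose lambda := D 0 i0.
have sA := split_iso_unitary Pu (select_split A).
have comm M : M *m Z = Z *m M -> forall i j, (P^t* *m M *m P) i j * (D 0 j - D 0 i) = 0.
  move=> MZ i j; set M' := P^t* *m M *m P.
  have : M' *m diag_mx D = diag_mx D *m M'.
    transitivity (P^t* *m (M *m Z) *m P).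
      by rewrite ZE /M' !mulmxA mulmxKtV.
    rewrite MZ ZE /M' !mulmxA (unitary_Kadj Pu) mul1mx -!mulmxA.
    by rewrite mulmxA.
  move=> /matrixP/(_ i j); rewrite mul_mx_diag mul_diag_mx !mxE => E.
  by rewrite mulrBr E mulrC subrr.
have red M (B B' : {set 'I_n}) : M *m Z = Z *m M -> split_iso (P *m select B) (P *m select B') ->
    (forall i j, i \in B -> j \in B' -> D 0 i != D 0 j) ->
    M *m (P *m select B) = (P *m select B) *m ((P *m select B)^t* *m M *m (P *m select B)).
  move=> MZ [_ _ sB] BB'.
  have M0 : (P *m select B')^t* *m (M *m (P *m select B)) = 0.
    apply/matrixP => i j; rewrite adjM -mulmxA mul_select_l !mulmxA mul_select_r [RHS]mxE.
    have := comm M MZ (enum_val i) (enum_val j) => /eqP; rewrite mulf_eq0 subr_eq0.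
    by rewrite (negPf (BB' _ _ _ _)) ?enum_valP // orbF => /eqP.
  by rewrite -[LHS]mul1mx -sB mulmxDl -!(mulmxA (_ *m select _)) M0 mulmx0 addr0 !mulmxA.
exists lambda, #|A|, #|~: A|, (P *m select A), (P *m select (~: A)); split=> //.
- by apply/card_gt0P; exists i0; rewrite inE.
- rewrite ZE -mulmxA (mulmxA (P^t*)) (unitary_Kadj Pu) mul1mx -mulmxA scalemxAr.
  congr (_ *m _); apply/matrixP => i j; rewrite mul_diag_mx !mxE.
  case: eqP => [->|]; rewrite ?mulr1 ?mulr0 //.
  by have := enum_valP j; rewrite inE => /eqP.
- have sA' : split_iso (P *m select (~: A)) (P *m select A).
    by case: sA => ? ? ?; split=> //; rewrite addrC.
  move=> M MZ; split.
    apply: (red M A (~: A)) => // i j; rewrite !inE => /eqP-> ; by rewrite eq_sym.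
  by apply: (red M (~: A) A) => // i j; rewrite !inE => + /eqP->.
Qed.

Lemma proj_isometry n (p : 'M[C]_n) : p^t* = p -> p *m p = p ->
  exists (k : nat) (K : 'M[C]_(n, k)), K^t* *m K = 1%:M /\ K *m K^t* = p.
Proof.
move=> pA pp; have /spectral_decomposition[P [D [Pu pE]]] : p \is normalmx.
  by apply/normalmxP; rewrite pA.
have DD : diag_mx D *m diag_mx D = diag_mx D.
  have E : diag_mx D = P^t* *m p *m P.
    by rewrite pE !mulmxA unitary_Kadj // mul1mx mulmxKtV // unitary_Kadj.
  rewrite {1 2}E -!mulmxA [P *m (_ *m _)]mulmxA unitary_adjK // mul1mx.
  by rewrite (mulmxA p) pp mulmxA.
pose A := [set i | D 0 i != 0].
have DA : diag_mx D = select A *m (select A)^t*.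
  rewrite select_proj; congr diag_mx; apply/rowP => i; rewrite mxE inE.
  have /matrixP/(_ i i) := DD; rewrite mul_diag_mx !mxE eqxx mulr1n.
  have [->//|Di] := eqVneq (D 0 i) 0.
  by move=> E; apply: (mulfI Di); rewrite mulr1.
exists #|A|, (P *m select A); rewrite adjM; split.
  by rewrite !mulmxA -(mulmxA _ (P^t*)) unitary_Kadj // mulmx1 select_iso.
by rewrite !mulmxA -(mulmxA P) -DA -pE.
Qed.

Lemma isometry_complement n k (K : 'M[C]_(n, k)) : K^t* *m K = 1%:M ->
  exists (k' : nat) (K' : 'M[C]_(n, k')), split_iso K K'.
Proof.
move=> KK; have [||k' [K' [KK' K'K]]] := @proj_isometry n (1%:M - K *m K^t*).
- by rewrite adjB adj1 adjM trmxCK.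
- rewrite mulmxBr mulmx1 mulmxBl mul1mx !mulmxA -(mulmxA K) KK mulmx1.
  by rewrite subrr subr0.
by exists k', K'; split=> //; rewrite K'K addrC subrK.
Qed.

Section Glue.
Variables (n k k' m l l' : nat).
Variables (L : 'M[C]_(n, k)) (L' : 'M[C]_(n, k')) (M : 'M[C]_(m, l)) (M' : 'M[C]_(m, l')).

(** The block-diagonal operator from the decomposition [M, M'] to the decomposition [L, L']. *)
Definition glue (X : 'M[C]_(k, l)) (Y : 'M[C]_(k', l')) : 'M[C]_(n, m) :=
  L *m X *m M^t* + L' *m Y *m M'^t*.

End Glue.

Lemma glue_adj n k k' m l l' (L : 'M[C]_(n, k)) (L' : 'M[C]_(n, k'))
    (M : 'M[C]_(m, l)) (M' : 'M[C]_(m, l')) X Y :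
  (glue L L' M M' X Y)^t* = glue M M' L L' (X^t*) (Y^t*).
Proof. by rewrite adjD !adjM !trmxCK !mulmxA. Qed.

Lemma glueM n k k' m l l' p q q' (L : 'M[C]_(n, k)) (L' : 'M[C]_(n, k'))
    (M : 'M[C]_(m, l)) (M' : 'M[C]_(m, l')) (N : 'M[C]_(p, q)) (N' : 'M[C]_(p, q'))
    X Y X2 Y2 : split_iso M M' ->
  glue L L' M M' X Y *m glue M M' N N' X2 Y2 = glue L L' N N' (X *m X2) (Y *m Y2).
Proof.
move=> sM; have [MM MM' _] := sM; have [ort ort'] := split_iso_orth sM.
rewrite /glue mulmxDl !mulmxDr !mulmxA.
rewrite -(mulmxA _ (M^t*) M) MM mulmx1 -(mulmxA _ (M'^t*) M') MM' mulmx1.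
rewrite -(mulmxA _ (M^t*) M') ort mulmx0 !mul0mx addr0.
by rewrite -(mulmxA _ (M'^t*) M) ort' mulmx0 !mul0mx add0r.
Qed.

Lemma glue11 n k k' (K : 'M[C]_(n, k)) (K' : 'M[C]_(n, k')) : split_iso K K' ->
  glue K K' K K' 1%:M 1%:M = 1%:M.
Proof. by case=> _ _ <-; rewrite /glue !mulmx1. Qed.

Lemma glueB n k k' m l l' (L : 'M[C]_(n, k)) (L' : 'M[C]_(n, k'))
    (M : 'M[C]_(m, l)) (M' : 'M[C]_(m, l')) X Y X2 Y2 :
  glue L L' M M' X Y - glue L L' M M' X2 Y2 = glue L L' M M' (X - X2) (Y - Y2).
Proof. by rewrite /glue opprD addrACA !mulmxBr !mulmxBl. Qed.

Lemma mxtrace_glue n k k' (K : 'M[C]_(n, k)) (K' : 'M[C]_(n, k')) X Y : split_iso K K' ->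
  \tr (glue K K' K K' X Y) = \tr X + \tr Y.
Proof.
case=> KK KK' _; rewrite /glue mxtraceD -!mulmxA mxtrace_mulC -mulmxA KK mulmx1.
by rewrite (mxtrace_mulC K') -mulmxA KK' mulmx1.
Qed.

End SpectralSplit.

Section FrobeniusGlue.
Variable R : realType.
Local Notation C := R[i].

Lemma mxtrace_fro2 m n (A : 'M[C]_(m, n)) : \tr (A^t* *m A) = (fro2 A)%:C%C.
Proof.
rewrite [LHS]complexE -[complex.Re _]/(fro2 A).
suff -> : complex.Im (\tr (A^t* *m A)) = 0 by rewrite mulr0 addr0.
have := cIm_conj (\tr (A^t* *m A)); rewrite -mxtrace_adj adjM trmxCK => /eqP.
by rewrite -addr_eq0 -mulr2n mulrn_eq0 => /eqP.
Qed.

Lemma fro2_glue n k k' m l l' (L : 'M[C]_(n, k)) (L' : 'M[C]_(n, k'))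
    (M : 'M[C]_(m, l)) (M' : 'M[C]_(m, l')) X Y :
  split_iso L L' -> split_iso M M' ->
  fro2 (glue L L' M M' X Y) = fro2 X + fro2 Y.
Proof.
move=> sL sM; rewrite /fro2 /ip glue_adj glueM // mxtrace_glue //.
exact: cReD.
Qed.

End FrobeniusGlue.

(** * Unitary representations and subrepresentations *)

Section UnitaryRepresentations.
Variables (C : numClosedFieldType) (G : groupType).

Definition urep n (rho : G -> 'M[C]_n) : Prop :=
  (forall g, rho g \is unitarymx) /\ (forall g h, rho (g * h)%g = rho g *m rho h).

Lemma urep1 n (rho : G -> 'M[C]_n) : urep rho -> rho 1%g = 1%:M.
Proof.
case=> rU rM; have := rM 1%g 1%g; rewrite mulg1 => /(congr1 (mulmx ((rho 1%g)^t*))).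
by rewrite mulmxA unitary_Kadj // mul1mx => ->.
Qed.

Lemma urepV n (rho : G -> 'M[C]_n) g : urep rho -> rho g^-1%g = (rho g)^t*.
Proof.
move=> ur; have [rU rM] := ur.
by rewrite -[LHS]mul1mx -(unitary_Kadj (rU g)) -mulmxA -rM mulgV urep1 // mulmx1.
Qed.

Lemma mxtrace_urep1 n (rho : G -> 'M[C]_n) : urep rho -> \tr (rho 1%g) = n%:R.
Proof. by move/urep1->; rewrite mxtrace1. Qed.

Lemma urep_trivial n : urep (fun _ : G => 1%:M : 'M[C]_n).
Proof.
split=> [g|g h]; last by rewrite mulmx1.
by apply/unitarymxP; rewrite adj1 mulmx1.
Qed.

(** For an isometry [K], invariance of its range; [compress rho K] is then the subrepresentation on
    that range. *)
Definition reduces n k (rho : G -> 'M[C]_n) (K : 'M[C]_(n, k)) : Prop :=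
  forall g, rho g *m K = K *m (K^t* *m rho g *m K).

Definition compress n k (rho : G -> 'M[C]_n) (K : 'M[C]_(n, k)) (g : G) : 'M[C]_k :=
  K^t* *m rho g *m K.

Lemma urep_compress n k (rho : G -> 'M[C]_n) (K : 'M[C]_(n, k)) :
  urep rho -> K^t* *m K = 1%:M -> reduces rho K -> urep (compress rho K).
Proof.
move=> ur KK red; have [rU rM] := ur.
have cM g h : compress rho K (g * h)%g = compress rho K g *m compress rho K h.
  transitivity (K^t* *m rho g *m (rho h *m K)); first by rewrite /compress rM !mulmxA.
  by rewrite red -/(compress rho K h) mulmxA.
have cV g : (compress rho K g)^t* = compress rho K g^-1%g.
  by rewrite /compress !adjM trmxCK -urepV // mulmxA.
split=> // g; apply/unitarymxP.
by rewrite cV -cM mulgV /compress urep1 // mulmx1.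
Qed.

(** The block of [rho g] from the complement to the range of [K] is the adjoint of a block of
    [rho g^-1] that vanishes by invariance. *)
Lemma reduces_complement n k k' (rho : G -> 'M[C]_n) (K : 'M[C]_(n, k)) (K' : 'M[C]_(n, k')) :
  urep rho -> split_iso K K' -> reduces rho K -> reduces rho K'.
Proof.
move=> ur sK red g; have [ort ort'] := split_iso_orth sK; have [_ _ sumK] := sK.
have KrK : K^t* *m rho g *m K' = 0.
  transitivity ((K'^t* *m (rho g^-1%g *m K))^t*).
    by rewrite urepV // !adjM !trmxCK.
  by rewrite red mulmxA ort' mul0mx adj0.
rewrite -[LHS]mul1mx -sumK mulmxDl -!mulmxA (mulmxA (K^t*)) KrK mulmx0 add0r.
by rewrite mulmxA.
Qed.

Lemma urep_glue n k k' (K : 'M[C]_(n, k)) (K' : 'M[C]_(n, k')) rho rho' :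
  split_iso K K' -> urep rho -> urep rho' ->
  urep (fun g => glue K K' K K' (rho g) (rho' g)).
Proof.
move=> sK [rU rM] [rU' rM']; split=> [g|g h]; last by rewrite glueM // -rM -rM'.
by apply/unitarymxP; rewrite glue_adj glueM // !unitary_adjK // glue11.
Qed.

Lemma compress_glue n k k' (K : 'M[C]_(n, k)) (K' : 'M[C]_(n, k')) rho g :
  split_iso K K' -> reduces rho K -> reduces rho K' ->
  rho g = glue K K' K K' (compress rho K g) (compress rho K' g).
Proof.
move=> [_ _ sumK] red red'; rewrite /glue /compress -red -red' -[LHS]mulmx1 -sumK.
by rewrite mulmxDr !mulmxA.
Qed.

Lemma urep_conj n m (rho : G -> 'M[C]_n) (T : 'M[C]_(m, n)) :
  T^t* *m T = 1%:M -> T *m T^t* = 1%:M -> urep rho ->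
  urep (fun g => T *m rho g *m T^t*).
Proof.
move=> TT TT' [rU rM]; split=> [g|g h].
  apply/unitarymxP; rewrite !adjM trmxCK !mulmxA -(mulmxA _ (T^t*)) TT mulmx1.
  by rewrite -(mulmxA T) unitary_adjK // mulmx1.
by rewrite rM !mulmxA -(mulmxA _ (T^t*)) TT mulmx1.
Qed.

Definition dsum n m (rho : G -> 'M[C]_n) (sigma : G -> 'M[C]_m) (g : G) : 'M[C]_(n + m) :=
  block_mx (rho g) 0 0 (sigma g).

Lemma urep_dsum n m (rho : G -> 'M[C]_n) (sigma : G -> 'M[C]_m) :
  urep rho -> urep sigma -> urep (dsum rho sigma).
Proof.
move=> [rU rM] [sU sM]; split=> [g|g h]; last first.
  by rewrite /dsum mulmx_block !mulmx0 !mul0mx !addr0 add0r rM sM.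
apply/unitarymxP; rewrite /dsum tr_block_mx map_block_mx !trmx0 !map_mx0.
rewrite mulmx_block !mulmx0 !mul0mx !addr0 add0r !unitary_adjK //.
by rewrite -scalar_mx_block.
Qed.

Lemma mxtrace_dsum n m (rho : G -> 'M[C]_n) (sigma : G -> 'M[C]_m) g :
  \tr (dsum rho sigma g) = \tr (rho g) + \tr (sigma g).
Proof. exact: mxtrace_block. Qed.

End UnitaryRepresentations.

Lemma urep_comp (C : numClosedFieldType) (H G : groupType) (i : {multiplicative H -> G})
  n (rho : G -> 'M[C]_n) : urep rho -> urep (rho \o i).
Proof. by case=> rU rM; split=> [g|g h] //=; rewrite gmulfM rM. Qed.

(** * Polar parts of intertwiners *)

Section Intertwiners.
Variables (R : realType) (G : groupType).
Local Notation C := R[i].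

(** Polar decomposition on a single eigenspace [K] of [B^t* *m B], with eigenvalue [mu ^+ 2]: there
    [B] divided by [mu] is an isometry [L], equivariant because [B] is. The complements are again
    subrepresentations, which permits induction. *)
Lemma intertwiner_split n m (rho : G -> 'M[C]_n) (sigma : G -> 'M[C]_m) (B : 'M[C]_(n, m)) :
  urep rho -> urep sigma -> (forall g, rho g *m B = B *m sigma g) -> B != 0 ->
  exists (k n' m' : nat) (L : 'M[C]_(n, k)) (L' : 'M[C]_(n, n'))
    (K : 'M[C]_(m, k)) (K' : 'M[C]_(m, m')) (mu : R),
  [/\ (0 < k)%N /\ 0 < mu, split_iso L L' /\ split_iso K K',
      (reduces rho L /\ reduces rho L') /\ (reduces sigma K /\ reduces sigma K'),
      forall g, compress rho L g = compress sigma K g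
    & B = glue L L' K K' (mu%:C%C)%:M (L'^t* *m B *m K')].
Proof.
move=> ur us Bi B0.
have m0 : (0 < m)%N.
  by case: m B B0 {us Bi sigma} => // B; rewrite thinmx0 eqxx.
pose Z := B^t* *m B.
have ZA : Z^t* = Z by rewrite adjM trmxCK.
have Z0 : Z != 0.
  apply: contra B0 => /eqP Z0; apply/eqP/fro2_eq0.
  by rewrite /fro2 /ip -/Z Z0 mxtrace0.
have BA g : B^t* *m rho g = sigma g *m B^t*.
  have := Bi g^-1%g; rewrite !urepV // => /(congr1 (fun M => M^t*)).
  by rewrite !adjM !trmxCK.
have Zc g : sigma g *m Z = Z *m sigma g by rewrite /Z mulmxA -BA -!mulmxA Bi.
have [|lambda [k [k' [K [K' [/(_ Z0) l0 k0 sK ZK red]]]]]] := spectral_split m0 (_ : Z \is normalmx).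
  by apply/normalmxP; rewrite ZA.
have [KK KK' sumK] := sK; have [ort ort'] := split_iso_orth sK.
have redK : reduces sigma K by move=> g; have [] := red _ (Zc g).
have redK' : reduces sigma K' by move=> g; have [] := red _ (Zc g).
(* The trace of [K^t* *m Z *m K] identifies the eigenvalue with this nonnegative real number. *)
pose x := fro2 (B *m K) / k%:R.
have lE : lambda = x%:C%C.
  have kC : (k%:R : C) != 0 by rewrite pnatr_eq0 -lt0n.
  have E : (fro2 (B *m K))%:C%C = lambda * k%:R.
    rewrite -mxtrace_fro2 adjM mulmxA -(mulmxA _ _ B) -/Z.
    by rewrite -mulmxA ZK -scalemxAr KK mxtraceZ mxtrace1.
  apply: (mulIf kC); rewrite -E -[fro2 _](@divfK _ (k%:R : R)) ?pnatr_eq0 -?lt0n //.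
  by rewrite rmorphM rmorph_nat.
have x0 : 0 < x.
  rewrite lt_def divr_ge0 ?fro2_ge0 // andbT.
  by apply: contra l0; rewrite lE => /eqP->.
pose mu := Num.sqrt x.
have mu0 : 0 < mu by rewrite sqrtr_gt0.
have mu2 : mu ^+ 2 = x by rewrite sqr_sqrtr // ltW.
have muN : mu != 0 by rewrite gt_eqF.
pose L := (mu^-1)%:C%C *: (B *m K).
have BK : B *m K = mu%:C%C *: L by rewrite scalerA -rmorphM /= divff // scale1r.
have LB : L^t* *m B = mu%:C%C *: K^t*.
  rewrite adjZ adjM conj_real -scalemxAl -mulmxA -/Z -{1}ZA -adjM ZK adjZ lE conj_real.
  by rewrite scalerA -rmorphM /= -mu2 expr2 mulKf.
have LL : L^t* *m L = 1%:M.
  by rewrite -scalemxAr mulmxA LB -scalemxAl KK scalerA -rmorphM /= mulVf // scale1r.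
have Lcomp g : rho g *m L = L *m compress sigma K g.
  by rewrite -scalemxAr mulmxA Bi -mulmxA redK (mulmxA B) scalemxAl.
have LcK g : compress rho L g = compress sigma K g.
  by rewrite {1}/compress -mulmxA Lcomp mulmxA LL mul1mx.
have redL : reduces rho L by move=> g; rewrite -/(compress rho L g) LcK -Lcomp.
have [n' [L' sL]] := isometry_complement LL.
have [_ _ sumL] := sL.
exists k, n', k', L, L', K, K', mu; split=> //.
- by split=> //; split=> //; exact: (reduces_complement ur sL).
- rewrite /glue mul_mx_scalar -scalemxAl.
  rewrite -{1}[B]mulmx1 -sumK mulmxDr !mulmxA BK -scalemxAl; congr (_ + _ *m _).
  rewrite -[LHS]mul1mx -sumL mulmxDl -!mulmxA (mulmxA (L^t*)) LB -[(_ *: K^t*) *m _]scalemxAl ort.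
  by rewrite scaler0 mulmx0 add0r.
Qed.

End Intertwiners.

(** * Representations and characters of the finite group *)

Section FiniteGroup.
Variables (R : realType) (H : finGroupType).
Local Notation C := R[i].

Lemma reduces_adj n k (rho : H -> 'M[C]_n) (L : 'M[C]_(n, k)) g :
  urep rho -> reduces rho L -> L^t* *m rho g = compress rho L g *m L^t*.
Proof.
move=> ur red; transitivity ((rho g^-1%g *m L)^t*).
  by rewrite urepV // adjM trmxCK.
by rewrite red urepV // !adjM !trmxCK mulmxA.
Qed.

Lemma split_fro2 n k k' p (L : 'M[C]_(n, k)) (L' : 'M[C]_(n, k')) (Y : 'M[C]_(n, p)) :
  split_iso L L' -> fro2 Y = fro2 (L^t* *m Y) + fro2 (L'^t* *m Y).
Proof.
case=> _ _ sumL; rewrite /fro2 /ip -cReD -mxtraceD !adjM !trmxCK.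
by rewrite -!mulmxA -mulmxDr !(mulmxA _ (_^t*)) -mulmxDl sumL mul1mx.
Qed.

Lemma avg_intertwines n m (rho : H -> 'M[C]_n) (sigma : H -> 'M[C]_m) (A : 'M[C]_(n, m)) k :
  urep rho -> urep sigma ->
  rho k *m (\sum_h rho h *m A *m (sigma h)^t*) =
  (\sum_h rho h *m A *m (sigma h)^t*) *m sigma k.
Proof.
move=> ur us; rewrite mulmx_sumr mulmx_suml.
rewrite [RHS](reindex_inj (mulgI k)) /=; apply: eq_bigr => h _.
rewrite ur.2 us.2 adjM -!mulmxA; congr (_ *m (_ *m (_ *m _))).
by rewrite unitary_Kadj ?mulmx1 //; exact: us.1.
Qed.

(** If the average of every elementary matrix [delta_mx j l] vanished, the sum over [j] and [l] of
    their entries at [(j, l)], which is the scalar product of the characters, would be zero. *)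
Lemma nonzero_intertwiner n m (rho : H -> 'M[C]_n) (sigma : H -> 'M[C]_m) :
  urep rho -> urep sigma -> \sum_h \tr (rho h) * (\tr (sigma h))^* != 0 ->
  exists B : 'M[C]_(n, m), B != 0 /\ forall h, rho h *m B = B *m sigma h.
Proof.
move=> ur us; apply: contra_neqP => nB.
have B0 j l : \sum_h rho h *m delta_mx j l *m (sigma h)^t* = 0.
  apply: contrapT => /eqP B0; apply: nB; exists (\sum_h rho h *m delta_mx j l *m (sigma h)^t*).
  by split=> // h; exact: avg_intertwines.
under eq_bigr do rewrite /mxtrace rmorph_sum mulr_suml.
rewrite exchange_big big1 //= => j _; under eq_bigr do rewrite mulr_sumr.
rewrite exchange_big big1 //= => l _.
have := congr1 (fun M : 'M[C]_(n, m) => M j l) (B0 j l); rewrite summxE mxE => E.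
rewrite -[RHS]E; apply: eq_bigr => h _; rewrite mxE (bigD1 l) //= big1 ?addr0.
  rewrite adjE mxE (bigD1 j) //= big1 ?addr0 => [|i /negPf ij].
    by rewrite mxE !eqxx mulr1.
  by rewrite mxE ij mulr0.
move=> i /negPf il; rewrite mxE big1 ?mul0r // => i' _.
by rewrite mxE il andbF mulr0.
Qed.

(* Induction on the dimension: on an eigenspace of [B^* B] replace [B] by its
   polar part; when [B = 0], any nonzero intertwiner provides the first step. *)
Lemma unitary_intertwiner n m (rho : H -> 'M[C]_n) (sigma : H -> 'M[C]_m) (B : 'M[C]_(n, m)) :
  urep rho -> urep sigma -> (forall h, \tr (rho h) = \tr (sigma h)) ->
  (forall h, rho h *m B = B *m sigma h) ->
  (forall p (X : 'M[C]_(m, p)), fro2 (B *m X) <= fro2 X) ->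
  exists T : 'M[C]_(n, m), [/\ T *m T^t* = 1%:M, T^t* *m T = 1%:M,
    forall h, rho h *m T = T *m sigma h & fro2 (T - B) <= m%:R - fro2 B].
Proof.
have [N] := ubnP m; elim: N n m rho sigma B => // N IHN n m rho sigma B.
rewrite ltnS => mN ur us rs Bi Bc.
have [m0|m0] := posnP m.
  have n0 : n = 0%N.
    apply/eqP; rewrite -(eqr_nat C) -(mxtrace_urep1 ur) rs (mxtrace_urep1 us).
    by rewrite m0.
  have BZ : B = 0 by apply/matrixP => -[i lt_i]; exfalso; rewrite n0 in lt_i.
  exists 0; split.
  - by apply/matrixP => -[i lt_i]; exfalso; rewrite n0 in lt_i.
  - by apply/matrixP => -[i lt_i]; exfalso; rewrite m0 in lt_i.
  - by move=> h; rewrite mulmx0 mul0mx.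
  - by rewrite BZ subr0 fro20 subr0.
have [B0 [B0N B0i B0E]] : exists B0 : 'M[C]_(n, m), [/\ B0 != 0,
    forall h, rho h *m B0 = B0 *m sigma h & B = B0 \/ B = 0].
  have [BZ|BN] := eqVneq B 0; last by exists B; split=> //; left.
  have [|B0 [B0N B0i]] := nonzero_intertwiner ur us; last first.
    by exists B0; split=> //; right.
  under eq_bigr do rewrite rs.
  rewrite psumr_neq0 => [|h _]; last exact: mul_conjC_ge0.
  apply/hasP; exists 1%g; first exact: mem_index_enum.
  by rewrite mul_conjC_gt0 (mxtrace_urep1 us) pnatr_eq0 -lt0n.
have [k [n' [m' [L [L' [K [K' [mu []]]]]]]]] := intertwiner_split ur us B0i B0N.
move=> [k0 mu0] [sL sK] [[redL redL'] [redK redK']] LK B0glue.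
have [LL LL' sumL] := sL; have [KK KK' sumK] := sK.
have dimK := split_iso_dim sK.
pose B' := L'^t* *m B *m K'.
have [||||||T' [TT TT' Ti Tle]] := IHN n' m' (compress rho L') (compress sigma K') B'.
- by apply: leq_trans mN; rewrite -dimK -[X in (X < _)%N]add0n ltn_add2r.
- exact: urep_compress.
- exact: urep_compress.
- move=> h; have := rs h; rewrite (compress_glue h sL redL redL').
  rewrite (compress_glue h sK redK redK') !mxtrace_glue // LK.
  by move=> /addrI.
- move=> h; transitivity (L'^t* *m (rho h *m B) *m K').
    by rewrite /B' !mulmxA reduces_adj.
  transitivity (L'^t* *m B *m (sigma h *m K')); first by rewrite Bi !mulmxA.
  by rewrite redK' -/(compress sigma K' h) mulmxA.
- move=> p X; rewrite /B' -!mulmxA.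
  apply: (@le_trans _ _ (fro2 (B *m (K' *m X)))).
    by rewrite [leRHS](split_fro2 _ sL) lerDr fro2_ge0.
  by rewrite (le_trans (Bc _ _)) // fro2_isol.
exists (glue L L' K K' 1%:M T').
have sG : fro2 (glue L L' K K' 1%:M T') = m%:R.
  by rewrite fro2_glue // !fro2_iso // ?adj1 ?mulmx1 // -natrD dimK.
split.
- by rewrite glue_adj (glueM _ _ _ _ _ _ _ _ sK) adj1 mulmx1 TT glue11.
- by rewrite glue_adj (glueM _ _ _ _ _ _ _ _ sL) adj1 mulmx1 TT' glue11.
- move=> h; rewrite (compress_glue h sL redL redL') (compress_glue h sK redK redK').
  rewrite (glueM _ _ _ _ _ _ _ _ sL) (glueM _ _ _ _ _ _ _ _ sK).
  by rewrite Ti mulmx1 mul1mx LK.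
case: B0E => [BE|->]; last by rewrite subr0 sG fro20 subr0.
have BG : B = glue L L' K K' (mu%:C%C)%:M B' by rewrite {1}BE B0glue /B' BE.
have fmu r : fro2 ((r%:C%C)%:M : 'M[C]_k) = r ^+ 2 * k%:R.
  by rewrite -scalemx1 fro2Z fro2_iso // adj1 mulmx1.
(* The contraction hypothesis enters here: for [mu] in the unit interval,
   [(1 - mu) ^+ 2 <= 1 - mu ^+ 2], the required bound on the eigenspace. *)
have mu1 : mu <= 1.
  have BK : B *m K = mu%:C%C *: L.
    have [ort ort'] := split_iso_orth sK.
    rewrite BG /glue mulmxDl -!mulmxA KK ort' !mulmx0 addr0 mulmx1.
    by rewrite mul_mx_scalar.
  have := Bc _ K; rewrite BK fro2Z !fro2_iso // ger_pMl ?ltr0n // => mu2.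
  by rewrite -(@ler_pXn2r _ 2) ?nnegrE ?expr1n // ltW.
rewrite {1}BG glueB fro2_glue // -raddfB /= -[1 in X in X + _](rmorph1 (real_complex R)).
rewrite -rmorphB fmu [X in _ <= _ - fro2 X]BG fro2_glue // fmu.
move: Tle; rewrite -dimK natrD => Tle.
have : mu ^+ 2 * k%:R <= mu * k%:R by rewrite ler_wpM2r // expr2 ler_piMl // ltW.
by move: Tle; do 2 move: (fro2 _) => ?; rewrite !expr2; clear -R; lra.
Qed.

Definition chr n (rho : H -> 'M[C]_n) : {ffun H -> C} := [ffun h => \tr (rho h)].

Definition is_char (f : {ffun H -> C}) : Prop :=
  exists n (rho : H -> 'M[C]_n), urep rho /\ f = chr rho.

(** Irreducibility expressed on characters; the part of Schur's lemma that is needed becomes their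
    orthogonality. *)
Definition irr_char (f : {ffun H -> C}) : Prop :=
  [/\ is_char f, f 1%g != 0 & forall f1 f2, is_char f1 -> is_char f2 ->
    f = f1 + f2 -> f1 1%g = 0 \/ f2 1%g = 0].

Definition cdot (f g : {ffun H -> C}) : C := \sum_h f h * (g h)^*.

Lemma chr1 n (rho : H -> 'M[C]_n) : urep rho -> chr rho 1%g = n%:R.
Proof. by move=> ur; rewrite ffunE mxtrace_urep1. Qed.

Lemma char0 (f : {ffun H -> C}) : is_char f -> f 1%g = 0 -> f = 0.
Proof.
move=> [n [rho [ur ->]]]; rewrite chr1 // => /eqP; rewrite pnatr_eq0 => /eqP n0.
apply/ffunP => h; rewrite !ffunE /mxtrace big1 // => -[i lt_i].
by exfalso; rewrite n0 in lt_i.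
Qed.

Lemma compress_char n k k' (rho : H -> 'M[C]_n) (K : 'M[C]_(n, k)) (K' : 'M[C]_(n, k')) :
  split_iso K K' -> reduces rho K -> reduces rho K' ->
  chr rho = chr (compress rho K) + chr (compress rho K').
Proof.
move=> sK red red'; apply/ffunP => h; rewrite !ffunE.
by rewrite (compress_glue h sK red red') mxtrace_glue.
Qed.

(** A nonzero intertwiner exists, and [intertwiner_split] extracts from it a subrepresentation
    common to both sides, with character [a]. *)
Lemma common_char (f g : {ffun H -> C}) : is_char f -> is_char g -> cdot f g != 0 ->
  exists a f' g', [/\ is_char a, is_char f' & is_char g'] /\
    [/\ a 1%g != 0, f = a + f' & g = a + g'].
Proof.
move=> [n [rho [ur ->]]] [m [sigma [us ->]]] fg.
have [|B [BN Bi]] := nonzero_intertwiner ur us.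
  by apply: contra_neq fg => E; rewrite -[RHS]E; apply: eq_bigr => h _; rewrite !ffunE.
have [k [n' [m' [L [L' [K [K' [mu []]]]]]]]] := intertwiner_split ur us Bi BN.
move=> [k0 _] [sL sK] [[redL redL'] [redK redK']] LK _.
have [LL LL' _] := sL; have [KK KK' _] := sK.
have uL := urep_compress ur LL redL.
exists (chr (compress rho L)), (chr (compress rho L')), (chr (compress sigma K')).
split; first split.
- by exists k, (compress rho L).
- by exists n', (compress rho L'); split=> //; exact: urep_compress.
- by exists m', (compress sigma K'); split=> //; exact: urep_compress.
split; first by rewrite (chr1 uL) pnatr_eq0 -lt0n.
- exact: compress_char.
- rewrite (compress_char sK redK redK'); congr (_ + _).
  by apply/ffunP => h; rewrite !ffunE LK.
Qed.

Lemma irr_orth (f g : {ffun H -> C}) : irr_char f -> irr_char g -> f != g -> cdot f g = 0.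
Proof.
move=> [fc f1 firr] [gc g1 girr]; apply: contra_neq_eq => fg.
have [a [f' [g' [[ac fc' gc'] [a0 fE gE]]]]] := common_char fc gc fg.
have [a1|/(char0 fc') f'0] := firr _ _ ac fc' fE; first by rewrite a1 eqxx in a0.
have [a1|/(char0 gc') g'0] := girr _ _ ac gc' gE; first by rewrite a1 eqxx in a0.
by rewrite fE gE f'0 g'0.
Qed.

Lemma cdot_gt0 (f : {ffun H -> C}) : f 1%g != 0 -> 0 < cdot f f.
Proof.
move=> f1; rewrite /cdot (bigD1 1%g) //= ltr_wpDr ?mul_conjC_gt0 //.
by apply: sumr_ge0 => h _; exact: mul_conjC_ge0.
Qed.

Lemma char_irr_sum (f : {ffun H -> C}) : is_char f -> exists l : seq {ffun H -> C},
  (forall g, g \in l -> irr_char g) /\ f = \sum_(g <- l) g.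
Proof.
move=> [n [rho [ur ->]]].
have [N] := ubnP n; elim: N n rho ur => // N IHN n rho ur; rewrite ltnS => nN.
have fc : is_char (chr rho) by exists n, rho.
have [n0|n0] := posnP n.
  exists [::]; split=> //; rewrite big_nil; apply: char0 => //.
  by rewrite chr1 // n0.
have [irr|nirr] := pselect (irr_char (chr rho)).
  by exists [:: chr rho]; rewrite big_seq1; split=> // g; rewrite inE => /eqP->.
have [f1 [f2 [[f1c f2c] fE f11 f21]]] : exists f1 f2, [/\ is_char f1 /\ is_char f2,
    chr rho = f1 + f2, f1 1%g != 0 & f2 1%g != 0].
  apply: contrapT => nf; apply: nirr; split=> // [|f1 f2 f1c f2c fE].
    by rewrite chr1 // pnatr_eq0 -lt0n.
  have [->|f11] := eqVneq (f1 1%g) 0; [by left|right].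
  by apply: contrapT => /eqP f21; apply: nf; exists f1, f2.
move: fE f11 f21; case: f1c f2c => [n1 [rho1 [ur1 ->]]] [n2 [rho2 [ur2 ->]]] fE.
rewrite !chr1 // !pnatr_eq0 -!lt0n => n10 n20.
have nE : n = (n1 + n2)%N.
  by apply/eqP; rewrite -(eqr_nat C) natrD -(chr1 ur) -(chr1 ur1) -(chr1 ur2) fE ffunE.
rewrite fE; have [|l1 [l1P ->]] := IHN n1 rho1 ur1.
  by apply: leq_trans nN; rewrite nE -[X in (X < _)%N]addn0 ltn_add2l.
have [|l2 [l2P ->]] := IHN n2 rho2 ur2.
  by apply: leq_trans nN; rewrite nE -[X in (X < _)%N]add0n ltn_add2r.
exists (l1 ++ l2); rewrite big_cat; split=> // g.
by rewrite mem_cat => /orP[/l1P|/l2P].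
Qed.

(** Orthogonality makes the Gram matrix diagonal and invertible, so the matrix of values, which has
    [#|H|] columns, has full row rank. *)
Lemma irr_uniq_size (l : seq {ffun H -> C}) : uniq l ->
  (forall g, g \in l -> irr_char g) -> (size l <= #|H|)%N.
Proof.
move=> ul lP; set r := size l.
pose M : 'M[C]_(r, #|H|) := \matrix_(i, j) (nth 0 l i) (enum_val j).
have MM : M *m M^t* = diag_mx (\row_i cdot (nth 0 l i) (nth 0 l i)).
  apply/matrixP => i j; rewrite !mxE.
  transitivity (cdot (nth 0 l i) (nth 0 l j)).
    rewrite /cdot (reindex (fun k : 'I_#|H| => enum_val k)) /=; last first.
      by apply: onW_bij; exact: enum_val_bij.
    by apply: eq_bigr => k _; rewrite adjE !mxE.
  have [->|ij] := eqVneq i j; first by rewrite mulr1n.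
  rewrite mulr0n; apply: irr_orth; try by apply: lP; rewrite mem_nth.
  by rewrite nth_uniq.
have Mu : M *m M^t* \in unitmx.
  rewrite unitmxE MM det_diag unitfE; apply/prodf_neq0 => i _; rewrite mxE gt_eqF //.
  by apply: cdot_gt0; have [] := lP _ (mem_nth 0 (ltn_ord i)).
rewrite -(mxrank_unit Mu); apply: leq_trans (mxrankM_maxl _ _) _.
exact: rank_leq_col.
Qed.

(* The functionals [beta k] are the multiplicities of the irreducible characters. *)
Lemma char_lattice : exists (r : nat) (beta : 'I_r -> H -> C),
  (forall n (rho : H -> 'M[C]_n) k, urep rho ->
     exists x : nat, \sum_h \tr (rho h) * beta k h = x%:R) /\
  (forall n m (rho : H -> 'M[C]_n) (sigma : H -> 'M[C]_m), urep rho -> urep sigma ->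
     (forall k, \sum_h \tr (rho h) * beta k h = \sum_h \tr (sigma h) * beta k h) ->
     forall h, \tr (rho h) = \tr (sigma h)).
Proof.
(* By [irr_uniq_size] there is a duplicate-free list of irreducible characters of maximal length,
   and it must contain all of them. *)
pose P n := `[< exists l : seq {ffun H -> C}, [/\ uniq l, size l = n
  & forall g, g \in l -> irr_char g] >].
have P0 : exists n, P n by exists 0%N; apply/asboolP; exists [::].
have [n /asboolP[l [ul ln lP]] nmax] := ex_maxnP P0 (m := #|H|) (fun n Pn =>
  let: ex_intro l (And3 ul ln lP) := asboolW Pn in
  eq_ind _ (fun n => n <= #|H|)%N (irr_uniq_size ul lP) _ ln).
have irr_l f : irr_char f -> f \in l.
  move=> fi; apply: contraT => fl.
  suff /nmax : P n.+1 by rewrite ltnn.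
  apply/asboolP; exists (f :: l); rewrite /= fl ul ln; split=> // g.
  by rewrite inE => /predU1P[->//|/lP].
have lirr (k : 'I_(size l)) : irr_char (nth 0 l k) by apply: lP; rewrite mem_nth.
(* [cdot] is not normalized; dividing by the square norm makes the pairing an exact multiplicity. *)
pose beta (k : 'I_(size l)) h : C :=
  (nth 0 l k h)^* / cdot (nth 0 l k) (nth 0 l k).
have betaE k (f : {ffun H -> C}) : \sum_h f h * beta k h =
    cdot f (nth 0 l k) / cdot (nth 0 l k) (nth 0 l k).
  by rewrite /cdot mulr_suml; apply: eq_bigr => h _; rewrite mulrA.
have betaS k (s : seq {ffun H -> C}) : (forall g, g \in s -> irr_char g) ->
    \sum_h (\sum_(g <- s) g) h * beta k h = (count_mem (nth 0 l k) s)%:R.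
  elim: s => [|g s IHs] sP; first by rewrite big1 // => h _; rewrite big_nil ffunE mul0r.
  under eq_bigr do rewrite big_cons ffunE mulrDl.
  rewrite big_split /= IHs => [|g' g's]; last by apply: sP; rewrite inE g's orbT.
  rewrite natrD; congr (_ + _); rewrite betaE.
  have gi : irr_char g by apply: sP; rewrite mem_head.
  have [->|gk] := eqVneq g (nth 0 l k); last by rewrite irr_orth ?mul0r.
  by rewrite divff // gt_eqF // cdot_gt0 //; have [] := lirr k.
have chrE m (rho : H -> 'M[C]_m) k : \sum_h \tr (rho h) * beta k h =
    \sum_h chr rho h * beta k h by apply: eq_bigr => h _; rewrite ffunE.
exists (size l), beta; split=> [m rho k ur|m1 m2 rho sigma ur us E h].
  have [|s [sP sE]] := @char_irr_sum (chr rho); first by exists m, rho.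
  by exists (count_mem (nth 0 l k) s); rewrite chrE sE betaS.
suff /ffunP/(_ h) : chr rho = chr sigma by rewrite !ffunE.
have [|s [sP sE]] := @char_irr_sum (chr rho); first by exists m1, rho.
have [|t [tP tE]] := @char_irr_sum (chr sigma); first by exists m2, sigma.
rewrite sE tE; apply: perm_big; apply/allP => g; rewrite mem_cat => gst.
have gl : g \in l by apply: irr_l; case/orP: gst => [/sP|/tP].
have /(_ (Ordinal (etrans (index_mem g l) gl))) := E.
rewrite !chrE sE tE !betaS //= nth_index // => /eqP; rewrite eqr_nat.
exact.
Qed.

End FiniteGroup.

Section RepresentationRealizable.
Variables (R : realType) (H : finGroupType) (G : groupType) (i : H -> G).
Local Notation C := R[i].

(** The counterpart of [P_realizable], where [w] is a character of H per unit of dimension. *)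
Definition HS_realizable (w : H -> C) (n : nat) : Prop :=
  exists psi : G -> 'M[C]_n, urep psi /\ forall h, \tr (psi (i h)) = n%:R * w h.

Lemma HS_realizable0 w : HS_realizable w 0.
Proof.
exists (fun=> 1%:M); split=> [|h]; first exact: urep_trivial.
by rewrite mxtrace1 mul0r.
Qed.

Lemma HS_realizableD w m n :
  HS_realizable w m -> HS_realizable w n -> HS_realizable w (m + n).
Proof.
move=> [psi [up tp]] [psi' [up' tp']]; exists (dsum psi psi').
split=> [|h]; first exact: urep_dsum.
by rewrite mxtrace_dsum tp tp' natrD mulrDl.
Qed.

Lemma HS_realizable_sum (T : finType) (w : T -> H -> C) (s : T -> nat) :
  (forall t, HS_realizable (w t) (s t)) ->
  exists psi : G -> 'M[C]_(\sum_t s t), urep psi /\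
    forall h, \tr (psi (i h)) = \sum_t (s t)%:R * w t h.
Proof.
move=> sR; elim: (index_enum T) => [|t l IHl].
  rewrite big_nil; exists (fun=> 1%:M); split=> [|h]; first exact: urep_trivial.
  by rewrite mxtrace1 big_nil.
have [psi [up tp]] := sR t; case: IHl => psi' [up' tp'].
rewrite big_cons; exists (dsum psi psi'); split=> [|h]; first exact: urep_dsum.
by rewrite mxtrace_dsum tp tp' big_cons.
Qed.

End RepresentationRealizable.

(** * Types of unitary representations through class sums *)

Section RepresentationTypes.
Variables (R : realType) (H : finGroupType) (G : groupType).
Variables (i : {multiplicative H -> G}) (s : seq G).
Local Notation C := R[i].
Hypothesis s_uniq : uniq s.
Hypothesis sP : forall g, g \in s <-> exists h x, g = (i h ^ x)%g.

Let cls h : seq G := [seq g <- s | `[< exists x, g = (i h ^ x)%g >]].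

Let clsP h g : g \in cls h <-> exists x, g = (i h ^ x)%g.
Proof.
rewrite mem_filter; split=> [/andP[/asboolP//]|gE].
by apply/andP; split; [exact/asboolP | apply/sP; exists h].
Qed.

Let cls_gt0 h : (0 < size (cls h))%N.
Proof.
by rewrite lt0n size_eq0; apply/eqP => E; have : i h \in cls h;
  [apply/clsP; exists 1%g; rewrite conjg1 | rewrite E].
Qed.

Let cls_conj h x : perm_eq [seq (g ^ x)%g | g <- cls h] (cls h).
Proof.
apply: uniq_perm.
- by rewrite map_inj_uniq ?filter_uniq //; exact: conjg_inj.
- exact: filter_uniq.
move=> g; apply/mapP/idP => [[g' /clsP[y ->] ->]|/clsP[y ->]].
  by apply/clsP; exists (y * x)%g; rewrite conjgM.
exists (i h ^ (y * x^-1))%g; last by rewrite -conjgM mulgVK.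
by apply/clsP; exists (y * x^-1)%g.
Qed.

Section ClassSum.
Variables (n : nat) (psi : G -> 'M[C]_n).
Hypothesis up : urep psi.

Definition class_sum h : 'M[C]_n := \sum_(g <- cls h) psi g.

Lemma class_sum_comm h x : psi x *m class_sum h = class_sum h *m psi x.
Proof.
rewrite mulmx_sumr mulmx_suml -[RHS](perm_big _ (cls_conj h x^-1)) big_map /=.
apply: eq_bigr => g _; rewrite -!up.2; congr psi.
by rewrite conjgE invgK mulgA mulgKV.
Qed.

Lemma class_sum_normal h : class_sum h \is normalmx.
Proof.
have E : (class_sum h)^t* = \sum_(g <- cls h) psi g^-1%g.
  by rewrite /class_sum adj_sum; apply: eq_bigr => g _; rewrite urepV.
apply/normalmxP; rewrite E mulmx_sumr mulmx_suml.
by apply: eq_bigr => g _; rewrite class_sum_comm.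
Qed.

Lemma mxtrace_class_sum h : \tr (class_sum h) = (size (cls h))%:R * \tr (psi (i h)).
Proof.
transitivity (\sum_(g <- cls h) \tr (psi (i h))); last first.
  by rewrite big_const_seq count_predT iter_addr addr0 mulr_natl.
rewrite raddf_sum; apply: eq_big_seq => g /clsP[x ->].
by rewrite /= conjgE !up.2 mxtrace_mulC -mulmxA -up.2 mulgV urep1 // mulmx1.
Qed.

End ClassSum.

(** On the finite set [N] given by [dietzmann], the row of traces of [psi] is a left eigenvector,
    with eigenvalue [lambda h], of the integer matrix [M h] of left multiplication by the class of
    [i h]. It is nonzero, its entry at [1] being the dimension. The characteristic polynomial of
    [M h] does not depend on [psi]. *)
Lemma class_sum_eigenvalues : exists r : H -> seq C,
  forall n (psi : G -> 'M[C]_n) (lambda : H -> C), (0 < n)%N -> urep psi ->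
  (forall h, class_sum psi h = (lambda h)%:M) -> forall h, lambda h \in r h.
Proof.
have sJ g x : g \in s -> (g ^ x)%g \in s.
  by move=> /sP[h [y ->]]; apply/sP; exists h, (y * x)%g; rewrite conjgM.
have sX g : g \in s -> (g ^+ #|H|)%g = 1%g.
  have i1 : i 1%g = 1%g by apply: (mulgI (i 1%g)); rewrite -gmulfM !mulg1.
  have iX h n : (i h ^+ n)%g = i (h ^+ n)%g.
    by elim: n => [|n IHn]; rewrite ?expg0 ?i1 // !expgS gmulfM IHn.
  move=> /sP[h [x ->]]; rewrite -conjXg iX.
  have -> : (h ^+ #|H| = 1)%g by rewrite -cardsT; apply: expg_cardG; rewrite inE.
  by rewrite i1 conj1g.
have H0 : (0 < #|H|)%N by apply/card_gt0P; exists 1%g.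
have [N [uN N1 NM]] := dietzmann H0 sJ sX.
pose M h : 'M[C]_(size N) := \matrix_(j', j)
  (count (fun g => (g * nth 1 N j == nth 1 N j')%g) (cls h))%:R.
exists (fun h => sval (closed_field_poly_normal (char_poly (M h)))).
move=> n psi lambda n0 up pure h; case: closed_field_poly_normal => r /= rE.
suff : root (char_poly (M h)) (lambda h).
  rewrite rE rootZ ?root_prod_XsubC // lead_coef_eq0.
  by rewrite -size_poly_gt0 size_char_poly.
rewrite -eigenvalue_root_char; apply/eigenvalueP.
exists (\row_j \tr (psi (nth 1%g N j))); last first.
  apply/eqP => /rowP/(_ (Ordinal (etrans (index_mem 1%g N) N1))).
  rewrite !mxE /= nth_index // (mxtrace_urep1 up) => /eqP.
  by rewrite pnatr_eq0 -leqn0 leqNgt n0.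
apply/rowP => j; rewrite !mxE.
transitivity (\sum_(g <- cls h) \tr (psi (g * nth 1 N j)%g)).
  under eq_bigr do rewrite !mxE.
  have sub : {subset cls h <= s} by move=> g; rewrite mem_filter => /andP[].
  elim: (cls h) sub => [|g l IHl] sub.
    by rewrite big_nil big1 // => j' _; rewrite mulr0.
  rewrite big_cons -IHl => [|g' g'l]; last by apply: sub; rewrite inE g'l orbT.
  under eq_bigr do rewrite /= natrD mulrDr.
  rewrite big_split /=; congr (_ + _).
  have gN : (g * nth 1 N j)%g \in N by apply: NM; rewrite ?mem_nth ?sub ?mem_head.
  rewrite (bigD1 (Ordinal (etrans (index_mem _ N) gN))) //= nth_index // eqxx mulr1.
  rewrite big1 ?addr0 // => j' j'N; case: eqP => [E|]; last by rewrite mulr0.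
  by case/eqP: j'N; apply: val_inj; rewrite /= E index_uniq.
rewrite -raddf_sum /=; under eq_bigr do rewrite up.2.
by rewrite -mulmx_suml -/(class_sum psi h) pure mul_scalar_mx mxtraceZ.
Qed.

Lemma sum_at (T : finType) (V : nmodType) (P : pred T) (t : T) (F : T -> V) :
  (forall t', t' != t -> F t' = 0) ->
  \sum_(t' | P t') F t' = if P t then F t else 0.
Proof.
move=> F0; case: ifP => Pt; last by rewrite big1 // => t' Pt'; apply: F0;
  apply: contraTneq Pt' => ->; rewrite Pt.
by rewrite (bigD1 t) //= big1 ?addr0 // => t' /andP[_ /F0].
Qed.

(* Type: the scalars by which the class sums act. A representation on which all
   class sums are scalar has its character on H determined by its dimension. *)
Lemma HS_types : exists (T : finType) (w : T -> H -> C),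
  forall n (psi : G -> 'M[C]_n), urep psi -> exists z : T -> nat,
  [/\ forall t, HS_realizable i (w t) (z t),
      forall h, \tr (psi (i h)) = \sum_t (z t)%:R * w t h
    & forall K : pred T, exists psi' : G -> 'M[C]_n, [/\ urep psi',
        forall h, \tr (psi' (i h)) = \sum_(t | K t) (z t)%:R * w t h
          + (\sum_(t | ~~ K t) z t)%:R
      & forall g, fro2 (psi' g - psi g) <= 4 * (\sum_(t | ~~ K t) z t)%:R]].
Proof.
have [r rP] := class_sum_eigenvalues.
pose V := seq_sub (flatten [seq r h | h <- enum H]).
have rV h x : x \in r h -> x \in flatten [seq r h | h <- enum H].
  by move=> xr; apply/flatten_mapP; exists h => //; rewrite mem_enum.
(* If the class sum is the scalar [t h], its trace is both the dimension times [t h] and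
   [size (cls h)] times the character at [h]. *)
pose w (t : {ffun H -> V}) h : C := val (t h) / (size (cls h))%:R.
exists {ffun H -> V}, w => n psi up.
have [N] := ubnP n; elim: N n psi up => // N IHN n psi up; rewrite ltnS => nN.
have [n0|n0] := posnP n.
  have psi0 (M : 'M[C]_n) : \tr M = 0.
    by rewrite /mxtrace big1 // => -[j lt_j]; exfalso; rewrite n0 in lt_j.
  exists (fun=> 0%N); split=> [t|h|K]; first exact: HS_realizable0.
    by rewrite psi0 big1 // => t _; rewrite mul0r.
  exists psi; split=> // [h|g]; last by rewrite subrr fro20 mulr_ge0.
  by rewrite psi0 !big1 ?addr0 // => t _; rewrite mul0r.
have [[lambda pure]|npure] := pselect (exists lambda : H -> C, forall h,
    class_sum psi h = (lambda h)%:M).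
  have lr h : lambda h \in flatten [seq r h | h <- enum H].
    by apply: (rV h); exact: (rP n psi lambda).
  pose t : {ffun H -> V} := [ffun h => SeqSub (lr h)].
  have trE h : \tr (psi (i h)) = n%:R * w t h.
    have sz : (size (cls h))%:R != 0 :> C by rewrite pnatr_eq0 -lt0n.
    apply: (mulfI sz); rewrite -mxtrace_class_sum // pure mxtrace_scalar /w ffunE /=.
    by rewrite mulrCA [_ * (_ / _)]mulrC divfK // mulr_natl.
  pose z t' := if t' == t then n else 0%N.
  have zt : z t = n by rewrite /z eqxx.
  have z0 t' : t' != t -> z t' = 0%N by rewrite /z => /negPf->.
  have zw h t' : t' != t -> (z t')%:R * w t' h = 0 by move=> /z0->; rewrite mul0r.
  exists z; split=> [t'|h|K].
  - rewrite /z; case: eqP => [->|_]; last exact: HS_realizable0.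
    by exists psi.
  - by rewrite (sum_at _ (zw h)) zt.
  - rewrite (sum_at (fun t => ~~ K t) z0) zt.
    have [Kt|Kt] := boolP (K t).
      exists psi; split=> // [h|g]; last by rewrite subrr fro20 mulr_ge0.
      by rewrite (sum_at _ (zw h)) Kt zt addr0.
    exists (fun=> 1%:M); split=> [|h|g]; first exact: urep_trivial.
      by rewrite (sum_at _ (zw h)) (negPf Kt) add0r mxtrace1.
    (* Two unitaries of squared norm [n] each: [2 n + 2 n] is the source of the factor [4]. *)
    apply: (le_trans (fro2B_le _ _)).
    rewrite !fro2_iso ?adj1 ?mulmx1 //; last exact: unitary_Kadj (up.1 g).
    by lra.
have [h nscal] : exists h, forall x, class_sum psi h <> x%:M.
  apply: contrapT => nh; apply: npure.
  suff /choice[lambda lP] : forall h, exists x, class_sum psi h = x%:M by exists lambda.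
  move=> h; apply: contrapT => nx; apply: nh; exists h => x E; apply: nx; by exists x.
have [x [k [k' [K [K' [_ k0 sK ZK red]]]]]] := spectral_split n0 (class_sum_normal up h).
have redK : reduces psi K by move=> g; have [] := red _ (class_sum_comm up h g).
have redK' : reduces psi K' by move=> g; have [] := red _ (class_sum_comm up h g).
have [KK KK' sumK] := sK; have dimK := split_iso_dim sK.
(* The eigenspace is proper because the class sum is not scalar; both pieces are smaller and the
   induction applies to each. *)
have k'0 : (0 < k')%N.
  rewrite lt0n; apply/eqP => k'0; apply: (nscal x).
  rewrite -[LHS]mulmx1 -sumK mulmxDr mulmxA ZK -scalemxAl.
  have E : K' *m K'^t* = 0.
    by apply/matrixP => a b; rewrite !mxE big1 // => -[c lt_c]; exfalso; rewrite k'0 in lt_c.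
  by move: sumK; rewrite E addr0 => ->; rewrite mulmx0 addr0 scalemx1.
have [||z1 [Ez1 tr1 dec1]] := IHN k (compress psi K).
- exact: urep_compress.
- by apply: leq_trans nN; rewrite -dimK -[X in (X < _)%N]addn0 ltn_add2l.
have [||z2 [Ez2 tr2 dec2]] := IHN k' (compress psi K').
- exact: urep_compress.
- by apply: leq_trans nN; rewrite -dimK -[X in (X < _)%N]add0n ltn_add2r.
exists (fun t => z1 t + z2 t)%N.
have sumz (P : pred {ffun H -> V}) h' : \sum_(t | P t) (z1 t + z2 t)%:R * w t h' =
    \sum_(t | P t) (z1 t)%:R * w t h' + \sum_(t | P t) (z2 t)%:R * w t h'.
  by rewrite -big_split /=; apply: eq_bigr => t _; rewrite natrD mulrDl.
split=> [t|h'|P]; first exact: HS_realizableD.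
  by rewrite (compress_glue _ sK redK redK') mxtrace_glue // tr1 tr2 sumz.
have [p1 [up1 trp1 le1]] := dec1 P; have [p2 [up2 trp2 le2]] := dec2 P.
exists (fun g => glue K K' K K' (p1 g) (p2 g)); split=> [|h'|g].
- exact: urep_glue.
- by rewrite mxtrace_glue // trp1 trp2 sumz big_split natrD addrACA.
- rewrite (compress_glue g sK redK redK') glueB fro2_glue // big_split natrD mulrDr.
  exact: lerD.
Qed.

End RepresentationTypes.

Lemma HS_decomposition (R : realType) (H : finGroupType) (G : groupType)
    (i : {multiplicative H -> G}) : almost_normal (range i) ->
  exists (T : finType) (w : T -> H -> R[i]),
  forall n (psi : G -> 'M[R[i]]_n), urep psi -> exists z : T -> nat,
  [/\ forall t, HS_realizable i (w t) (z t),
      forall h, \tr (psi (i h)) = \sum_t (z t)%:R * w t h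
    & forall K : pred T, exists psi' : G -> 'M[R[i]]_n, [/\ urep psi',
        forall h, \tr (psi' (i h)) = \sum_(t | K t) (z t)%:R * w t h
          + (\sum_(t | ~~ K t) z t)%:R
      & forall g, fro2 (psi' g - psi g) <= 4 * (\sum_(t | ~~ K t) z t)%:R]].
Proof. by move=> /almost_normal_conj[s us sP]; exact: HS_types us sP. Qed.

(** * From an almost intertwiner to a unitary intertwiner *)

Section CloseIntertwiner.
Variables (R : realType) (H : finGroupType).
Local Notation C := R[i].

Lemma fro2_adjiso_le n k p (K : 'M[C]_(n, k)) (Y : 'M[C]_(n, p)) :
  K^t* *m K = 1%:M -> fro2 (K^t* *m Y) <= fro2 Y.
Proof.
move=> KK; have [k' [K' sK]] := isometry_complement KK.
by rewrite [leRHS](split_fro2 _ sK) lerDl fro2_ge0.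
Qed.

Lemma fro2_mulr_le n k p (K : 'M[C]_(n, k)) (Y : 'M[C]_(p, n)) :
  K^t* *m K = 1%:M -> fro2 (Y *m K) <= fro2 Y.
Proof.
by move=> KK; rewrite -fro2_adj adjM -[leRHS]fro2_adj; exact: fro2_adjiso_le.
Qed.

(** [J1 *m J2^t*] almost intertwines, and averaging it over H moves it by at most [4 * a] in squared
    norm. The average [B] then satisfies [fro2 B >= d - 4 * a], and [unitary_intertwiner] gives [T]
    with [fro2 (T - B) <= f2 - d + 4 * a]; doubling both errors yields the bound. *)
Lemma close_intertwiner d f1 f2 (theta : H -> 'M[C]_d) (J1 : 'M[C]_(f1, d))
    (J2 : 'M[C]_(f2, d)) (Z1 : H -> 'M[C]_f1) (Z2 : H -> 'M[C]_f2) (a : R) :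
  J1^t* *m J1 = 1%:M -> J2^t* *m J2 = 1%:M -> urep Z1 -> urep Z2 ->
  (forall h, theta h \is unitarymx) -> (forall h, \tr (Z1 h) = \tr (Z2 h)) ->
  (forall h, fro2 (J1 *m theta h - Z1 h *m J1) <= a) ->
  (forall h, fro2 (J2 *m theta h - Z2 h *m J2) <= a) ->
  exists T : 'M[C]_(f1, f2), [/\ T *m T^t* = 1%:M, T^t* *m T = 1%:M,
    forall h, Z1 h *m T = T *m Z2 h
    & fro2 (J1 - T *m J2) <= 2 * (f2%:R - d%:R) + 16 * a].
Proof.
move=> JJ1 JJ2 u1 u2 uth tr12 le1 le2.
pose A := J1 *m J2^t*.
have H0 : (0 < #|H|)%N by apply/card_gt0P; exists 1%g.
have nH0 : #|H|%:R != 0 :> R by rewrite pnatr_eq0 -lt0n.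
pose S := \sum_h Z1 h *m A *m (Z2 h)^t*.
pose B := (#|H|%:R^-1 : R)%:C%C *: S.
have Bi h : Z1 h *m B = B *m Z2 h.
  by rewrite -scalemxAr -scalemxAl avg_intertwines.
have Ac p (X : 'M[C]_(f2, p)) : fro2 (A *m X) <= fro2 X.
  by rewrite /A -mulmxA fro2_isol // fro2_adjiso_le.
have Bc p (X : 'M[C]_(f2, p)) : fro2 (B *m X) <= fro2 X.
  rewrite /B -scalemxAl mulmx_suml; apply: fro2_sum_le => // h.
  have -> : Z1 h *m A *m (Z2 h)^t* *m X = Z1 h *m (A *m ((Z2 h)^t* *m X)).
    by rewrite !mulmxA.
  rewrite fro2_unitl; last exact: u1.1.
  by rewrite (le_trans (Ac _ _)) // fro2_unitl // trmxC_unitary u2.1.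
have AB h : fro2 (A - Z1 h *m A *m (Z2 h)^t*) <= 4 * a.
  rewrite -(@fro2_unitr _ _ _ (Z2 h)); last exact: u2.1.
  rewrite mulmxBl -[X in _ - X]mulmxA unitary_Kadj ?mulmx1; last exact: u2.1.
  have -> : A *m Z2 h - Z1 h *m A = J1 *m (J2^t* *m Z2 h - theta h *m J2^t*)
      + (J1 *m theta h - Z1 h *m J1) *m J2^t*.
    by rewrite mulmxBr mulmxBl !mulmxA addrA subrK.
  apply: (le_trans (fro2D_le _ _)); rewrite fro2_isol // fro2_isor //.
  have -> : fro2 (J2^t* *m Z2 h - theta h *m J2^t*) = fro2 (J2 *m theta h - Z2 h *m J2).
    rewrite -fro2_adj adjB !adjM trmxCK -(@fro2_unitl _ _ _ (Z2 h)); last exact: u2.1.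
    rewrite -(@fro2_unitr _ _ _ (theta h)) // mulmxBr mulmxBl !mulmxA.
    rewrite unitary_adjK ?mul1mx; last exact: u2.1.
    by rewrite -[X in _ - X]mulmxA unitary_Kadj ?mulmx1 // -fro2N opprB.
  by have := le1 h; have := le2 h; lra.
have ABle : fro2 (A - B) <= 4 * a.
  have -> : A - B = (#|H|%:R^-1 : R)%:C%C *: \sum_h (A - Z1 h *m A *m (Z2 h)^t*).
    rewrite sumrB scalerBr sumr_const -[A *+ _]scaler_nat -/S; congr (_ - _).
    by rewrite -(rmorph_nat (real_complex R)) scalerA -rmorphM /= mulVf ?scale1r.
  exact: fro2_sum_le.
(* [B] is the orthogonal projection of [A] onto the intertwiners; this turns its closeness to [A]
   into a lower bound for [fro2 B]. *)
have BB : fro2 B = ip A B.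
  rewrite {1}/fro2 {1}/B ipZl [ip S B]ipC ip_sumr.
  rewrite (eq_bigr (fun=> ip A B)) => [|h _].
    by rewrite sumr_const -[ip A B *+ _]mulr_natl mulKf.
  rewrite ipC /ip !adjM trmxCK -!mulmxA mxtrace_mulC -!mulmxA -Bi.
  rewrite (mulmxA _ (Z1 h)) unitary_Kadj ?mul1mx //; exact: u1.1.
have BE : fro2 B = d%:R - fro2 (A - B).
  rewrite fro2B -BB; have -> : fro2 A = d%:R by rewrite fro2_isor // fro2_iso.
  by ring.
have [T [TT TT' Ti Tle]] := unitary_intertwiner u1 u2 tr12 Bi Bc.
exists T; split=> //.
have -> : J1 - T *m J2 = (A - T) *m J2.
  by rewrite mulmxBl -mulmxA JJ2 mulmx1.
apply: (le_trans (fro2_mulr_le _ JJ2)).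
have -> : A - T = (A - B) - (T - B) by rewrite opprB addrA subrK.
apply: (le_trans (fro2B_le _ _)); move: BE ABle Tle.
by move: (fro2 _) (fro2 _) (fro2 _) => ? ? ?; clear -R; lra.
Qed.

End CloseIntertwiner.

Section Weights.
Variables (R : realType) (H : finGroupType) (G : groupType).
Variables (i : {multiplicative H -> G}) (T : finType) (w : T -> H -> R[i]).
Variables (r : nat) (beta : 'I_r -> H -> R[i]).
Local Notation C := R[i].
Hypothesis beta_nat : forall n (rho : H -> 'M[C]_n) k, urep rho ->
  exists x : nat, \sum_h \tr (rho h) * beta k h = x%:R.

(** The pairing of [w t] with [beta k] is a multiplicity divided by a dimension, hence rational as
    soon as some nonzero dimension is realizable; otherwise [0] serves as a default. This makes the
    rational balancing lemma applicable. *)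
Lemma rational_weights : exists q : T -> 'I_r -> rat, forall t k n,
  HS_realizable i (w t) n -> n%:R * q t k \in Num.int /\
    ratr (n%:R * q t k) = n%:R * \sum_h w t h * beta k h.
Proof.
have real_nat t k n : HS_realizable i (w t) n ->
    exists x : nat, n%:R * \sum_h w t h * beta k h = x%:R.
  move=> [psi [up tp]]; have [x xE] := beta_nat k (urep_comp i up).
  exists x; rewrite -xE mulr_sumr; apply: eq_bigr => h _.
  by rewrite /= tp mulrA.
have q_ex t k : exists q : rat, forall n, HS_realizable i (w t) n ->
    ratr (n%:R * q) = n%:R * \sum_h w t h * beta k h.
  have [[n [n0 nR]]|nR] := pselect (exists n, (0 < n)%N /\ HS_realizable i (w t) n).
    have [x xE] := real_nat t k n nR; exists (x%:R / n%:R) => m mR.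
    rewrite rmorphM fmorph_div /= !ratr_nat -xE mulrC.
    by rewrite [_ / _]mulrC mulKf ?pnatr_eq0 -?lt0n // mulrC.
  exists 0 => -[|n] nR'; first by rewrite !mul0r rmorph0.
  by exfalso; apply: nR; exists n.+1.
pose q t k := xget 0 [set q : rat | forall n, HS_realizable i (w t) n ->
    ratr (n%:R * q) = n%:R * \sum_h w t h * beta k h]%classic.
have qP t k := @xgetPex _ 0 _ (q_ex t k).
exists q => t k n nR; split; last exact: qP.
have [x xE] := real_nat t k n nR.
have -> : n%:R * q t k = x%:R; last by rewrite rpred_nat.
by apply: (fmorph_inj (@ratr C)); apply: etrans (qP t k n nR) _; rewrite xE rmorph_nat.
Qed.

End Weights.

Lemma normc_sum_le (R : realType) (I : Type) (s : seq I) (F : I -> R[i]) :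
  Normc.normc (\sum_(j <- s) F j) <= \sum_(j <- s) Normc.normc (F j).
Proof.
elim: s => [|j s IHs]; first by rewrite !big_nil Normc.normc0.
by rewrite !big_cons (le_trans (le_normcD _ _)) // lerD2l.
Qed.

Lemma normc_ratr (R : realType) (q : rat) : Normc.normc (ratr q : R[i]) = `|ratr q : R|.
Proof.
rewrite -(fmorph_rat (real_complex R)) /=.
by rewrite expr0n /= addr0 sqrtr_sqr.
Qed.

(** * Correction of one pair of unitary representations *)

Section HilbertSchmidtStep.
Variables (R : realType) (H : finGroupType) (G1 G2 : groupType).
Variables (i1 : {multiplicative H -> G1}) (i2 : {multiplicative H -> G2}).
Hypotheses (an1 : almost_normal (range i1)) (an2 : almost_normal (range i2)).
Local Notation C := R[i].

Definition inl_mx e s : 'M[C]_(e + s, e) := col_mx 1%:M 0.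

Lemma inl_mx_iso e s : (inl_mx e s)^t* *m inl_mx e s = 1%:M.
Proof.
rewrite /inl_mx tr_col_mx map_row_mx mul_row_col mulmx0 addr0 mulmx1.
exact: adj1.
Qed.

Lemma dsum_inl (G : groupType) e s (psi : G -> 'M[C]_e) (psi' : G -> 'M[C]_s) g :
  dsum psi psi' g *m inl_mx e s = inl_mx e s *m psi g.
Proof. by rewrite mul_block_col mul_col_mx mul0mx !mulmx0 mulmx1 mul1mx !addr0 mul0mx. Qed.

(** The unitary analogue of [P_step]. The hypothesis on traces bounds the difference of the
    multiplicities, which for permutations was obtained by counting points. *)
Lemma HS_step : exists2 c : R, 0 <= c &
  forall d e1 e2 (eta : R) (theta : H -> 'M[C]_d) (J1 : 'M[C]_(e1, d)) (J2 : 'M[C]_(e2, d))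
    (psi1 : G1 -> 'M[C]_e1) (psi2 : G2 -> 'M[C]_e2),
  0 <= eta -> J1^t* *m J1 = 1%:M -> J2^t* *m J2 = 1%:M -> urep psi1 -> urep psi2 ->
  e1%:R <= d%:R + eta -> e2%:R <= d%:R + eta -> (forall h, theta h \is unitarymx) ->
  (forall h, fro2 (J1 *m theta h - psi1 (i1 h) *m J1) <= eta) ->
  (forall h, fro2 (J2 *m theta h - psi2 (i2 h) *m J2) <= eta) ->
  (forall h, Normc.normc (\tr (psi1 (i1 h)) - \tr (psi2 (i2 h))) <= eta) ->
  exists f (J : 'M[C]_(f, d)) (Psi1 : G1 -> 'M[C]_f) (Psi2 : G2 -> 'M[C]_f),
  [/\ J^t* *m J = 1%:M, f%:R <= d%:R + c * eta, urep Psi1 /\ urep Psi2,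
      forall h, Psi1 (i1 h) = Psi2 (i2 h)
    & (forall g M, M \is unitarymx -> fro2 (J *m M - Psi1 g *m J) <=
         4 * fro2 (J1 *m M - psi1 g *m J1) + c * eta) /\
      (forall g M, M \is unitarymx -> fro2 (J *m M - Psi2 g *m J) <=
         4 * fro2 (J2 *m M - psi2 g *m J2) + c * eta)].
Proof.
have [T1 [w1 dec1]] := HS_decomposition R an1.
have [T2 [w2 dec2]] := HS_decomposition R an2.
have [r [beta [beta_nat beta_inj]]] := char_lattice R H.
have [q1 q1P] := @rational_weights R H G1 i1 T1 w1 r beta beta_nat.
have [q2 q2P] := @rational_weights R H G2 i2 T2 w2 r beta beta_nat.
have [||||||K1 [K2 [c0 bal]]] := @balance_two T1 T2 'I_r q1 q2
    (fun t => HS_realizable i1 (w1 t)) (fun t => HS_realizable i2 (w2 t)).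
- by move=> t; exact: HS_realizable0.
- by move=> t; exact: HS_realizable0.
- by move=> t m n; exact: HS_realizableD.
- by move=> t m n; exact: HS_realizableD.
- by move=> t n k nR; have [] := q1P t k n nR.
- by move=> t n k nR; have [] := q2P t k n nR.
(* Converts a bound on characters of H into one on multiplicities, their pairings with the
   [beta k]. *)
pose cb : R := \sum_k \sum_h Normc.normc (beta k h).
have cb0 : 0 <= cb.
  by apply: sumr_ge0 => k _; apply: sumr_ge0 => h _; case: (beta k h) => a b; exact: sqrtr_ge0.
pose c1 : R := c0%:R * cb.
have c10 : 0 <= c1 by rewrite mulr_ge0.
(* Not optimized: any constants absorbing the linear estimates below would do. *)
exists (300 + 1100 * c1); first by lra.
move=> d e1 e2 eta theta J1 J2 psi1 psi2 eta0 JJ1 JJ2 u1 u2 le_e1 le_e2 uth le1 le2 le_tr.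
have [z1 [Ez1 tr1 /(_ K1)[p1 [up1 trp1 p1E]]]] := dec1 _ psi1 u1.
have [z2 [Ez2 tr2 /(_ K2)[p2 [up2 trp2 p2E]]]] := dec2 _ psi2 u2.
have [s1 [s2 [Es1 Es2 sE le_del le_s]]] := bal z1 z2 Ez1 Ez2.
set v := (\sum_k _)%R in le_del le_s.
set del1 := (\sum_(t | ~~ K1 t) z1 t)%N in le_del trp1 p1E.
set del2 := (\sum_(t | ~~ K2 t) z2 t)%N in le_del trp2 p2E.
have q1E (P : pred T1) (z : T1 -> nat) k : (forall t, HS_realizable i1 (w1 t) (z t)) ->
    \sum_h (\sum_(t | P t) (z t)%:R * w1 t h) * beta k h =
    ratr (\sum_(t | P t) (z t)%:R * q1 t k).
  move=> zR; rewrite rmorph_sum; under eq_bigr do rewrite mulr_suml.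
  rewrite exchange_big /=; apply: eq_bigr => t _.
  by rewrite (q1P t k _ (zR t)).2 mulr_sumr; apply: eq_bigr => h _; rewrite mulrA.
have q2E (P : pred T2) (z : T2 -> nat) k : (forall t, HS_realizable i2 (w2 t) (z t)) ->
    \sum_h (\sum_(t | P t) (z t)%:R * w2 t h) * beta k h =
    ratr (\sum_(t | P t) (z t)%:R * q2 t k).
  move=> zR; rewrite rmorph_sum; under eq_bigr do rewrite mulr_suml.
  rewrite exchange_big /=; apply: eq_bigr => t _.
  by rewrite (q2P t k _ (zR t)).2 mulr_sumr; apply: eq_bigr => h _; rewrite mulrA.
have vE : ratr v <= cb * eta.
  rewrite rmorph_sum mulr_suml; apply: ler_sum => k _.
  rewrite /= ratr_norm -normc_ratr rmorphB /= -(q1E predT) // -(q2E predT) //.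
  rewrite -sumrB (le_trans (normc_sum_le _ _)) // mulr_suml; apply: ler_sum => h _.
  by rewrite -mulrBl Normc.normcM -tr1 -tr2 mulrC ler_wpM2l //; case: (beta k h) => ? ?; exact: sqrtr_ge0.
have {}vE n : (n%:R <= c0%:R * v)%R -> (n%:R <= c1 * eta :> R).
  rewrite -(ler_rat R) rmorphM !rmorph_nat => /le_trans; apply.
  by rewrite /c1 -mulrA ler_wpM2l.
move: le_del le_s => /vE + /vE; rewrite !natrD.
set x := c1 * eta => le_del le_s.
have x0 : 0 <= x by rewrite mulr_ge0.
have cE : (300 + 1100 * c1) * eta = 300 * eta + 1100 * x by rewrite /x; ring.
have [S1 [uS1 trS1]] := HS_realizable_sum Es1.
have [S2 [uS2 trS2]] := HS_realizable_sum Es2.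
(* As for permutations, each side receives as many trivial dimensions as were trivialized on the
   other. *)
pose D1 := dsum S1 (fun=> 1%:M : 'M[C]_del2); pose D2 := dsum S2 (fun=> 1%:M : 'M[C]_del1).
have uD1 : urep D1 by apply: urep_dsum => //; exact: urep_trivial.
have uD2 : urep D2 by apply: urep_dsum => //; exact: urep_trivial.
pose Z1 := dsum p1 D1; pose Z2 := dsum p2 D2.
have uZ1 : urep Z1 by exact: urep_dsum.
have uZ2 : urep Z2 by exact: urep_dsum.
have trZ h : \tr (Z1 (i1 h)) = \tr (Z2 (i2 h)).
  move: h; apply: (beta_inj _ _ (Z1 \o i1) (Z2 \o i2)); [exact: urep_comp|exact: urep_comp|].
  move=> k.
  have E1 h : \tr ((Z1 \o i1) h) * beta k h =
     (\sum_(t | K1 t) (z1 t)%:R * w1 t h) * beta k h +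
     (\sum_t (s1 t)%:R * w1 t h) * beta k h + (del1%:R + del2%:R) * beta k h.
    by rewrite /= !mxtrace_dsum trp1 trS1 mxtrace1 -!mulrDl; congr (_ * _); ring.
  have E2 h : \tr ((Z2 \o i2) h) * beta k h =
     (\sum_(t | K2 t) (z2 t)%:R * w2 t h) * beta k h +
     (\sum_t (s2 t)%:R * w2 t h) * beta k h + (del1%:R + del2%:R) * beta k h.
    by rewrite /= !mxtrace_dsum trp2 trS2 mxtrace1 -!mulrDl; congr (_ * _); ring.
  rewrite (eq_bigr _ (fun h _ => E1 h)) (eq_bigr _ (fun h _ => E2 h)) !big_split /=.
  by rewrite !q1E // !q2E // -!rmorphD /= sE.
pose JJ e s (J : 'M[C]_(e, d)) := inl_mx e s *m J.
have JJiso e s (J : 'M[C]_(e, d)) : J^t* *m J = 1%:M ->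
    (JJ e s J)^t* *m JJ e s J = 1%:M.
  by move=> Ji; rewrite /JJ adjM mulmxA -(mulmxA (J^t*)) inl_mx_iso mulmx1.
have JJfro (G : groupType) e s (J : 'M[C]_(e, d)) (p : G -> 'M[C]_e) (D : G -> 'M[C]_s) g M :
    fro2 (JJ e s J *m M - dsum p D g *m JJ e s J) = fro2 (J *m M - p g *m J).
  rewrite /JJ (mulmxA (dsum _ _ _)) dsum_inl -!mulmxA -mulmxBr fro2_isol //.
  exact: inl_mx_iso.
have p_le (G : groupType) e (J : 'M[C]_(e, d)) (p psi : G -> 'M[C]_e) (y : R) g M :
    J^t* *m J = 1%:M -> fro2 (p g - psi g) <= 4 * y ->
    fro2 (J *m M - p g *m J) <= 2 * fro2 (J *m M - psi g *m J) + 8 * y.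
  move=> Ji le_y.
  have -> : J *m M - p g *m J = (J *m M - psi g *m J) - (p g - psi g) *m J.
    by rewrite mulmxBl opprB addrA subrK.
  apply: (le_trans (fro2B_le _ _)).
  have := fro2_mulr_le (p g - psi g) Ji; move: le_y.
  by do 3 move: (fro2 _) => ?; clear -an1 an2; lra.
have d10 : 0 <= del1%:R :> R by [].
have d20 : 0 <= del2%:R :> R by [].
have s10 : 0 <= (\sum_t s1 t)%:R :> R by [].
have s20 : 0 <= (\sum_t s2 t)%:R :> R by [].
(* By [p_le] the passage from [psi1] to [p1] doubles the error and adds [8 * del1], and likewise on
   the other side; [x] bounds [del1 + del2]. *)
have [||||||||T [TT TT' Ti Tle]] := @close_intertwiner R H d _ _ theta (JJ _ _ J1) (JJ _ _ J2)
   (Z1 \o i1) (Z2 \o i2) (2 * eta + 8 * x).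
- exact: JJiso.
- exact: JJiso.
- exact: urep_comp.
- exact: urep_comp.
- exact: uth.
- exact: trZ.
- move=> h; rewrite JJfro; apply: (le_trans (p_le _ _ _ _ _ _ _ _ JJ1 (p1E (i1 h)))).
  move: (le1 h) le_del d10 d20; move: (fro2 _) => ?.
  by clear -an1 an2; lra.
- move=> h; rewrite JJfro; apply: (le_trans (p_le _ _ _ _ _ _ _ _ JJ2 (p2E (i2 h)))).
  move: (le2 h) le_del d10 d20; move: (fro2 _) => ?.
  by clear -an1 an2; lra.
exists _, (JJ _ _ J1), Z1, (fun g => T *m Z2 g *m T^t*); split.
- exact: JJiso.
- by rewrite !natrD cE; lra.
- by split=> //; exact: urep_conj.
- by move=> h; rewrite -[T *m _]Ti /= -mulmxA TT mulmx1.
split=> g M uM.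
  rewrite JJfro; apply: (le_trans (p_le _ _ _ _ _ _ _ _ JJ1 (p1E g))).
  rewrite cE; have := fro2_ge0 (J1 *m M - psi1 g *m J1).
  by move: le_del d10 d20 x0 eta0; move: (fro2 _) => ?; clear -an1 an2; lra.
set J := JJ _ _ J1 in Tle *; set J' := JJ _ _ J2 in Tle *.
have -> : fro2 (J *m M - T *m Z2 g *m T^t* *m J) = fro2 (T^t* *m J *m M - Z2 g *m (T^t* *m J)).
  rewrite -[RHS](@fro2_isol _ _ _ _ T) // mulmxBr !mulmxA TT mul1mx.
  by rewrite -!mulmxA.
(* Seen from [Z2], the inclusion is [T^t* *m J], which differs from [J'] by [X]. Multiplication by
   unitaries keeps the norm of [X], bounded by [Tle]. *)
pose X := T^t* *m J - J'.
have Xle : fro2 X = fro2 (J - T *m J').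
  by rewrite -(@fro2_isol _ _ _ _ T X) // mulmxBr mulmxA TT mul1mx.
have -> : T^t* *m J *m M - Z2 g *m (T^t* *m J) =
    (J' *m M - Z2 g *m J') + (X *m M - Z2 g *m X).
  by rewrite /X mulmxBl mulmxBr opprB addrACA addKr [J' *m M + _]addrC subrK.
apply: (le_trans (fro2D_le _ _)); rewrite JJfro.
have := p_le _ _ _ _ _ _ g M JJ2 (p2E g).
have := fro2B_le (X *m M) (Z2 g *m X).
rewrite fro2_unitr // fro2_unitl; last exact: uZ2.1.
rewrite Xle cE; move: Tle le_e2 le_del le_s d10 d20 s10 s20 x0 eta0; rewrite !natrD.
by do 4 move: (fro2 _) => ?; clear -an1 an2; lra.
Qed.

End HilbertSchmidtStep.

(** * Limits *)

Import numFieldNormedType.Exports.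
Local Open Scope classical_set_scope.
Local Open Scope set_scope.
Local Open Scope group_scope.

(** The definition of stability counts classical sets, the estimates count finite sets. *)
Lemma card_mkset (X : finType) (P : pred X) :
  #|[set x | P x]%classic| = #|[set x | P x]|.
Proof.
apply: eq_card => x; rewrite finset.inE; apply/idP/idP; first by rewrite in_setE.
by move=> Px; rewrite in_setE.
Qed.

Section Squeeze.
Variable R : realType.

Lemma cvg0_le (u v : nat -> R) : (forall n, 0 <= u n <= v n)%R ->
  v @ \oo --> (0 : R)%R -> u @ \oo --> (0 : R)%R.
Proof.
move=> uv v0; apply: (squeeze_cvgr _ (cvg_cst (0 : R)%R) v0).
by apply: nearW.
Qed.

Lemma cvg0D (u v : nat -> R) : u @ \oo --> (0 : R)%R -> v @ \oo --> (0 : R)%R ->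
  (fun n => u n + v n)%R @ \oo --> (0 : R)%R.
Proof. by move=> u0 v0; rewrite -[X in _ --> X]addr0; exact: cvgD. Qed.

Lemma cvg0M (c : R) (u : nat -> R) : u @ \oo --> (0 : R)%R ->
  (fun n => c * u n)%R @ \oo --> (0 : R)%R.
Proof. by move=> u0; rewrite -[X in _ --> X](mulr0 c); apply: cvgM => //; exact: cvg_cst. Qed.

Lemma cvg0_sum (I : Type) (r : seq I) (u : I -> nat -> R) :
  (forall i, u i @ \oo --> (0 : R)%R) ->
  (fun n => \sum_(i <- r) u i n)%R @ \oo --> (0 : R)%R.
Proof.
move=> u0; elim: r => [|i r IHr].
  by under eq_fun do rewrite big_nil; exact: cvg_cst.
by under eq_fun do rewrite big_cons; exact: cvg0D.
Qed.

Lemma cvg1_le (u v : nat -> R) : (forall n, 1 <= u n <= 1 + v n)%R ->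
  v @ \oo --> (0 : R)%R -> u @ \oo --> (1 : R)%R.
Proof.
move=> uv v0; rewrite (_ : u = fun n => 1 + (u n - 1))%R; last first.
  by apply/funext => n; ring.
rewrite -[X in _ --> X]addr0; apply: cvgD; first exact: cvg_cst.
by apply: cvg0_le v0 => n; have /andP[? ?] := uv n; apply/andP; split; lra.
Qed.

Lemma cvg1_sub (u : nat -> R) : u @ \oo --> (1 : R)%R ->
  (fun n => u n - 1)%R @ \oo --> (0 : R)%R.
Proof. by move=> u1; rewrite -(subrr (1 : R)%R); apply: cvgB => //; exact: cvg_cst. Qed.

End Squeeze.

(** * Stability of the amalgam for permutations *)

Section PermutationCase.
Variables (R : realType) (H : finGroupType) (G1 G2 : groupType).
Variables (i1 : {multiplicative H -> G1}) (i2 : {multiplicative H -> G2}).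
Local Notation A := (amalgam i1 i2).

Lemma flexibly_P_stable_amalgam :
  flexibly_P_stable R G1 -> flexibly_P_stable R G2 ->
  almost_normal (range i1) -> almost_normal (range i2) -> flexibly_P_stable R A.
Proof.
move=> st1 st2 an1 an2 X phi X0 phiM.
have [|Y1 [j1 [a1 [j1I Y1c a1c]]]] := st1 X (fun n g => phi n (amalgam_inl i1 i2 g)) X0.
  by move=> g h; have := phiM (amalgam_inl i1 i2 g) (amalgam_inl i1 i2 h);
    rewrite -amalgam_inlM.
have [|Y2 [j2 [a2 [j2I Y2c a2c]]]] := st2 X (fun n g => phi n (amalgam_inr i1 i2 g)) X0.
  by move=> g h; have := phiM (amalgam_inr i1 i2 g) (amalgam_inr i1 i2 h);
    rewrite -amalgam_inrM.
pose bad1 g n := #|[set x | j1 n (phi n (amalgam_inl i1 i2 g) x) != a1 n g (j1 n x)]|.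
pose bad2 g n := #|[set x | j2 n (phi n (amalgam_inr i1 i2 g) x) != a2 n g (j2 n x)]|.
(* All errors on sizes and on H in one number; since H is finite, it is still negligible against
   [#|X n|]. *)
pose eta n := ((#|Y1 n| - #|X n|) + (#|Y2 n| - #|X n|) +
  (\sum_h bad1 (i1 h) n + \sum_h bad2 (i2 h) n))%N.
have [c cP] := P_step an1 an2.
have step n : exists (Z : finType) (J : X n -> Z) (psi : {multiplicative A -> {perm Z}}),
  [/\ injective J, (#|Z| <= #|X n| + c * eta n)%N,
      forall g, (#|[set x | J (phi n (amalgam_inl i1 i2 g) x) !=
        psi (amalgam_inl i1 i2 g) (J x)]| <= bad1 g n + c * eta n)%N
    & forall g, (#|[set x | J (phi n (amalgam_inr i1 i2 g) x) !=
        psi (amalgam_inr i1 i2 g) (J x)]| <= bad2 g n + c * eta n)%N].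
  have [x0 _|noX] := pickP (@predT (X n)); last first.
    by have := X0 n; rewrite (eq_card0 noX).
  have [||||||] := cP (X n) (Y1 n) (Y2 n) (eta n)
    (fun h => phi n (amalgam_inl i1 i2 (i1 h))) (j1 n) (j2 n) (a1 n) (a2 n) x0
    (@j1I n) (@j2I n).
  - by move=> g h; rewrite gmulfM.
  - by move=> g h; rewrite gmulfM.
  - by rewrite -leq_subLR /eta -!addnA leq_addr.
  - by rewrite -leq_subLR /eta -addnA (leq_trans (leq_addr _ _) (leq_addl _ _)).
  - move=> h; apply: (@leq_trans (bad1 (i1 h) n)) => //.
    by rewrite /eta (bigD1 h) //=; set b := (\sum_(_ | _ != _) _)%N; lia.
  - move=> h; rewrite amalgam_agree; apply: (@leq_trans (bad2 (i2 h) n)) => //.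
    rewrite /eta [X in (_ + (_ + X))%N](bigD1 h) //=.
    by set b := (\sum_(_ | _ != _) _)%N; lia.
  move=> Z [J [b1 [b2 [JI Ze [b1M b2M] b12 [b1E b2E]]]]].
  have [|||||psi [psiM psi1 psi2]] := @amalgam_lift H G1 G2 i1 i2 _
    *%g 1 (@mulgA {perm Z}) (@mul1g _) (@mulg1 _) b1 b2.
  - exact: b1M.
  - exact: b2M.
  - exact: action1.
  - exact: action1.
  - exact: b12.
  exists Z, J, (HB.pack_for {multiplicative A -> {perm Z}} psi
    (isMultiplicative.Build _ _ psi psiM)); split=> // g /=.
  - by rewrite psi1; exact: b1E.
  - by rewrite psi2; exact: b2E.
have [Z stepZ] := choice step.
pose J n := projT1 (cid (stepZ n)).
have stepJ n := projT2 (cid (stepZ n)).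
pose psi n := projT1 (cid (stepJ n)).
have stepP n := projT2 (cid (stepJ n)).
have eta0 : (fun n => (eta n)%:R / #|X n|%:R : R)%R @ \oo --> (0 : R)%R.
  have E n : ((eta n)%:R / #|X n|%:R = (#|Y1 n|%:R / #|X n|%:R - 1) +
      (#|Y2 n|%:R / #|X n|%:R - 1) + (\sum_h (bad1 (i1 h) n)%:R / #|X n|%:R +
      \sum_h (bad2 (i2 h) n)%:R / #|X n|%:R) :> R)%R.
    have n0 : (#|X n|%:R != 0 :> R)%R by rewrite pnatr_eq0 -lt0n.
    have XY1 : (#|X n| <= #|Y1 n|)%N by exact: leq_card (@j1I n).
    have XY2 : (#|X n| <= #|Y2 n|)%N by exact: leq_card (@j2I n).
    rewrite /eta !natrD !natrB // -!mulr_suml !natr_sum !mulrDl !mulNr divff //.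
  under eq_fun do rewrite E.
  apply: cvg0D; first by apply: cvg0D; exact: cvg1_sub.
  apply: cvg0D; apply: cvg0_sum => h.
    by have := a1c (i1 h); under eq_fun do rewrite card_mkset.
  by have := a2c (i2 h); under eq_fun do rewrite card_mkset.
exists Z, J, psi; split=> [n||].
- by have [] := stepP n.
- apply: (cvg1_le _ (cvg0M c%:R%R eta0)) => n; have [JI Ze _ _] := stepP n.
  have n0 : (0 < #|X n|%:R :> R)%R by rewrite ltr0n.
  rewrite ler_pdivlMr // mul1r ler_nat (leq_card _ JI) /= ler_pdivrMr //.
  rewrite mulrDl mul1r mulrA divfK ?gt_eqF // -natrM -natrD ler_nat.
  exact: Ze.
have badP (b : nat -> nat) (u : nat -> nat) :
    (fun n => (b n)%:R / #|X n|%:R : R)%R @ \oo --> (0 : R)%R ->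
    (forall n, (u n <= b n + c * eta n)%N) ->
    (fun n => (u n)%:R / #|X n|%:R : R)%R @ \oo --> (0 : R)%R.
  move=> b0 ub; apply: (cvg0_le _ (cvg0D b0 (cvg0M c%:R%R eta0))) => n.
  rewrite divr_ge0 //= mulrA -mulrDl ler_wpM2r ?invr_ge0 //.
  by rewrite -natrM -natrD ler_nat.
suff closeness g : (fun n => #|[set x | J n (phi n g x) != psi n g (J n x)]|%:R
    / #|X n|%:R : R)%R @ \oo --> (0 : R)%R.
  by move=> g; under eq_fun do rewrite card_mkset; exact: closeness.
(* An error at [a * b] comes from [phiM], from [a], or from [b] at the point [phi n a x]; the last
   ones are counted by pulling back along the permutation [phi n a]. *)
move: g; apply: amalgam_ind => [a b a0 b0|g|g].
- apply: (cvg0_le _ (cvg0D (phiM a b) (cvg0D a0 b0))) => n.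
  rewrite divr_ge0 //= /hamming_dist card_mkset -!mulrDl ler_wpM2r ?invr_ge0 //.
  rewrite -!natrD ler_nat; set B := [set x | _ != psi n b _].
  have -> : #|B| = #|phi n a @^-1: B| by rewrite card_preimset //; exact: perm_inj.
  apply: leq_trans (leq_add (leqnn _) (leq_card_setU _ _)).
  apply: leq_trans (leq_card_setU _ _).
  apply: subset_leq_card; apply/fintype.subsetP => x; rewrite !inE permM gmulfM permM.
  case: (eqVneq (phi n b _) _) => //= <-.
  by case: (eqVneq (J n (phi n a x)) _) => //= ->.
- apply: (badP (bad1 g)) => [|n]; last by have [_ _ + _] := stepP n; exact.
  by have := a1c g; under eq_fun do rewrite card_mkset.
- apply: (badP (bad2 g)) => [|n]; last by have [_ _ _] := stepP n; exact.
  by have := a2c g; under eq_fun do rewrite card_mkset.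
Qed.

End PermutationCase.

Local Open Scope classical_set_scope.
Local Open Scope ring_scope.

(** * Stability of the amalgam for unitaries *)

Section HilbertSchmidt.
Variable R : realType.
Local Notation C := R[i].

Lemma hs_normE d (A : 'M[C]_d) : hs_norm A = Num.sqrt (fro2 A / d%:R).
Proof. by []. Qed.

Lemma cvg_sqrt0 (u : nat -> R) : u @ \oo --> (0 : R) ->
  (fun n => Num.sqrt (u n)) @ \oo --> (0 : R).
Proof.
move=> u0; rewrite -[X in _ --> X]sqrtr0; apply: continuous_cvg => //.
exact: sqrt_continuous.
Qed.

Lemma cvg_hs_normP (d : nat -> nat) (A : forall n, 'M[C]_(d n)) :
  (fun n => hs_norm (A n)) @ \oo --> (0 : R) <->
  (fun n => fro2 (A n) / (d n)%:R) @ \oo --> (0 : R).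
Proof.
split=> [A0|]; last exact: cvg_sqrt0.
rewrite (_ : (fun _ => _) = fun n => hs_norm (A n) * hs_norm (A n)); last first.
  by apply/funext => n; rewrite -expr2 hs_normE sqr_sqrtr // divr_ge0 ?fro2_ge0.
by rewrite -[X in _ --> X](mulr0 (0 : R)); exact: cvgM.
Qed.

(** Passes from compressions to intertwining. Both [J *m phi] and [psi *m J] have squared norm [d],
    so their squared distance is [2 * ip phi D], and Cauchy-Schwarz applies. *)
Lemma almost_intertwiner_le d e (phi : 'M[C]_d) (J : 'M[C]_(e, d)) (psi : 'M[C]_e) :
  (0 < d)%N -> phi \is unitarymx -> psi \is unitarymx -> J^t* *m J = 1%:M ->
  fro2 (J *m phi - psi *m J) / d%:R <= 2 * hs_norm (phi - J^t* *m psi *m J).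
Proof.
move=> d0 uphi upsi JJ; set D := phi - _.
have d0R : 0 < d%:R :> R by rewrite ltr0n.
have fphi : fro2 phi = d%:R by rewrite fro2_iso // unitary_Kadj.
have -> : fro2 (J *m phi - psi *m J) = 2 * ip phi D.
  rewrite fro2B fro2_isol // fro2_unitl // (fro2_iso JJ) fphi.
  rewrite /D ipDr ipNr -[ip phi phi]/(fro2 phi) fphi.
  have -> : ip (J *m phi) (psi *m J) = ip phi (J^t* *m psi *m J).
    by rewrite /ip adjM !mulmxA.
  by ring.
rewrite -mulrA ler_wpM2l // ler_pdivrMr //.
have [ip0|ip0] := ltP (ip phi D) 0.
  by rewrite (le_trans (ltW ip0)) // mulr_ge0 ?sqrtr_ge0.
rewrite -(@ler_pXn2r _ 2) ?nnegrE ?mulr_ge0 ?sqrtr_ge0 //.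
rewrite exprMn sqr_sqrtr ?divr_ge0 ?fro2_ge0 //.
apply: (le_trans (CauchySchwarz_ip _ _)); rewrite fphi -/(fro2 D).
by rewrite [X in _ <= X](_ : _ = d%:R * fro2 D) //; field; rewrite gt_eqF.
Qed.

(** The trace of [psi] splits into that of its compression to the range of [J], compared with [phi]
    by Cauchy-Schwarz, and a contribution of the complement, of order [e - d]. *)
Lemma trace_compression_le d e (phi : 'M[C]_d) (J : 'M[C]_(e, d)) (psi : 'M[C]_e) :
  (0 < d)%N -> psi \is unitarymx -> J^t* *m J = 1%:M ->
  Normc.normc (\tr psi - \tr phi) / d%:R <= 2 * (e%:R / d%:R - 1) +
    2 * Num.sqrt (fro2 (J *m phi - psi *m J) / d%:R).
Proof.
move=> d0 upsi JJ; have [k [K sK]] := isometry_complement JJ.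
have [_ KK sumK] := sK; have dimK := split_iso_dim sK.
have d0R : 0 < d%:R :> R by rewrite ltr0n.
have -> : \tr psi - \tr phi = \tr (K^t* *m (psi *m K)) - \tr (J^t* *m (J *m phi - psi *m J)).
  rewrite -[psi in LHS]mulmx1 -sumK mulmxDr raddfD /= mulmxBr raddfB /=.
  rewrite [J^t* *m (J *m phi)]mulmxA JJ mul1mx.
  rewrite !mulmxA (mxtrace_mulC _ (J^t*)) (mxtrace_mulC _ (K^t*)) !mulmxA.
  by ring.
rewrite ler_pdivrMr // mulrDl -!mulrA mulrBl mul1r divfK ?gt_eqF //.
apply: (le_trans (le_normcD _ _)); rewrite normcN; apply: lerD.
  apply: (le_trans (normc_tr_le _ _)); rewrite fro2_unitl // fro2_iso //.
  by rewrite -expr2 sqrtr_sqr ger0_norm // -dimK natrD; lra.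
apply: (le_trans (normc_tr_le _ _)); rewrite fro2_iso // ler_wpM2l //.
set F := fro2 _; have F0 : 0 <= F by exact: fro2_ge0.
rewrite -(@ler_pXn2r _ 2) ?nnegrE ?mulr_ge0 ?sqrtr_ge0 //.
rewrite exprMn !sqr_sqrtr ?divr_ge0 ?mulr_ge0 //.
by rewrite [X in _ <= X](_ : _ = d%:R * F) //; field; rewrite gt_eqF.
Qed.

Lemma telescope3 (V : zmodType) (x y z t : V) :
  t - z = (x - y) + (y - z) + (t - x).
Proof. by rewrite subrKA [RHS]addrC subrKA. Qed.

Section HilbertSchmidtCase.
Variables (H : finGroupType) (G1 G2 : groupType).
Variables (i1 : {multiplicative H -> G1}) (i2 : {multiplicative H -> G2}).
Local Notation A := (amalgam i1 i2).

Lemma flexibly_HS_stable_amalgam :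
  flexibly_HS_stable R G1 -> flexibly_HS_stable R G2 ->
  almost_normal (range i1) -> almost_normal (range i2) -> flexibly_HS_stable R A.
Proof.
move=> st1 st2 an1 an2 d phi d0 uphi phiM.
have [||e1 [J1 [psi1 [JJ1 e1c u1 m1 c1]]]] :=
  st1 d (fun n g => phi n (amalgam_inl i1 i2 g)) d0.
- by move=> n g; exact: uphi.
- move=> g h; have := phiM (amalgam_inl i1 i2 g) (amalgam_inl i1 i2 h).
  by rewrite -amalgam_inlM.
have [||e2 [J2 [psi2 [JJ2 e2c u2 m2 c2]]]] :=
  st2 d (fun n g => phi n (amalgam_inr i1 i2 g)) d0.
- by move=> n g; exact: uphi.
- move=> g h; have := phiM (amalgam_inr i1 i2 g) (amalgam_inr i1 i2 h).
  by rewrite -amalgam_inrM.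
have d0R n : 0 < (d n)%:R :> R by rewrite ltr0n.
have de n e (J : 'M[C]_(e, d n)) : J^t* *m J = 1%:M -> (d n <= e)%N.
  by case/isometry_complement => k [K /split_iso_dim <-]; exact: leq_addr.
pose a1 g n := fro2 (J1 n *m phi n (amalgam_inl i1 i2 g) - psi1 n g *m J1 n).
pose a2 g n := fro2 (J2 n *m phi n (amalgam_inr i1 i2 g) - psi2 n g *m J2 n).
have a1c g : (fun n => a1 g n / (d n)%:R) @ \oo --> (0 : R).
  apply: (cvg0_le _ (cvg0M 2 (c1 g))) => n; rewrite divr_ge0 ?fro2_ge0 //=.
  exact: almost_intertwiner_le.
have a2c g : (fun n => a2 g n / (d n)%:R) @ \oo --> (0 : R).
  apply: (cvg0_le _ (cvg0M 2 (c2 g))) => n; rewrite divr_ge0 ?fro2_ge0 //=.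
  exact: almost_intertwiner_le.
pose t1 g n := Normc.normc (\tr (psi1 n g) - \tr (phi n (amalgam_inl i1 i2 g))).
pose t2 g n := Normc.normc (\tr (psi2 n g) - \tr (phi n (amalgam_inr i1 i2 g))).
have normc_ge0 (z : C) : 0 <= Normc.normc z by case: z => ? ?; exact: sqrtr_ge0.
have t1c g : (fun n => t1 g n / (d n)%:R) @ \oo --> (0 : R).
  apply: (cvg0_le _ (cvg0D (cvg0M 2 (cvg1_sub e1c)) (cvg0M 2 (cvg_sqrt0 (a1c g))))) => n.
  rewrite divr_ge0 ?normc_ge0 //=.
  exact: (trace_compression_le (phi n (amalgam_inl i1 i2 g)) (d0 n) (u1 n g) (JJ1 n)).
have t2c g : (fun n => t2 g n / (d n)%:R) @ \oo --> (0 : R).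
  apply: (cvg0_le _ (cvg0D (cvg0M 2 (cvg1_sub e2c)) (cvg0M 2 (cvg_sqrt0 (a2c g))))) => n.
  rewrite divr_ge0 ?normc_ge0 //=.
  exact: (trace_compression_le (phi n (amalgam_inr i1 i2 g)) (d0 n) (u2 n g) (JJ2 n)).
pose b h n := a1 (i1 h) n + a2 (i2 h) n + (t1 (i1 h) n + t2 (i2 h) n).
(* Besides the dimensions and the intertwining errors, [eta] includes the trace errors that
   [HS_step] requires. *)
pose eta n : R := ((e1 n)%:R - (d n)%:R) + ((e2 n)%:R - (d n)%:R) + \sum_h b h n.
have b0 h n : 0 <= b h n by rewrite !addr_ge0 ?fro2_ge0 ?normc_ge0.
have b_le h n : b h n <= \sum_h b h n by rewrite (bigD1 h) //= lerDl sumr_ge0.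
have e1_ge n : 0 <= (e1 n)%:R - (d n)%:R :> R by rewrite subr_ge0 ler_nat (de _ _ _ (JJ1 n)).
have e2_ge n : 0 <= (e2 n)%:R - (d n)%:R :> R by rewrite subr_ge0 ler_nat (de _ _ _ (JJ2 n)).
have sb0 n : 0 <= \sum_h b h n by apply: sumr_ge0.
have eta0 n : 0 <= eta n by apply: addr_ge0 => //; exact: addr_ge0.
have etac : (fun n => eta n / (d n)%:R) @ \oo --> (0 : R).
  have E n : eta n / (d n)%:R = ((e1 n)%:R / (d n)%:R - 1) + ((e2 n)%:R / (d n)%:R - 1)
      + \sum_h (a1 (i1 h) n / (d n)%:R + a2 (i2 h) n / (d n)%:R +
          (t1 (i1 h) n / (d n)%:R + t2 (i2 h) n / (d n)%:R)).
    rewrite /eta !mulrDl !mulNr divff ?gt_eqF // mulr_suml; congr (_ + _).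
    by apply: eq_bigr => h _; rewrite /b !mulrDl.
  under eq_fun do rewrite E.
  apply: cvg0D; first by apply: cvg0D; exact: cvg1_sub.
  apply: cvg0_sum => h; apply: cvg0D; first by apply: cvg0D; [exact: a1c|exact: a2c].
  by apply: cvg0D; [exact: t1c|exact: t2c].
have [c c_ge0 cP] := HS_step R an1 an2.
have step n : exists (f : nat) (J : 'M[C]_(f, d n)) (psi : A -> 'M[C]_f),
  [/\ J^t* *m J = 1%:M, f%:R <= (d n)%:R + c * eta n, urep psi,
      forall g, fro2 (J *m phi n (amalgam_inl i1 i2 g) - psi (amalgam_inl i1 i2 g) *m J)
        <= 4 * a1 g n + c * eta n
    & forall g, fro2 (J *m phi n (amalgam_inr i1 i2 g) - psi (amalgam_inr i1 i2 g) *m J)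
        <= 4 * a2 g n + c * eta n].
  have a1_le h : a1 (i1 h) n <= eta n.
    have := b_le h n; have := e1_ge n; have := e2_ge n; rewrite /eta /b.
    have := fro2_ge0 (J2 n *m phi n (amalgam_inr i1 i2 (i2 h)) - psi2 n (i2 h) *m J2 n).
    rewrite -/(a2 (i2 h) n); have := normc_ge0 (\tr (psi1 n (i1 h)) - \tr (phi n (amalgam_inl i1 i2 (i1 h)))).
    rewrite -/(t1 (i1 h) n); have := normc_ge0 (\tr (psi2 n (i2 h)) - \tr (phi n (amalgam_inr i1 i2 (i2 h)))).
    rewrite -/(t2 (i2 h) n); set s := \sum_h _; lra.
  have a2_le h : a2 (i2 h) n <= eta n.
    have := b_le h n; have := e1_ge n; have := e2_ge n; rewrite /eta /b.
    have := fro2_ge0 (J1 n *m phi n (amalgam_inl i1 i2 (i1 h)) - psi1 n (i1 h) *m J1 n).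
    rewrite -/(a1 (i1 h) n); have := normc_ge0 (\tr (psi1 n (i1 h)) - \tr (phi n (amalgam_inl i1 i2 (i1 h)))).
    rewrite -/(t1 (i1 h) n); have := normc_ge0 (\tr (psi2 n (i2 h)) - \tr (phi n (amalgam_inr i1 i2 (i2 h)))).
    rewrite -/(t2 (i2 h) n); set s := \sum_h _; lra.
  have t_le h : Normc.normc (\tr (psi1 n (i1 h)) - \tr (psi2 n (i2 h))) <= eta n.
    apply: (@le_trans _ _ (t1 (i1 h) n + t2 (i2 h) n)).
      rewrite /t1 /t2 -amalgam_agree; set x := \tr _; set y := \tr (psi2 _ _); set z := \tr _.
      by rewrite -(normcN (y - z)) opprB (le_trans _ (le_normcD _ _)) // addrA subrK.
    have := b_le h n; have := e1_ge n; have := e2_ge n; rewrite /eta /b.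
    have := fro2_ge0 (J1 n *m phi n (amalgam_inl i1 i2 (i1 h)) - psi1 n (i1 h) *m J1 n).
    rewrite -/(a1 (i1 h) n).
    have := fro2_ge0 (J2 n *m phi n (amalgam_inr i1 i2 (i2 h)) - psi2 n (i2 h) *m J2 n).
    rewrite -/(a2 (i2 h) n); set s := \sum_h _; lra.
  have [||||f [J [P1 [P2 [Ji fle [uP1 uP2] P12 [P1E P2E]]]]]] := cP (d n) (e1 n) (e2 n) (eta n)
    (fun h => phi n (amalgam_inl i1 i2 (i1 h))) (J1 n) (J2 n) (psi1 n) (psi2 n)
    (eta0 n) (JJ1 n) (JJ2 n) (conj (u1 n) (m1 n)) (conj (u2 n) (m2 n)) _ _ _ a1_le _ t_le.
  - by have := e2_ge n; have := sb0 n; rewrite /eta; lra.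
  - by have := e1_ge n; have := sb0 n; rewrite /eta; lra.
  - by move=> h; exact: uphi.
  - by move=> h; rewrite amalgam_agree; exact: a2_le.
  have [|||||psi [psiM psiE1 psiE2]] := @amalgam_lift H G1 G2 i1 i2 _
    (@mulmx C f f f) 1%:M (@mulmxA C f f f f) (@mul1mx C f f) (@mulmx1 C f f) P1 P2.
  - exact: uP1.2.
  - exact: uP2.2.
  - exact: urep1.
  - exact: urep1.
  - exact: P12.
  exists f, J, psi; split=> // [|g|g].
  - split=> //; apply: amalgam_ind => [g h ug uh|g|g].
    + by rewrite psiM mul_unitarymx.
    + by rewrite psiE1; exact: uP1.1.
    + by rewrite psiE2; exact: uP2.1.
  - by rewrite psiE1; apply: P1E; exact: uphi.
  - by rewrite psiE2; apply: P2E; exact: uphi.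
have [f stepf] := choice step.
pose J n := projT1 (cid (stepf n)).
have stepJ n := projT2 (cid (stepf n)).
pose psi n := projT1 (cid (stepJ n)).
have stepP n := projT2 (cid (stepJ n)).
have JJ n : (J n)^t* *m J n = 1%:M by have [] := stepP n.
have upsi n : urep (psi n) by have [] := stepP n.
exists f, J, psi; split=> [//||n|n|].
- apply: (cvg1_le _ (cvg0M c etac)) => n; have [_ fle _ _ _] := stepP n.
  rewrite ler_pdivlMr // mul1r ler_nat (de _ _ _ (JJ n)) /= ler_pdivrMr //.
  by rewrite mulrDl mul1r mulrA divfK ?gt_eqF.
- exact: (upsi n).1.
- exact: (upsi n).2.
(* Closeness is proved in the form [J phi] near [psi J], which passes to products, unlike closeness
   of compressions; multiplication by the adjoint of [J] recovers the latter. *)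
suff close g : (fun n => fro2 (J n *m phi n g - psi n g *m J n) / (d n)%:R) @ \oo --> (0 : R).
  move=> g; apply/cvg_hs_normP; apply: cvg0_le (close g) => n.
  rewrite divr_ge0 ?fro2_ge0 //= ler_wpM2r ?invr_ge0 //.
  have -> : phi n g - (J n)^t* *m psi n g *m J n =
      (J n)^t* *m (J n *m phi n g - psi n g *m J n).
    by rewrite mulmxBr !mulmxA JJ mul1mx.
  exact: fro2_adjiso_le.
move: g; apply: amalgam_ind => [g h g0 h0|g|g].
- have gh0 := (cvg_hs_normP (fun n => phi n g *m phi n h - phi n (g * h)%g)).1 (phiM g h).
  apply: (cvg0_le _ (cvg0D (cvg0M 2 gh0) (cvg0D (cvg0M 4 g0) (cvg0M 4 h0)))) => n.
  rewrite divr_ge0 ?fro2_ge0 //= !mulrA -!mulrDl ler_wpM2r ?invr_ge0 //.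
  have -> : J n *m phi n (g * h)%g - psi n (g * h)%g *m J n =
      (J n *m phi n g - psi n g *m J n) *m phi n h
      + psi n g *m (J n *m phi n h - psi n h *m J n)
      - J n *m (phi n g *m phi n h - phi n (g * h)%g).
    rewrite (upsi n).2 !mulmxBr !mulmxBl !mulmxA opprB.
    exact: telescope3.
  apply: (le_trans (fro2B_le _ _)); rewrite fro2_isol // addrC lerD2l.
  have := fro2D_le ((J n *m phi n g - psi n g *m J n) *m phi n h)
    (psi n g *m (J n *m phi n h - psi n h *m J n)).
  by rewrite fro2_unitr // fro2_unitl; [lra | exact: (upsi n).1].
- apply: (cvg0_le _ (cvg0D (cvg0M 4 (a1c g)) (cvg0M c etac))) => n.
  rewrite divr_ge0 ?fro2_ge0 //= !mulrA -mulrDl ler_wpM2r ?invr_ge0 //.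
  by have [_ _ _ + _] := stepP n; exact.
- apply: (cvg0_le _ (cvg0D (cvg0M 4 (a2c g)) (cvg0M c etac))) => n.
  rewrite divr_ge0 ?fro2_ge0 //= !mulrA -mulrDl ler_wpM2r ?invr_ge0 //.
  by have [_ _ _ _] := stepP n; exact.
Qed.

End HilbertSchmidtCase.

End HilbertSchmidt.

Theorem theorem6 (R : realType) (C : stability_class) (G1 G2 : groupType)
    (H : finGroupType)
    (i1 : {multiplicative H -> G1}) (i2 : {multiplicative H -> G2}) :
  finitely_generated G1 -> finitely_generated G2 ->
  flexibly_stable R C G1 -> flexibly_stable R C G2 ->
  injective i1 -> injective i2 ->
  almost_normal (range i1) -> almost_normal (range i2) ->
  flexibly_stable R C (amalgam i1 i2).
Proof.
move=> _ _ st1 st2 _ _; case: C st1 st2 => st1 st2.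
  exact: flexibly_HS_stable_amalgam.
exact: flexibly_P_stable_amalgam.
Qed.
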